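(* Let $K=76$. There exists an integer $N$ such that, for all integers $n$ and $d$ with $N\leq n<d$ and every real number $t$ belonging to $$ \Biggl[0,\gamma^--\frac{K}{n}\Biggr]\cup\Biggl[\gamma^-+\frac{K}{n},\gamma^+-\frac{K}{n}\Biggr]\cup\Biggl[\gamma^++\frac{K}{n},\sqrt{\frac{\log n}{6}}\Biggr], $$ the following holds: considering the hyperplanes $H$ of $\mathbb{R}^d$ whose distance to the center of $[0,1]^d$ is equal to $t$, the $(d-1)$-dimensional volume of $H\cap[0,1]^d$ is never locally extremal (even weakly so) when $H$ is orthogonal to a diagonal of an $n$-dimensional face of $[0,1]^d$.
   Context: The numbers $\gamma^\pm$ are $\gamma^\pm=\frac{1}{2}\sqrt{1\pm\sqrt{2/3}}$ (the non-negative roots of $1-24t^2+48t^4$). Local extremality is understood as follows. The number $t$ is fixed and the volume is considered a function of the hyperplane. By the symmetries of the hypercube, one may consider only the hyperplanes $H_a=\{x\in\mathbb{R}^d:a\cdot x=\sigma(a)/2-t\}$ where $a$ belongs to $\mathbb{S}^{d-1}\cap[0,+\infty[^d$ and $\sigma(a)$ is the sum of the coordinates of $a$. Let $V(a)$ be the $(d-1)$-dimensional volume of $H_a\cap[0,1]^d$. A diagonal of a face is a segment joining two opposite vertices of that face; $H_a$ is orthogonal to a diagonal of an $n$-dimensional face of $[0,1]^d$ when $a$ has $n$ coordinates equal to $1/\sqrt{n}$ and $d-n$ coordinates equal to $0$ (up to symmetry of the hypercube). The volume is not locally extremal, even weakly so, at $H_a$ if every neighborhood of $a$ in $\mathbb{S}^{d-1}\cap[0,+\infty[^d$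 contains points $b$ and $b'$ with $V(b)<V(a)<V(b')$. *)

(* Defs.v *)
From HB Require Import structures.
From mathcomp Require Import all_boot all_order all_algebra.
From mathcomp Require Import all_classical all_reals all_analysis.

Set Implicit Arguments.
Unset Strict Implicit.
Unset Printing Implicit Defensive.

Import Order.TTheory GRing.Theory Num.Theory.
Import numFieldNormedType.Exports.

Local Open Scope classical_set_scope.
Local Open Scope ring_scope.

Definition dot (R : realType) (d : nat) (x y : 'rV[R]_d) : R :=
  \sum_(i < d) x 0 i * y 0 i.

Definition cube (R : realType) (d : nat) : set 'rV[R]_d :=
  [set x | forall i, 0 <= x 0 i <= 1].

Definition sphere_orthant (R : realType) (d : nat) : set 'rV[R]_d :=
  [set a | dot a a = 1 /\ forall i, 0 <= a 0 i].

(* H_a: since the center of the cube is (1/2, ..., 1/2), this hyperplane is at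
   distance |t| from it when a is a unit vector. *)
Definition hyperplane (R : realType) (d : nat) (t : R) (a : 'rV[R]_d) :
    set 'rV[R]_d :=
  [set x | dot a x = (\sum_(i < d) a 0 i) / 2 - t].

(* The m-dimensional Lebesgue measure as the m-fold product of the Lebesgue
   measure on R: the measure of A is the integral of the measures of its
   sections, as in the library's product_measure1. On R^0 it is the Dirac
   measure at the unique point. *)
Fixpoint lebesgue_rV (R : realType) (m : nat) : set 'rV[R]_m -> \bar R :=
  match m with
  | 0 => fun A => (\1_A 0)%:E
  | m'.+1 => fun A =>
      (\int[@lebesgue_measure R]_x
         lebesgue_rV [set y : 'rV[R]_m' | A (row_mx (x%:M : 'rV[R]_1) y)])%E
  end.

(* The rows of B are an orthonormal basis of the direction of H and p is a
   point of H, so that y |-> p + y B is an isometry from R^(d-1) onto H. *)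
Definition isometric_chart (R : realType) (d : nat) (H : set 'rV[R]_d)
    (pB : 'rV[R]_d * 'M[R]_(d.-1, d)) : Prop :=
  pB.2 *m pB.2^T = 1%:M /\ range (fun y : 'rV[R]_d.-1 => pB.1 + y *m pB.2) = H.

(* The (d-1)-dimensional volume of a subset S of a hyperplane H: the Lebesgue
   measure of S once H is isometrically identified with R^(d-1). The value does
   not depend on the chart because the Lebesgue measure is invariant under
   isometries. *)
Definition hyperplane_volume (R : realType) (d : nat) (H S : set 'rV[R]_d) :
    \bar R :=
  let pB := xget (0, 0) (isometric_chart H) in
  lebesgue_rV [set y : 'rV[R]_d.-1 | S (pB.1 + y *m pB.2)].

Definition section_volume (R : realType) (d : nat) (t : R) (a : 'rV[R]_d) :
    \bar R :=
  hyperplane_volume (hyperplane t a) (hyperplane t a `&` @cube R d).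

Definition cube_vertex (R : realType) (d : nat) (v : 'rV[R]_d) : Prop :=
  forall i, v 0 i = 0 \/ v 0 i = 1.

(* Two vertices p and q that differ in exactly n coordinates are opposite in the
   n-dimensional face of the cube on which the other coordinates are equal to
   their common values in p and q, and all pairs of opposite vertices of an
   n-dimensional face are of this form. *)
Definition face_diagonal (R : realType) (d n : nat) (p q : 'rV[R]_d) : Prop :=
  [/\ cube_vertex p, cube_vertex q & #|[set i : 'I_d | p 0 i != q 0 i]%SET| = n].

Definition orthogonal_to_face_diagonal (R : realType) (d n : nat)
    (H : set 'rV[R]_d) : Prop :=
  exists p q : 'rV[R]_d, face_diagonal n p q /\
    forall x y, H x -> H y -> dot (x - y) (p - q) = 0.

Definition not_weakly_locally_extremal (R : realType) (d : nat)
    (X : set 'rV[R]_d) (V : 'rV[R]_d -> \bar R) (a : 'rV[R]_d) : Prop :=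
  forall U : set 'rV[R]_d, nbhs a U ->
    exists b b' : 'rV[R]_d,
      [/\ (X `&` U) b, (X `&` U) b', (V b < V a)%E & (V a < V b')%E].

Definition gamma_minus (R : realType) : R :=
  2^-1 * Num.sqrt (1 - Num.sqrt (2 / 3)).

Definition gamma_plus (R : realType) : R :=
  2^-1 * Num.sqrt (1 + Num.sqrt (2 / 3)).

(* Main.v *)
Require Import Defs.
From HB Require Import structures.
From mathcomp Require Import all_boot all_order all_algebra.
From mathcomp Require Import all_classical all_reals all_analysis.
From mathcomp Require Import measurable_realfun zify ring lra.

(** Put [r = sqrt n] and [x = - r t].

    _The volume is a spline._  An isometric chart of the hyperplane can be
    replaced by its parametrisation by all coordinates but one, the Jacobian
    being a coordinate of the unit normal ([section_volume_graph]).  Integrating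
    the indicator function of the cube over these coordinates one at a time, each
    integration is a central difference of a primitive.  Hence, if [b] is the unit
    vector [c / l] completed by zero coordinates, where [c] has [k] positive
    entries, the volume at [b] is [l / (c_1 ... c_k)] times the value at [- l t] of
    the differences with steps [c_1, ..., c_k] of the truncated power of degree
    [k - 1] ([section_volume_spline], [section_volume_homogeneous]).  At the
    diagonal the volume is [r M(x)], where [M] is the density of the sum of [n]
    independent variables that are uniform on [[-1/2, 1/2]].

    _Two competing perturbations._  The diagonal [(1, ..., 1, 0, ..., 0) / r] is
    approached by giving a small value [h] to a zero coordinate (this is where
    [n < d] is used), and by replacing two coordinates 1, 1 by [(p + q) / 2] and
    [(p - q) / 2] with [p^2 + q^2 = 4].  To second order in [h] and [q] the volume
    changes by a positive multiple of [tail_slope n x] and of [pair_slope n x]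
    ([tail_variation], [pair_variation]).  If these two numbers have opposite
    signs, then the volume takes larger and smaller values near the diagonal.

    _Signs of the slopes._  Let [F_k] be the [k]-th derivative of [t |-> r M(- r t)].
    Taylor expansions give, up to [O(n^-2)],
      [r^5 tail_slope / n = F_4 / 720 - F_6 / (42 * 720 n)],
      [r^5 pair_slope = - F_4 / 720 + F_6 / (21 * 720 n)]
    ([slopes_expansion]), so that it suffices to know that [|F_4|] exceeds
    [|F_6| / (21 n) + C / n^2] ([slopes_opposite], [density_separation]).

    _The size of [F_4]._  As [n] grows, [F_0] approaches a multiple of
    [exp(- 6 t^2)] and [F_4] approaches [432 (48 t^4 - 24 t^2 + 1) F_0], which
    vanishes at [gamma_minus] and [gamma_plus].  The terms in [1 / n] matter near
    these roots.  They come from the recurrence of splines, which yields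
      [F_(k+1) + 12 t F_k + 12 k F_(k-1) = F_(k+3) / (60 n) + O(n^-2)]
    ([density_ode]).  For [t <= 7 / 10] these equations express [F_4] and [F_6]
    through [F_0] with explicit coefficients, and since the quartic is at least
    [100 / n] in absolute value at distance [76 / n] from its roots
    ([quartic_gap]), its contribution outweighs the other terms
    ([separation_near]).  For [t >= 7 / 10] the quartic is large and errors of
    order [1 / n] are harmless as long as they are small compared with [t F_0]
    ([separation_far]); this holds because [6 t^2 <= ln n] means that [exp(- 6 t^2)]
    is at least [1 / n], while the errors made in comparing [F_0] with the Gaussian
    are [O(1 / (n t))] ([gauss_compare]).  The Gaussian is compared with [F_0] by
    means of the differential equation for [k = 0] only, and [F_0 0] is bounded
    below by the total mass 1 ([mass_le]).

    _Uniform bounds._  All this rests on bounds for the [F_k] that do not depend on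
    [n] and [t] ([spline_bound]).  A difference with step 1 is twice a difference
    with step 1/2 of an average over two points.  By homogeneity, the [n]-fold
    difference is therefore a [k]-fold difference of a bounded function averaged
    about [n] times, and a difference of an [m]-fold average of a bounded function
    is [O(1 / sqrt m)] ([cdiff1_iter_avg4_le]). *)

Set Implicit Arguments.
Unset Strict Implicit.
Unset Printing Implicit Defensive.

Import Order.TTheory GRing.Theory Num.Theory.
Import numFieldNormedType.Exports.

Local Open Scope classical_set_scope.
Local Open Scope ring_scope.

(** * Volumes of slices of the cube by parametrised flats *)

(** Pushing the Lebesgue measure forward by an affine map multiplies the
    measure of every half-open interval by the same constant, and a measure that is
    determined by these values is a multiple of the Lebesgue measure. *)
Lemma integral_lebesgue_affine {R : realType} (k c : R) (f : R -> \bar R) :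
  k != 0 -> measurable_fun [set: R] f -> (forall x, (0 <= f x)%E) ->
  (\int[@lebesgue_measure R]_x f (k * x + c)%R =
   (`|k|^-1)%:E * \int[@lebesgue_measure R]_x f x)%E.
Proof.
move=> k0 mf f0.
have mphi : measurable_fun [set: R] (fun x : R => k * x + c : measurableTypeR R).
  by apply: measurable_funD => //; exact: measurable_funM.
set phi : R -> measurableTypeR R := fun x => k * x + c.
have nk0 : 0 <= `|k|^-1 by rewrite invr_ge0.
pose mu := @lebesgue_measure R.
have mphi' : measurable_fun setT phi by [].
have nk : 0 <= `|k| by [].
pose pf : {measure set (measurableTypeR R) -> \bar R} :=
  pushforward mu (phi : measurableTypeR R -> measurableTypeR R).
have pE A : measurable A -> mu A = (`|k|%:E * pushforward mu phi A)%E.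
  move=> mA.
  have H := @lebesgue_measure_unique R (mscale (NngNum nk) (pf mphi)).
  rewrite [LHS]H//; last first.
  move=> _ [[a b] _ <-].
  rewrite -[RHS]/(`|k|%:E * mu (phi @^-1` `]a, b]))%E.
  have kp : 0 < `|k| by rewrite normr_gt0.
  have [kpos|kneg] : (0 < k) \/ (k < 0) by apply/orP; rewrite orbC -neq_lt.
  - have -> : phi @^-1` `]a, b] = `](a - c) / k, (b - c) / k]%classic.
      apply/seteqP; split => x /=; rewrite !in_itv/= /phi ltr_pdivrMr// ler_pdivlMr//.
        by move=> /andP[? ?]; apply/andP; split; nra.
      by move=> /andP[? ?]; apply/andP; split; nra.
    rewrite /mu !lebesgue_measure_itv/= !lte_fin ltr_pM2r ?invr_gt0// ltrD2r.
    case: ifPn => ab; last by rewrite mule0.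
    by rewrite gtr0_norm// -!EFinD -EFinM; congr EFin; field.
  - have -> : phi @^-1` `]a, b] = `[(b - c) / k, (a - c) / k[%classic.
      apply/seteqP; split => x /=; rewrite !in_itv/= /phi ltr_ndivlMr// ler_ndivrMr//.
        by move=> /andP[? ?]; apply/andP; split; nra.
      by move=> /andP[? ?]; apply/andP; split; nra.
    rewrite /mu !lebesgue_measure_itv/= !lte_fin ltr_nM2r ?invr_lt0// ltrD2r.
    case: ifPn => ab; last by rewrite mule0.
    by rewrite ltr0_norm// -!EFinD -EFinM; congr EFin; field.
have <- : (\int[pushforward mu phi]_x f x =
          \int[mu]_x f (k * x + c)%R)%E.
  by rewrite ge0_integral_pushforward.
rewrite -(@ge0_integral_mscale _ _ _ mu _ measurableT (NngNum nk0)) //.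
apply: eq_measure_integral => A mA _.
rewrite -[RHS]/((`|k|^-1)%:E * mu A)%E pE// muleA -EFinM mulVf ?normr_eq0// mul1e.
by [].
Qed.

Section cube_flat_volume.
Variables (R : realType) (r : nat).
Implicit Types (p l : 'rV[R]_r) (ls : seq 'rV[R]_r).

(** The measure of the coefficients [y] such that [p + sum_i y_i l_i] lies in
    the cube, for [ls] the sequence of the [l_i].  As an iterated integral over a
    sequence of vectors it can be permuted and sheared one vector at a time. *)
Fixpoint flat_volume ls : 'rV[R]_r -> \bar R :=
  match ls with
  | [::] => fun p => (\1_(@cube R r) p)%:E
  | l :: ls' => fun p => (\int[@lebesgue_measure R]_x flat_volume ls' (p + x *: l)%R)%E
  end.

Lemma flat_volume_cons l ls p : flat_volume (l :: ls) p =
  (\int[@lebesgue_measure R]_x flat_volume ls (p + x *: l)%R)%E.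
Proof. by []. Qed.

Lemma flat_volume_ge0 ls p : (0 <= flat_volume ls p)%E.
Proof.
elim: ls p => [|l ls IH] p /=; first by rewrite lee_fin.
by apply: integral_ge0 => x _; exact: IH.
Qed.

(** By induction on the rows, each step being the measurability part of the
    theorem of Fubini and Tonelli; the base point has to depend on a parameter for
    the induction to go through. *)
Lemma measurable_flat_volume ls d (T : measurableType d) (f : T -> 'rV[R]_r) :
  (forall i, measurable_fun setT (fun u => f u 0 i)) ->
  measurable_fun setT (fun u => flat_volume ls (f u)).
Proof.
elim: ls d T f => [|l ls IH] d T f mf /=.
  apply/measurable_EFinP.
  have -> : (fun u => \1_(@cube R r) (f u) : R) = \1_(f @^-1` @cube R r).
    by apply/funext => u; rewrite !indicE; congr (_%:R); congr nat_of_bool;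
      apply/idP/idP; rewrite !inE.
  apply: measurable_indic.
  have -> : f @^-1` @cube R r =
      \bigcap_(i in [set: 'I_r]) (fun u => f u 0 i) @^-1` `[0, 1].
    apply/seteqP; split => u /= H.
      by move=> i _ /=; rewrite in_itv/=; exact: H.
    by move=> i; have := H i I; rewrite /= in_itv.
  apply: fin_bigcap_measurable => // i _.
  by rewrite -[X in measurable X]setTI; exact: mf.
pose g (z : T * R) := flat_volume ls (f z.1 + z.2 *: l).
have mg : measurable_fun setT g.
  apply: IH => i.
  have -> : (fun u : T * R => (f u.1 + u.2 *: l) 0 i) =
      (fun u : T * R => f u.1 0 i + u.2 * l 0 i).
    by apply/funext => u; rewrite !mxE.
  apply: measurable_funD.
    exact: (measurableT_comp (mf i)).
  by apply: measurable_funM.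
apply: (measurable_fun_fubini_tonelli_F (m2 := @lebesgue_measure R) g mg).
by move=> z; exact: flat_volume_ge0.
Qed.

Lemma measurable_flat_volume_line ls p l :
  measurable_fun [set: R] (fun x : R => flat_volume ls (p + x *: l)).
Proof.
apply: (@measurable_flat_volume ls _ R (fun x => p + x *: l)) => i.
have -> : (fun u => (p + u *: l) 0 i) = (fun u : R => p 0 i + u * l 0 i).
  by apply/funext => u; rewrite !mxE.
by apply: measurable_funD => //; exact: measurable_funM.
Qed.

Lemma flat_volume_shift_head l ls p c :
  flat_volume (l :: ls) (p + c *: l) = flat_volume (l :: ls) p.
Proof.
rewrite /= -[RHS]mul1e.
have := @integral_lebesgue_affine R 1 c (fun x => flat_volume ls (p + x *: l)).
rewrite normr1 invr1 => <- //.
- by apply: eq_integral => x _; rewrite mul1r scalerDl addrA addrAC.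
- exact: measurable_flat_volume_line.
- by move=> x; exact: flat_volume_ge0.
Qed.

(** Moving the base point along a row translates one of the variables. *)
Lemma flat_volume_shift ls p c l : l \in ls ->
  flat_volume ls (p + c *: l) = flat_volume ls p.
Proof.
elim: ls p => // l' ls IH p; rewrite inE => /predU1P[->|lls].
  exact: flat_volume_shift_head.
rewrite !flat_volume_cons; apply: eq_integral => x _; rewrite addrAC; exact: IH.
Qed.

Lemma flat_volume_swap l1 l2 ls p :
  flat_volume [:: l1, l2 & ls] p = flat_volume [:: l2, l1 & ls] p.
Proof.
rewrite /=.
pose g (z : R * R) := flat_volume ls (p + z.1 *: l1 + z.2 *: l2).
have mg : measurable_fun setT g.
  apply: measurable_flat_volume => i.
  have -> : (fun u : R * R => (p + u.1 *: l1 + u.2 *: l2) 0 i) =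
      (fun u : R * R => p 0 i + u.1 * l1 0 i + u.2 * l2 0 i).
    by apply/funext => u; rewrite !mxE.
  by apply: measurable_funD; [apply: measurable_funD|];
    try exact: measurable_funM.
have := @fubini_tonelli _ _ _ _ _ (@lebesgue_measure R) (@lebesgue_measure R) g mg
  (fun z => flat_volume_ge0 _ _).
move=> /= ->.
by apply: eq_integral => y _; apply: eq_integral => x _; rewrite /g/= addrAC.
Qed.

Lemma flat_volume_rcons l ls p :
  flat_volume (l :: ls) p = flat_volume (rcons ls l) p.
Proof.
elim: ls p => // l' ls IH p; rewrite flat_volume_swap.
by apply: eq_integral => x _; exact: IH.
Qed.

Lemma flat_volume_shear_rcons l (ps : seq ('rV[R]_r * R)) p :
  flat_volume (rcons [seq q.1 + q.2 *: l | q <- ps] l) p =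
  flat_volume (rcons [seq q.1 | q <- ps] l) p.
Proof.
elim: ps p => // q ps IH p; rewrite !rcons_cons !flat_volume_cons.
apply: eq_integral => x _; rewrite IH scalerDr addrA scalerA.
by rewrite [LHS]flat_volume_shift // mem_rcons mem_head.
Qed.

(** Once the integration along [l] is moved innermost, the multiples of [l]
    added to the other rows are translations of its variable. *)
Lemma flat_volume_shear l (ps : seq ('rV[R]_r * R)) p :
  flat_volume (l :: [seq q.1 + q.2 *: l | q <- ps]) p =
  flat_volume (l :: [seq q.1 | q <- ps]) p.
Proof. by rewrite !flat_volume_rcons flat_volume_shear_rcons. Qed.

End cube_flat_volume.

Definition rows {R : Type} {m r : nat} (L : 'M[R]_(m, r)) : seq 'rV[R]_r :=
  [seq row i L | i <- enum 'I_m].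

Lemma rows_col_mx {R : Type} m r (l : 'rV[R]_r) (L : 'M[R]_(m, r)) :
  rows (col_mx l L : 'M[R]_(1 + m, r)) = l :: rows L.
Proof.
rewrite /rows enum_ordSl /= -map_comp; congr cons.
  by apply/rowP => j; rewrite !mxE; case: splitP => // i _; rewrite ord1.
apply: eq_map => i /=; apply/rowP => j; rewrite !mxE.
case: splitP => [k /= ik|k /= ik]; first by have := ltn_ord k; rewrite -ik.
by congr (L _ j); apply: val_inj; move: ik => /= [].
Qed.

Lemma flat_volume_shift_rows {R : realType} m r (L : 'M[R]_(m, r)) (w : 'rV[R]_m)
    ls p : {subset rows L <= ls} ->
  flat_volume ls (p + w *m L) = flat_volume ls p.
Proof.
move=> sL; rewrite mulmx_sum_row.
suff H (s : seq 'I_m) : flat_volume ls (p + \sum_(i <- s) w 0 i *: row i L) =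
    flat_volume ls p by exact: H.
elim: s => [|i s IH]; first by rewrite big_nil addr0.
rewrite big_cons addrCA addrC flat_volume_shift// sL//.
by apply/mapP; exists i => //; rewrite mem_enum.
Qed.

Section mulmx.
Variables (R : realType) (r : nat).

(** The change of variables formula for one matrix [G].  It has to be
    quantified over [L] and [p] to be stable under products. *)
Let scales m (G : 'M[R]_m) := forall (L : 'M[R]_(m, r)) p,
  flat_volume (rows (G *m L)) p = ((`|\det G|^-1)%:E * flat_volume (rows L) p)%E.

Let scales_mul m (G H : 'M[R]_m) : scales G -> scales H -> scales (G *m H).
Proof.
move=> sG sH L p; rewrite -mulmxA sG sH muleA -EFinM det_mulmx normrM.
by rewrite invfM.
Qed.

Let scales_upper m (a : R) (v : 'rV[R]_m) (G : 'M[R]_m) : a != 0 ->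
  scales G -> scales (block_mx a%:M v 0 G).
Proof.
move=> a0 sG L p.
rewrite -(vsubmxK (L : 'M[R]_(1 + m, r))) mul_block_col mul0mx add0r.
set l := usubmx _; set L' := dsubmx _.
rewrite !rows_col_mx !flat_volume_cons det_ublock det_scalar expr1.
transitivity (\int[@lebesgue_measure R]_x ((`|\det G|^-1)%:E *
    flat_volume (rows L') (p + (a * x + 0) *: l)%R)%E)%E.
  apply: eq_integral => x _; rewrite sG; congr (_ * _)%E.
  rewrite addr0 scalerDr (scalemxAl x v) addrA flat_volume_shift_rows//.
  by rewrite mul_scalar_mx scalerA (mulrC x).
have mline : measurable_fun [set: R] (fun x : R =>
    flat_volume (rows L') (p + (a * x + 0) *: l)).
  apply: measurable_flat_volume => i.
  have -> : (fun u => (p + (a * u + 0) *: l) 0 i) = (fun u : R => p 0 i + (a * u + 0) * l 0 i).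
    by apply/funext => u; rewrite !mxE.
  apply: measurable_funD => //; apply: measurable_funM => //.
  by apply: measurable_funD => //; exact: measurable_funM.
rewrite ge0_integralZl //; first last.
  by move=> x _; exact: flat_volume_ge0.
rewrite (@integral_lebesgue_affine R a 0 (fun x => flat_volume (rows L') (p + x *: l)))//.
- by rewrite muleA -EFinM normrM invfM mulrC.
- exact: measurable_flat_volume_line.
- by move=> x; exact: flat_volume_ge0.
Qed.

Let scales_lower m (u : 'cV[R]_m) : scales (block_mx 1%:M 0 u 1%:M).
Proof.
move=> L p.
rewrite -(vsubmxK (L : 'M[R]_(1 + m, r))) mul_block_col !mul1mx mul0mx addr0.
set l := usubmx _; set L' := dsubmx _.
rewrite !rows_col_mx det_lblock !det1 mulr1 normr1 invr1 mul1e.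
pose ps := [seq (row i L', u i 0) | i <- enum 'I_m].
have -> : rows (u *m l + L') = [seq q.1 + q.2 *: l | q <- ps].
  rewrite /rows /ps -[RHS]map_comp; apply: eq_map => i /=.
  apply/rowP => j; rewrite !mxE big_ord1 addrC; congr (_ + _ * _).
  by rewrite /l !mxE; congr (L _ j); apply: val_inj.
have -> : rows L' = [seq q.1 | q <- ps] by rewrite /ps -map_comp.
exact: flat_volume_shear.
Qed.

Let scales_pivot m (G : 'M[R]_(1 + m)) : (forall H : 'M[R]_m, H \in unitmx -> scales H) ->
  G \in unitmx -> G 0 0 != 0 -> scales G.
Proof.
move=> IH uG g0.
pose a := G 0 0; pose u := dlsubmx G; pose v := ursubmx G.
pose H := drsubmx G - (a^-1 *: u) *m v.
have GE : G = block_mx 1%:M 0 (a^-1 *: u) 1%:M *m block_mx a%:M v 0 H.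
  rewrite mulmx_block !mul1mx !mul0mx ?mulmx0 ?addr0 ?add0r.
  rewrite /H addrC subrK mul_mx_scalar scalerA divff// scale1r.
  rewrite -[LHS]submxK; congr block_mx.
  rewrite [LHS]mx11_scalar; congr (_%:M); rewrite /a !mxE.
  by congr (G _ _); apply: val_inj.
rewrite GE; apply: scales_mul; first exact: scales_lower.
apply: scales_upper => //; apply: IH.
move: uG; rewrite GE unitmx_mul => /andP[_].
by rewrite unitmxE det_ublock unitrM -unitmxE => /andP[_]; rewrite -unitmxE.
Qed.

(** By induction on the size of [G].  When its corner is nonzero, [G] is the
    product of a lower unipotent block matrix, which shears the other rows by the
    first one, and of an upper triangular block matrix, which rescales the first
    variable up to translations. *)
Lemma flat_volume_mulmx m (G : 'M[R]_m) (L : 'M[R]_(m, r)) p : G \in unitmx ->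
  flat_volume (rows (G *m L)) p = ((`|\det G|^-1)%:E * flat_volume (rows L) p)%E.
Proof.
move=> uG; move: L p; rewrite -/(scales G); elim: m G uG => [|m IH] G uG.
  move=> L p; rewrite det_mx00 normr1 invr1 mul1e; congr flat_volume.
  by rewrite (flatmx0 (G *m L)) (flatmx0 L).
have [g0|] := eqVneq (G 0 0) 0; last exact: scales_pivot.
(* A column of an invertible matrix has a nonzero entry, which a row operation
   adds to the corner. *)
have [i gi0] : exists i : 'I_m, G (lift ord0 i) 0 != 0.
  apply/existsP; apply: contraLR uG; rewrite negb_exists => /forallP Gi.
  rewrite unitmxE unitfE negbK (expand_det_col _ 0) big1// => i _.
  case: (unliftP ord0 i) => [j ->|->]; last by rewrite g0 mul0r.
  by have /negPn/eqP -> := Gi j; rewrite mul0r.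
pose E c : 'M[R]_(1 + m) := block_mx 1%:M (c *: delta_mx 0 i) 0 1%:M.
have sE c : scales (E c).
  apply: scales_upper; first exact: oner_neq0.
  by move=> L p; rewrite mul1mx det1 normr1 invr1 mul1e.
have EK : E (-1) *m E 1 = 1%:M.
  rewrite mulmx_block !mul1mx !mul0mx !mulmx0 mulmx1 addr0 !add0r.
  by rewrite scale1r scaleN1r subrr -scalar_mx_block.
have -> : G = E (-1) *m (E 1 *m G) by rewrite mulmxA EK mul1mx.
apply: scales_mul => //; apply: scales_pivot => //.
  by rewrite unitmx_mul uG andbT unitmxE det_ublock !det1 mulr1 unitr1.
rewrite mxE big_ord_recl (bigD1 i)//= big1 ?addr0.
  rewrite g0 mulr0 add0r /E /block_mx !mxE; case: splitP => // j _.
  rewrite !mxE; case: splitP => [k /= ik|k /= [ik]].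
    by have := ltn_ord k; rewrite -ik.
  have -> : k = i by apply: val_inj.
  by rewrite !mxE (ord1 j) !eqxx mulr1 mul1r.
move=> j ji; rewrite /E /block_mx !mxE; case: splitP => // k _.
rewrite !mxE; case: splitP => [k' /= ik|k' /= [ik]].
  by have := ltn_ord k'; rewrite -ik.
have -> : k' = j by apply: val_inj.
by rewrite !mxE (negbTE ji) andbF mulr0 mul0r.
Qed.
End mulmx.

(** * Charts of a hyperplane *)

(** Links the measure of a preimage under an affine map to the iterated
    integral along the rows of its matrix. *)
Lemma lebesgue_rV_flat {R : realType} m r (p : 'rV[R]_r) (L : 'M[R]_(m, r)) :
  lebesgue_rV [set y : 'rV[R]_m | cube (p + y *m L)] = flat_volume (rows L) p.
Proof.
elim: m p L => [|m IH] p L.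
  rewrite /rows (size0nil (s := enum 'I_0)) /= ?size_enum_ord// !indicE.
  congr (_%:R%:E); congr nat_of_bool.
  apply/idP/idP; rewrite !inE /= mul0mx addr0 //.
rewrite -[L in RHS](@vsubmxK _ 1 m) rows_col_mx flat_volume_cons.
apply: eq_integral => x _; rewrite -IH; congr lebesgue_rV.
have E (y : 'rV[R]_m) : p + row_mx (x%:M : 'rV[R]_1) y *m (L : 'M[R]_(1 + m, r)) =
    p + x *: usubmx (L : 'M[R]_(1 + m, r)) + y *m dsubmx (L : 'M[R]_(1 + m, r)).
  by rewrite -[in LHS](vsubmxK (L : 'M[R]_(1 + m, r))) mul_row_col mul_scalar_mx addrA.
by apply/seteqP; split => y; rewrite /mkset E.
Qed.

Lemma dotE {R : realType} d (x y : 'rV[R]_d) : (dot x y)%:M = x *m y^T.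
Proof.
rewrite [RHS]mx11_scalar; congr (_%:M); rewrite mxE; apply: eq_bigr => i _.
by rewrite mxE.
Qed.

Lemma dot_mulmx {R : realType} d (x y : 'rV[R]_d) : dot x y = (x *m y^T) 0 0.
Proof. by rewrite -dotE mxE eqxx mulr1n. Qed.

Lemma dotC {R : realType} d (x y : 'rV[R]_d) : dot x y = dot y x.
Proof. by apply: eq_bigr => i _; rewrite mulrC. Qed.

(** The rows of the Householder reflection that exchanges [a] and the first
    basis vector. *)
Lemma exists_orthogonal_first_row {R : realType} d (a : 'rV[R]_(1 + d)) :
  dot a a = 1 -> exists B : 'M[R]_(d, 1 + d),
    (col_mx a B : 'M[R]_(1 + d)) *m (col_mx a B)^T = 1%:M.
Proof.
move=> a1.
suff: exists O : 'M[R]_(1 + d), O *m O^T = 1%:M /\ usubmx O = a.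
  case=> O [OO aE].
  by exists (dsubmx O); rewrite -aE vsubmxK.
pose e : 'rV[R]_(1 + d) := delta_mx 0 0.
have eM (O : 'M[R]_(1 + d)) : usubmx O = e *m O.
  rewrite -rowE; apply/rowP => j; rewrite !mxE; congr (O _ _); exact: val_inj.
have ee : dot e e = 1.
  rewrite /dot (bigD1 0)//= big1 ?addr0; first by rewrite !mxE eqxx mulr1.
  by move=> i i0; rewrite !mxE (negbTE i0) mulr0.
have [->|ae] := eqVneq a e.
  by exists 1%:M; rewrite eM trmx1 !mulmx1.
pose v := a - e; pose q := dot v v.
have ea : dot e a = a 0 0.
  rewrite /dot (bigD1 0)//= big1 ?addr0; first by rewrite !mxE eqxx mul1r.
  by move=> i i0; rewrite !mxE (negbTE i0) mul0r.
have vE : e *m v^T = (dot e a - 1)%:M.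
  by rewrite linearB /= mulmxBr -!dotE ee -raddfB.
have qE : q = 2 - 2 * dot e a.
  rewrite /q dot_mulmx /v linearB /= mulmxBr !mulmxBl -!dotE !mxE !eqxx !mulr1n.
  by rewrite a1 ee (dotC a e); ring.
have q0 : q != 0.
  rewrite /q; apply: contra ae => /eqP H; rewrite -subr_eq0 -/v.
  apply/eqP/rowP => i; rewrite [RHS]mxE.
  have v2 j : (j \in index_enum 'I_(1 + d)) -> true -> 0 <= v 0 j * v 0 j.
    by move=> _ _; rewrite -expr2 sqr_ge0.
  have /eqP := @psumr_eq0P _ _ _ _ (fun j _ => v2 j (mem_index_enum j) isT) H i isT.
  by rewrite mulf_eq0 orbb => /eqP.
(* The reflection along v = a - e is 1 - (2 / q) V. *)
pose V := v^T *m v.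
have VV : V *m V = q *: V.
  by rewrite /V mulmxA -[v^T *m v *m v^T]mulmxA -dotE -/q mul_mx_scalar -scalemxAl.
have VT : V^T = V by rewrite /V trmx_mul trmxK.
exists (1%:M - (2 / q) *: V); split.
  have -> : (1%:M - (2 / q) *: V)^T = 1%:M - (2 / q) *: V.
    by rewrite [LHS]raddfB /= trmx1; congr (_ - _); rewrite [LHS]linearZ /= VT.
  have key : ((2 / q) *: V) *m ((2 / q) *: V) = (2 / q) *: V + (2 / q) *: V.
    rewrite -scalemxAl -scalemxAr VV !scalerA -scalerDl; congr (_ *: _).
    by field.
  rewrite mulmxBr !mulmxBl !mul1mx !mulmx1 key.
  by move: (_ *: V) => A; rewrite opprB addrK subrK.
rewrite eM mulmxBr mulmx1 -scalemxAr /V mulmxA vE mul_scalar_mx scalerA.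
have -> : 2 / q * (dot e a - 1) = -1.
  by rewrite qE; field; rewrite -qE.
by rewrite scaleN1r opprK /v addrC subrK.
Qed.

Section charts.
Variables (R : realType) (d : nat).
Implicit Types (a p : 'rV[R]_d.+1) (B : 'M[R]_(d, d.+1)).

(** Together with [exists_orthogonal_first_row], ensures that the chart
    selected in [hyperplane_volume] is a genuine one. *)
Lemma orthogonal_completion_chart a (B : 'M[R]_(d, 1 + d)) t :
  (col_mx a B : 'M[R]_(1 + d)) *m (col_mx a B)^T = 1%:M ->
  isometric_chart (hyperplane t a) (((\sum_i a 0 i) / 2 - t) *: a, B).
Proof.
move=> OO.
have /esym := OO; rewrite tr_col_mx mul_col_row scalar_mx_block.
move=> /eq_block_mx[/esym aa /esym aB /esym Ba BB].
split => //=.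
have c (y : 'rV[R]_d) u : dot a (u *: a + y *m B) = u.
  rewrite dot_mulmx linearD /= trmx_mul linearZ /= mulmxDr -scalemxAr aa mulmxA aB.
  by rewrite mul0mx addr0 !mxE eqxx mulr1.
apply/seteqP; split => x /=.
  by move=> [y _ <-]; rewrite /hyperplane /= c.
rewrite /hyperplane /= => ax; exists (x *m B^T) => //=.
have /mulmx1C : (col_mx a B : 'M[R]_(1 + d)) *m (col_mx a B)^T = 1%:M by [].
rewrite tr_col_mx mul_row_col => H.
rewrite -[RHS]mulmx1 -H mulmxDr !mulmxA; congr (_ + _).
by rewrite -dotE dotC ax mul_scalar_mx.
Qed.

Lemma chart_orthogonal a p B t : dot a a = 1 ->
  isometric_chart (hyperplane t a) (p, B) ->
  [/\ (col_mx a B : 'M[R]_(1 + d)) *m (col_mx a B)^T = 1%:M,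
      dot a p = (\sum_i a 0 i) / 2 - t & forall y, hyperplane t a (p + y *m B)].
Proof.
move=> a1 [/= BB rH].
have inH y : hyperplane t a (p + y *m B) by rewrite -rH; exists y.
have ap : dot a p = (\sum_i a 0 i) / 2 - t.
  by have := inH 0; rewrite mul0mx addr0 /hyperplane.
split => //.
have aB : a *m B^T = 0.
  rewrite -[LHS]trmxK trmx_mul trmxK; apply/eqP; rewrite trmx_eq0; apply/eqP.
  apply/row_matrixP => i; rewrite row0 rowE mulmxA.
  have H : dot (p + (delta_mx 0 i : 'rV[R]_d) *m B) a = dot p a.
    by rewrite dotC [dot p a]dotC ap; exact: inH.
  have E : ((delta_mx 0 i : 'rV[R]_d) *m B *m a^T) 0 0 = 0.
    move: (congr1 (fun z => z - dot p a) H).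
    by rewrite !dot_mulmx mulmxDl mxE addrAC !subrr add0r.
  by rewrite [LHS]mx11_scalar E raddf0.
rewrite tr_col_mx mul_col_row scalar_mx_block BB aB.
rewrite -dotE a1; congr block_mx.
by rewrite -[LHS]trmxK trmx_mul trmxK aB trmx0.
Qed.

(** The direction of the hyperplane as the graph of coordinate [i0] over the
    other coordinates. *)
Definition graph_rows (i0 : 'I_d.+1) a : 'M[R]_(d, d.+1) :=
  \matrix_(j, k) ((k == lift i0 j)%:R - (k == i0)%:R * (a 0 (lift i0 j) / a 0 i0)).

Lemma orthogonal_graph_rows (i0 : 'I_d.+1) a m (B : 'M[R]_(m, d.+1)) : a 0 i0 != 0 ->
  B *m a^T = 0 -> B = col' i0 B *m graph_rows i0 a.
Proof.
move=> a0 Ba; apply/matrixP => r k; rewrite mxE.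
case: (unliftP i0 k) => [j ->|->].
  rewrite (bigD1 j)//= big1 ?addr0.
    by rewrite !mxE eqxx [lift _ _ == _]eq_sym (negbTE (neq_lift _ _)) mul0r subr0 mulr1.
  move=> j' jj; rewrite !mxE (inj_eq lift_inj) eq_sym (negbTE jj).
  by rewrite eq_sym (negbTE (neq_lift _ _)) mul0r subr0 mulr0.
have /rowP/(_ 0) : row r (B *m a^T) = 0 by rewrite Ba row0.
rewrite !mxE (bigD1_ord i0)//= => /eqP; rewrite addr_eq0 !mxE => /eqP H.
apply: (mulIf a0); rewrite H -sumrN mulr_suml; apply: eq_bigr => j _.
rewrite !mxE (negbTE (neq_lift _ _)) eqxx mul1r sub0r mulrN mulNr -mulrA.
by rewrite divfK.
Qed.

(** The matrix with rows [a] and [B] is orthogonal, so that it coincides up to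
    sign with its matrix of cofactors. *)
Lemma chart_minor (i0 : 'I_d.+1) a (B : 'M[R]_(d, d.+1)) : 0 <= a 0 i0 ->
  (col_mx a B : 'M[R]_(1 + d)) *m (col_mx a B)^T = 1%:M ->
  `|\det (col' i0 B)| = a 0 i0.
Proof.
move=> a0 OO; set O := (col_mx a B : 'M[R]_(1 + d)) in OO.
have dO : `|\det O| = 1.
  have /(congr1 determinant) := OO; rewrite det_mulmx det_tr det1 -expr2.
  by move/(congr1 Num.sqrt); rewrite sqrtr_sqr sqrtr1.
have dO0 : \det O != 0 by rewrite -normr_eq0 dO oner_neq0.
have OT : O^T = (\det O)^-1 *: \adj O.
  have OA := mul_mx_adj O.
  have : O^T *m (O *m \adj O) = O^T *m (\det O)%:M by rewrite OA.
  rewrite mulmxA (mulmx1C OO) mul1mx mul_mx_scalar => ->.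
  by rewrite scalerA mulVf// scale1r.
have B' : row' 0 (col' i0 O) = col' i0 B.
  apply/matrixP => i j; rewrite !mxE; case: splitP => [k /= ik|k /= [ik]].
    by have := ltn_ord k; rewrite -ik.
  by congr (B _ _); apply: val_inj.
have O0 : O 0 i0 = a 0 i0.
  by rewrite mxE; case: splitP => // j _; rewrite ord1.
rewrite -[RHS]ger0_norm// -O0.
have <- : O^T i0 0 = O 0 i0 by rewrite mxE.
rewrite OT !mxE /cofactor B' !normrM normfV dO invr1 mul1r.
by rewrite normrX normrN1 expr1n mul1r.
Qed.

(** Whatever the selected chart is, it differs from the parametrisation as a
    graph by the minor computed in [chart_minor], and its base point only translates
    the parameters. *)
Lemma section_volume_graph (i0 : 'I_d.+1) a t : dot a a = 1 -> 0 < a 0 i0 ->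
  section_volume t a = (((a 0 i0)^-1)%R%:E *
    flat_volume (rows (graph_rows i0 a))
      ((((\sum_i a 0 i) / 2 - t) / a 0 i0) *: delta_mx 0 i0)%R)%E.
Proof.
move=> a1 a0; have a0' : a 0 i0 != 0 by rewrite gt_eqF.
rewrite /section_volume /hyperplane_volume.
have [B0 OO0] := @exists_orthogonal_first_row _ d a a1.
have : isometric_chart (hyperplane t a) (xget (0, 0) (isometric_chart (hyperplane t a))).
  by apply: (@xgetPex _ _ (isometric_chart _)); eexists; exact: orthogonal_completion_chart OO0.
case: xget => p B /(chart_orthogonal a1)[OO ap inH] /=.
have -> : [set y | (hyperplane t a `&` cube (d:=d.+1)) (p + y *m B)] =
    [set y | cube (p + y *m B)].
  apply/seteqP; split => y /=; first by case.
  by move=> ?; split => //; exact: inH.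
rewrite lebesgue_rV_flat.
have aB : B *m a^T = 0.
  have := OO; rewrite tr_col_mx mul_col_row scalar_mx_block.
  by move=> /eq_block_mx[_ _ -> _].
rewrite [in LHS](orthogonal_graph_rows a0' aB) flat_volume_mulmx; last first.
  by rewrite unitmxE unitfE -normr_eq0 (chart_minor (ltW a0) OO) gt_eqF.
rewrite (chart_minor (ltW a0) OO); congr (_ * _)%E.
set q := (_ / a 0 i0).
have -> : p = q *: delta_mx 0 i0 + col' i0 (p - q *: delta_mx 0 i0) *m graph_rows i0 a.
  apply/eqP; rewrite addrC -subr_eq; apply/eqP; apply: orthogonal_graph_rows => //.
  rewrite mulmxBl -scalemxAl -rowE -dotE dotC ap.
  by apply/rowP => j; rewrite ord1 !mxE eqxx mulr1n divfK// subrr.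
by rewrite flat_volume_shift_rows.
Qed.
End charts.

(** * Derivatives, central differences and truncated powers *)

Section derivatives.
Variable R : realType.
Implicit Types (f g df dg : R -> R).

(** A total function together with its derivative, in the form in which
    splines provide them. *)
Definition derivative f df := forall x : R, is_derive x 1 f (df x).

Lemma derivative_continuous f df : derivative f df -> continuous f.
Proof.
by move=> fdf x; apply/differentiable_continuous/derivable1_diffP; case: (fdf x).
Qed.

Lemma derivative_ext f g df dg : f =1 g -> df =1 dg -> derivative f df ->
  derivative g dg.
Proof. by move=> /funext -> /funext ->. Qed.

Lemma derivative_mean f df a b : derivative f df -> a <= b ->
  exists c, [/\ a <= c, c <= b & f b - f a = df c * (b - a)].
Proof.
move=> fdf ab.
have [c] := @MVT_segment R f df a b ab (fun x _ => fdf x)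
  (continuous_subspaceT (derivative_continuous fdf)).
by rewrite in_itv /= => /andP[? ?] ?; exists c.
Qed.

Lemma derivativeD f g df dg : derivative f df -> derivative g dg ->
  derivative (fun x => f x + g x) (fun x => df x + dg x).
Proof. by move=> fdf gdg x; exact: (@is_deriveD _ _ _ f g x 1 _ _ (fdf x) (gdg x)). Qed.

Lemma derivativeM f g df dg : derivative f df -> derivative g dg ->
  derivative (fun x => f x * g x) (fun x => df x * g x + f x * dg x).
Proof.
move=> fdf gdg x.
apply: is_derive_eq (is_deriveM (fdf x) (gdg x)) _.
by rewrite addrC [in RHS]mulrC.
Qed.

Lemma derivative_cst (c : R) : derivative (fun=> c) (fun=> 0).
Proof. by move=> x; exact: is_derive_cst. Qed.

Lemma derivative_id : derivative (fun x => x) (fun=> 1).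
Proof. by move=> x; exact: is_derive_id. Qed.

Lemma derivativeZ k f df : derivative f df ->
  derivative (fun x => k * f x) (fun x => k * df x).
Proof.
move=> fdf; apply: derivative_ext (derivativeM (derivative_cst k) fdf) => // x.
by rewrite mul0r add0r.
Qed.

Lemma derivativeB f g df dg : derivative f df -> derivative g dg ->
  derivative (fun x => f x - g x) (fun x => df x - dg x).
Proof. by move=> fdf gdg x; exact: (@is_deriveB _ _ _ f g x 1 _ _ (fdf x) (gdg x)). Qed.

Lemma derivative_comp f g df dg : derivative f df -> derivative g dg ->
  derivative (fun x => f (g x)) (fun x => df (g x) * dg x).
Proof. by move=> fdf gdg x; exact: (is_derive1_comp (fdf (g x)) (gdg x)). Qed.

Lemma derivative_affine f df (k c : R) : derivative f df ->
  derivative (fun x => f (k * x + c)) (fun x => k * df (k * x + c)).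
Proof.
move=> fdf.
have H : derivative (fun x => k * x + c) (fun=> k).
  apply: derivative_ext (derivativeD (derivativeZ k derivative_id) (derivative_cst c)) => // x.
  by rewrite mulr1 addr0.
by apply: derivative_ext (derivative_comp fdf H) => // x; rewrite mulrC.
Qed.

End derivatives.

Section differences.
Variable R : realType.
Implicit Types (f g : R -> R) (h x : R) (ws : seq R).

(** Central difference with step [h]. *)
Definition cdiff h f x := f (x + h / 2) - f (x - h / 2).

Definition cdiffs ws f := foldr cdiff f ws.

Lemma derivative_cdiff h f df : derivative f df -> derivative (cdiff h f) (cdiff h df).
Proof.
move=> fdf; apply: derivativeB.
  apply: derivative_ext (derivative_affine 1 (h / 2) fdf) => x; rewrite !mul1r //.
apply: derivative_ext (derivative_affine 1 (- (h / 2)) fdf) => x; rewrite !mul1r //.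
Qed.

Lemma derivative_cdiffs ws f df : derivative f df ->
  derivative (cdiffs ws f) (cdiffs ws df).
Proof. by move=> fdf; elim: ws => // h ws IH; exact: derivative_cdiff. Qed.

Lemma continuous_affine_comp k (c : R) f : continuous f ->
  continuous (fun x => f (k * x + c)).
Proof.
move=> cf x; apply: (@continuous_comp _ _ _ (fun y : R => k * y + c) f); last exact: cf.
have := derivativeD (derivativeZ k (derivative_id (R := R))) (derivative_cst c).
by move=> /derivative_continuous; exact.
Qed.

Lemma continuous_cdiff h f : continuous f -> continuous (cdiff h f).
Proof.
move=> cf x; apply: (@continuousB _ _ _ (fun y => f (y + h / 2)) (fun y => f (y - h / 2))).
  have := @continuous_affine_comp 1 (h / 2) f cf x.
  by under [X in continuous_at _ X -> _]eq_fun do rewrite mul1r.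
have := @continuous_affine_comp 1 (- (h / 2)) f cf x.
by under [X in continuous_at _ X -> _]eq_fun do rewrite mul1r.
Qed.

Lemma continuous_cdiffs ws f : continuous f -> continuous (cdiffs ws f).
Proof. by move=> cf; elim: ws => // h ws IH; exact: continuous_cdiff. Qed.

Lemma cdiffC h h' f : cdiff h (cdiff h' f) = cdiff h' (cdiff h f).
Proof.
apply/funext => x; rewrite /cdiff.
rewrite (addrAC x (h / 2)) (addrAC x (h / 2)) (addrAC x (- (h / 2))).
rewrite (addrAC x (- (h / 2)) (- (h' / 2))); ring.
Qed.

Lemma cdiffs_cat ws ws' f : cdiffs (ws ++ ws') f = cdiffs ws (cdiffs ws' f).
Proof. by rewrite /cdiffs foldr_cat. Qed.

Lemma cdiffs_perm ws ws' f : perm_eq ws ws' -> cdiffs ws f = cdiffs ws' f.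
Proof.
elim: ws ws' => [|h ws IH] ws' pws.
  by have -> : ws' = [::] by apply/perm_nilP; rewrite perm_sym.
have hws' : h \in ws' by rewrite -(perm_mem pws) mem_head.
have pw : perm_eq ws (rem h ws').
  by rewrite -(perm_cons h) (perm_trans pws)// perm_to_rem.
rewrite /= (IH _ pw).
elim: ws' hws' {pws pw IH} => // a s IH; rewrite inE /=.
have [->//|ah /= hs] := eqVneq a h.
by rewrite cdiffC (IH hs).
Qed.

End differences.

Section truncated_powers.
Variable R : realType.
Implicit Types x : R.

(** Truncated powers, normalised so that each is the derivative of the next. *)
Definition tpow (k : nat) x : R := Num.max x 0 ^+ k / k`!%:R.

Lemma tpow_neg k x : x <= 0 -> tpow k.+1 x = 0.
Proof. by move=> x0; rewrite /tpow max_r// expr0n mul0r. Qed.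

Lemma tpow_pos k x : 0 <= x -> tpow k x = x ^+ k / k`!%:R.
Proof. by move=> x0; rewrite /tpow max_l. Qed.

Lemma tpow_mulr k x : x * tpow k.+1 x = k.+2%:R * tpow k.+2 x.
Proof.
have [x0|x0] := leP x 0; first by rewrite !tpow_neg// !mulr0.
have f0 : k.+1`!%:R != 0 :> R by rewrite pnatr_eq0 -lt0n fact_gt0.
have k0 : k.+2%:R != 0 :> R by rewrite pnatr_eq0.
rewrite !tpow_pos ?ltW// [k.+2`!]factS natrM [x ^+ k.+2]exprS.
by move: (_%:R) (_%:R) f0 k0 => F K F0 K0; field; rewrite F0 K0.
Qed.

Lemma tpow_scale k l x : 0 <= l -> tpow k (l * x) = l ^+ k * tpow k x.
Proof.
move=> l0; rewrite /tpow mulrA -exprMn maxr_pMr// mulr0 //.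
Qed.

Lemma continuous_tpow k : continuous (tpow k.+1).
Proof.
have c1 : continuous (fun y : R => Num.max y 0).
  move=> y; apply: (@continuous_max _ _ (fun y : R => y : R^o) (fun=> 0 : R^o)) => //.
  exact: cst_continuous.
have c2 : continuous (fun z : R => z ^+ k.+1 / k.+1`!%:R).
  move=> z; apply: (@continuousM _ _ (fun y : R => y ^+ k.+1) (fun=> k.+1`!%:R^-1)).
    exact: exprn_continuous.
  exact: cst_continuous.
by move=> x; exact: (continuous_comp (c1 x) (c2 _)).
Qed.

Lemma derivative_exp k :
  derivative (fun x : R => x ^+ k.+1 / k.+1`!%:R) (fun x => x ^+ k / k`!%:R).
Proof.
elim: k => [|k IH].
  apply: (derivative_ext _ _ (derivative_id (R := R))) => x; first by rewrite expr1 divr1.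
  by rewrite expr0 fact0 divr1.
have f0 m : m`!%:R != 0 :> R by rewrite pnatr_eq0 -lt0n fact_gt0.
have k0 : k.+2%:R != 0 :> R by rewrite pnatr_eq0.
apply: derivative_ext (derivativeZ (k.+2%:R^-1)
  (derivativeM (derivative_id (R := R)) IH)) => x /=.
  rewrite [k.+2`!]factS natrM [x ^+ k.+2]exprS.
  have := f0 k.+1; move: (_%:R) (_%:R) k0 => K F K0 F0.
  by field; rewrite F0 K0.
rewrite factS natrM [x ^+ k.+1]exprS.
have k1 : k.+1%:R != 0 :> R by rewrite pnatr_eq0.
move: k0 k1 (f0 k); rewrite -[in X in X -> _]addn1 natrD -[k.+2]addn1 natrD.
move: (k`!%:R) (k.+1%:R) => F K K0 K1 F0.
by field; rewrite F0 K1 K0.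
Qed.

(** Only the origin needs care: there the difference quotient is [tpow k.+1]
    up to a constant factor, which is continuous. *)
Lemma derivative_tpow k : derivative (tpow k.+2) (tpow k.+1).
Proof.
move=> x; have [x0|x0|->] := ltgtP x 0.
- rewrite tpow_neg ?ltW//.
  apply: near_eq_is_derive (derivative_cst 0 x).
  have xI : x \in `]-oo, 0[ by rewrite in_itv.
  by apply: filterS (near_in_itvNyo xI) => y; rewrite in_itv/= => y0; rewrite tpow_neg ?ltW.
- rewrite tpow_pos ?ltW//; apply: near_eq_is_derive (derivative_exp k.+1 x).
  have xI : x \in `]0, +oo[ by rewrite in_itv/= andbT.
  apply: filterS (near_in_itvoy xI) => y; rewrite in_itv/= andbT => y0.
  by rewrite tpow_pos ?ltW.
- rewrite tpow_neg//; apply/is_derive1_caratheodory.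
  exists (fun z => tpow k.+1 z / k.+2%:R); split.
  + move=> z; rewrite [tpow _ 0]tpow_neg// !subr0 mulrAC [_ * z]mulrC tpow_mulr.
    by rewrite mulrAC divff ?mul1r// pnatr_eq0.
  + apply: (@continuousM _ _ (tpow k.+1) (fun=> k.+2%:R^-1)).
      exact: continuous_tpow.
    exact: cst_continuous.
  + by rewrite tpow_neg// mul0r.
Qed.

End truncated_powers.

(** * The section volume as a spline *)

Section slab.
Variable R : realType.
Implicit Types (w : seq R) (al z h : R).

(** For [w] of size [m], the measure of the points [y] of the [m]-dimensional
    cube such that [z - w . y] lies in [[0, al]]. *)
Fixpoint slab al w z : \bar R :=
  match w with
  | [::] => (\1_(`[0, al]%classic) z)%:E
  | h :: w' => (\int[@lebesgue_measure R]_(x in `[0%R, 1%R]) slab al w' (z - h * x)%R)%E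
  end.

(** In the parametrisation as a graph each parameter is itself a coordinate, so
    that the cube restricts the parameters to a cube and coordinate [i0] to a slab. *)
Lemma flat_volume_slab d (i0 : 'I_d.+1) (a : 'rV[R]_d.+1) q : 0 < a 0 i0 ->
  flat_volume (rows (graph_rows i0 a)) (q *: delta_mx 0 i0) =
  slab (a 0 i0) [seq a 0 (lift i0 j) | j <- enum 'I_d] (a 0 i0 * q).
Proof.
move=> a0.
(* For part of the rows, the coordinates that belong to the other rows are those of
   the base point and have to lie in the unit interval. *)
suff H (s : seq 'I_d) (p : 'rV[R]_d.+1) : uniq s -> (forall j, j \in s -> p 0 (lift i0 j) = 0) ->
    flat_volume [seq row j (graph_rows i0 a) | j <- s] p =
    if [forall j, (j \in s) || (0 <= p 0 (lift i0 j) <= 1)]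
    then slab (a 0 i0) [seq a 0 (lift i0 j) | j <- s] (a 0 i0 * p 0 i0) else 0%E.
  rewrite /rows H ?enum_uniq//; last first.
    by move=> j _; rewrite !mxE eq_sym (negbTE (neq_lift _ _)) andbF mulr0.
  rewrite ifT; last by apply/forallP => j; rewrite mem_enum.
  by rewrite !mxE !eqxx mulr1.
elim: s p => [|j s IH] p.
  move=> _ _ /=; rewrite !indicE mem_setE in_itv/=.
  have -> : (p \in cube (d:=d.+1)) = [forall i, 0 <= p 0 i <= 1].
    apply/idP/forallP; first by rewrite inE.
    by move=> ?; rewrite inE.
  have -> : [forall i, 0 <= p 0 i <= 1] =
      [forall j, 0 <= p 0 (lift i0 j) <= 1] && (0 <= p 0 i0 <= 1).
    apply/forallP/andP => [H|[/forallP H H0] i]; last first.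
      by case: (unliftP i0 i) => [j ->|->].
    by split => //; apply/forallP => j; exact: H.
  have -> : (0 <= a 0 i0 * p 0 i0 <= a 0 i0) = (0 <= p 0 i0 <= 1).
    by rewrite pmulr_rge0// ger_pMr.
  by case: ifPn => ?; rewrite ?andbF ?andTb.
move=> /= /andP[js us] p0.
pose G := [forall k, (k \in j :: s) || (0 <= p 0 (lift i0 k) <= 1)].
pose z := a 0 i0 * p 0 i0; pose b := a 0 (lift i0 j); pose al := a 0 i0.
pose w := [seq a 0 (lift i0 j) | j <- s].
transitivity (\int[@lebesgue_measure R]_(x in `[0%R, 1%R])
  if G then slab al w (z - b * x)%R else 0)%E.
  rewrite [RHS]integral_mkcond; apply: eq_integral => x _.
  rewrite IH//; last first.
    move=> k ks; rewrite !mxE p0 ?inE ?ks ?orbT// eq_sym (inj_eq lift_inj) .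
    have /negbTE -> : j != k by apply: contraNneq js => ->.
    by rewrite eq_sym (negbTE (neq_lift _ _)) mul0r subr0 mulr0 addr0.
  have E1 : (p + x *: row j (graph_rows i0 a)) 0 i0 = p 0 i0 - x * (a 0 (lift i0 j) / a 0 i0).
    by rewrite !mxE eqxx (negbTE (neq_lift _ _)) sub0r mul1r mulrN.
  have E2 k : (p + x *: row j (graph_rows i0 a)) 0 (lift i0 k) =
      if k == j then x else p 0 (lift i0 k).
    rewrite !mxE (inj_eq lift_inj) eq_sym [_ == i0]eq_sym (negbTE (neq_lift _ _)).
    rewrite mul0r subr0 [j == k]eq_sym; case: eqP => [->|_]; rewrite ?mulr0 ?addr0//.
    by rewrite p0 ?mem_head// add0r mulr1.
  have E3 : [forall k, (k \in s) || (0 <= (p + x *: row j (graph_rows i0 a)) 0 (lift i0 k) <= 1)]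
     = G && (0 <= x <= 1).
    apply/forallP/andP => [H|[/forallP H x01] k].
      split; last by have := H j; rewrite E2 eqxx (negbTE js).
      apply/forallP => k; have := H k; rewrite E2 inE.
      by case: eqVneq => //= _; case: (k \in s).
    have := H k; rewrite E2 inE; case: eqVneq => [-> _|_ //=].
    by rewrite x01 orbT.
  rewrite E3 E1 patchE mem_setE in_itv /=.
  rewrite mulrBr mulrCA [_ / _]mulrC mulVKf ?gt_eqF// [x * _]mulrC.
  by rewrite /z /b /al; case: (G); case: (0 <= x <= 1).
by rewrite -/G; case: (G) => //; rewrite integral0.
Qed.

End slab.

Section slab_spline.
Variable R : realType.
Implicit Types (w : seq R) (al z h : R).

(** The indicator function of an interval is not continuous, so that the first
    integration is the computation of the length of an intersection of intervals. *)
Lemma slab_nil_step al h z : 0 < al -> 0 < h ->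
  slab al [:: h] z = (h^-1 * cdiffs [:: al; h] (@tpow R 1) (z - (al + h) / 2))%:E.
Proof.
move=> al0 h0 /=.
have -> : (\int[@lebesgue_measure R]_(x in `[0%R, 1%R]) (\1_(`[0, al]%classic) (z - h * x)%R)%:E =
  \int[@lebesgue_measure R]_(x in `[0%R, 1%R]) (\1_(`[(z - al) / h, z / h]%classic) x)%:E)%E.
  apply: eq_integral => x _; rewrite !indicE !mem_setE !in_itv /=.
  congr (_%:R%:E); congr nat_of_bool.
  rewrite ler_pdivrMr// ler_pdivlMr//.
  by apply/andP/andP => -[? ?]; split; lra.
rewrite integral_indic// setIC.
have -> : `[0%R, 1%R] `&` `[(z - al) / h, z / h] =
    `[Num.max 0 ((z - al) / h), Num.min 1 (z / h)]%classic.
  apply/seteqP; split => x; rewrite /= !in_itv/= ge_max le_min.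
    by case=> /andP[-> ->] /andP[-> ->].
  by move=> /andP[/andP[-> ->] /andP[-> ->]].
rewrite [LHS]lebesgue_measure_itv /= lte_fin -EFinB.
rewrite /cdiff /tpow !expr1 !divr1.
have -> : z - (al + h) / 2 + al / 2 + h / 2 = z by field.
have -> : z - (al + h) / 2 + al / 2 - h / 2 = z - h by field.
have -> : z - (al + h) / 2 - al / 2 + h / 2 = z - al by field.
have -> : z - (al + h) / 2 - al / 2 - h / 2 = z - al - h by field.
have e1 : z = h * (z / h) by field; lra.
have e2 : z - al = h * ((z - al) / h) by field; lra.
have e3 : (z - al) / h < z / h by rewrite ltr_pM2r ?invr_gt0//; lra.
move: (z / h) ((z - al) / h) e1 e2 e3 => u v e1 e2 vu.
rewrite e1 (_ : h * u - h = h * (u - 1)); last by rewrite mulrBr mulr1.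
rewrite (_ : h * u - al - h = h * (v - 1)); last by rewrite mulrBr mulr1 -e2 -e1.
rewrite (_ : h * u - al = h * v); last by rewrite -e2 -e1.
have M y : Num.max (h * y) 0 = h * Num.max y 0 by rewrite maxr_pMr ?mulr0// ltW.
rewrite !M -!mulrBr. rewrite mulKf ?gt_eqF//.
case: ifPn => H; congr EFin; move: H vu; clear; rewrite /Num.max /Num.min; repeat case: ifPn; lra.
Qed.

(** By the fundamental theorem of calculus, averaging over an edge of length
    [h] is a central difference of a primitive, divided by [h]. *)
Lemma slab_cons_step al h v w z : 0 < al -> 0 < h ->
  (forall z, slab al v z = ((\prod_(b <- w) b)^-1 *
      cdiffs (al :: w) (@tpow R (size w)) (z - (al + \sum_(b <- w) b) / 2))%:E) ->
  (0 < size w)%N ->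
  slab al (h :: v) z = ((\prod_(b <- h :: w) b)^-1 *
      cdiffs (al :: h :: w) (@tpow R (size w).+1) (z - (al + \sum_(b <- h :: w) b) / 2))%:E.
Proof.
move=> al0 h0 wE; rewrite /= !big_cons; case sw : (size w) => [//|k] _.
set P := \prod_(b <- w) b; set S := \sum_(b <- w) b.
pose C := cdiffs (al :: w) (@tpow R k.+1); pose D := cdiffs (al :: w) (@tpow R k.+2).
have DC : derivative D C by apply: derivative_cdiffs; exact: derivative_tpow.
pose e := z - (al + S) / 2.
pose F x := (- (h^-1 * P^-1)) * D ((- h) * x + e).
pose f x := P^-1 * C ((- h) * x + e).
have Ff : derivative F f.
  apply: derivative_ext (derivativeZ (- (h^-1 * P^-1)) (derivative_affine (- h) e DC)) => // x.
  by rewrite /f mulrA mulrNN (mulrC h^-1) -(mulrA P^-1) mulVf ?mulr1// gt_eqF.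
have cf : continuous f.
  have dC : continuous C by apply: continuous_cdiffs; exact: continuous_tpow.
  move=> x; apply: (@continuousM _ _ (fun=> P^-1) (fun y => C (- h * y + e))).
    exact: cst_continuous.
  exact: continuous_affine_comp.
transitivity (\int[@lebesgue_measure R]_(x in `[0%R, 1%R]) (f x)%:E)%E.
  apply: eq_integral => x _; rewrite wE sw /f /C /e -/P -/S; congr (_ * cdiffs _ _ _)%:E.
  by ring.
rewrite (@continuous_FTC2 _ f F)//; last 3 first.
- exact: continuous_subspaceT.
- split.
  + by move=> x _; case: (Ff x).
  + apply: cvg_at_right_filter; exact: (derivative_continuous Ff).
  + apply: cvg_at_left_filter; exact: (derivative_continuous Ff).
- by move=> x _; rewrite derive1E; case: (Ff x).
rewrite -EFinB; congr EFin; rewrite /F.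
rewrite -[cdiff al _]/(cdiffs [:: al, h & w] _).
have -> : cdiffs [:: al, h & w] (@tpow R k.+2) = cdiff h D.
  by rewrite /D /= cdiffC.
rewrite /cdiff invfM.
have -> : z - (al + (h + S)) / 2 + h / 2 = - h * 0 + e by rewrite /e; field.
have -> : z - (al + (h + S)) / 2 - h / 2 = - h * 1 + e by rewrite /e; field.
by ring.
Qed.

Lemma slab_spline al w z : 0 < al -> all (fun h => 0 <= h) w ->
  let w' := [seq h <- w | 0 < h] in (0 < size w')%N ->
  slab al w z = ((\prod_(b <- w') b)^-1 *
      cdiffs (al :: w') (@tpow R (size w')) (z - (al + \sum_(b <- w') b) / 2))%:E.
Proof.
move=> al0 /=.
have slab0 h v y : h = 0 -> slab al (h :: v) y = slab al v y.
  move=> -> /=.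
  under eq_integral do rewrite mul0r subr0.
  rewrite integral_cst// [X in (_ * X)%E]lebesgue_measure_itv /= lte_fin ltr01.
  by rewrite -EFinB subr0 mule1.
have slab_nil v y : all (fun h => 0 <= h) v -> [seq h <- v | 0 < h] = [::] ->
    slab al v y = slab al [::] y.
  elim: v y => [//|h v IH] y /= /andP[h0 v0]; case: ifPn => // hn hv.
  rewrite -[RHS]/(slab al [::] y).
  rewrite -[RHS](IH y v0 hv); apply: slab0; apply/le_anti; rewrite h0 leNgt hn //.
elim: w z => [//|h w IH] z /= /andP[h0 w0].
case: ifPn => [hp|hn]; last first.
  by move=> wp; rewrite -(IH z w0 wp); apply: slab0; apply/le_anti; rewrite h0 leNgt hn.
move=> _; have [wn|wp] := posnP (size [seq h <- w | 0 < h]).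
  rewrite (size0nil wn) /= big_seq1.
  transitivity (slab al [:: h] z); last by rewrite slab_nil_step// big_seq1.
  by apply: eq_integral => x _; rewrite slab_nil// (size0nil wn).
by apply: (@slab_cons_step al h w [seq h <- w | 0 < h]) => // y; rewrite IH.
Qed.

(** Zero coordinates integrate to 1 and disappear; the coordinate chosen to
    write the hyperplane as a graph contributes a difference like the others, and
    its Jacobian completes the product.  The centre of the cube becomes the origin
    because the differences are central. *)
Lemma section_volume_spline d (a : 'rV[R]_d) t ws : sphere_orthant a ->
  perm_eq ws [seq h <- [seq a 0 i | i <- enum 'I_d] | 0 < h] -> (1 < size ws)%N ->
  section_volume t a =
  ((\prod_(h <- ws) h)^-1 * cdiffs ws (@tpow R (size ws).-1) (- t))%:E.
Proof.
case: d a => [|d] a; first by case; rewrite /dot big_ord0 => /esym/eqP; rewrite oner_eq0.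
move=> [a1 a0] pws sws.
have [i0 ai0] : exists i0, 0 < a 0 i0.
  apply/existsP; apply: contraTT sws; rewrite negb_exists => /forallP H.
  have : all (pred1 0) [seq a 0 i | i <- enum 'I_d.+1].
    by apply/allP => _ /mapP[i _ ->] /=; have := H i; rewrite lt0r a0 andbT negbK.
  rewrite (perm_size pws) => /all_pred1P ->.
  by rewrite size_filter count_nseq /= ltxx mul0n.
rewrite (section_volume_graph t a1 ai0) flat_volume_slab// mulrCA divff ?gt_eqF// mulr1.
set w := [seq _ | _ <- _]; set S := \sum_i _.
pose w' := [seq h <- w | 0 < h].
have pw : perm_eq (a 0 i0 :: w') ws.
  rewrite perm_sym (perm_trans pws)//.
  have : perm_eq (enum 'I_d.+1) (i0 :: [seq lift i0 j | j <- enum 'I_d]).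
    apply: uniq_perm; first exact: enum_uniq.
      rewrite /= map_inj_uniq ?enum_uniq ?andbT; last exact: lift_inj.
      by apply/mapP => -[j _ /eqP]; rewrite (negbTE (neq_lift _ _)).
    move=> i; rewrite mem_enum; case: (unliftP i0 i) => [j ->|->]; last by rewrite mem_head.
    by rewrite in_cons map_f ?orbT// mem_enum.
  move=> /(perm_map (a 0))/(perm_filter (fun h => 0 < h)).
  by rewrite /= ai0 -map_comp.
have SE : S = \sum_(b <- a 0 i0 :: w') b.
  rewrite (perm_big _ pw) (perm_big _ pws) big_filter /= -[LHS]big_enum /=.
  rewrite -(big_map (a 0) predT id) [LHS](bigID (fun h => 0 < h)) /=.
  rewrite [X in _ + X]big1_seq ?addr0// => h /andP[hn /mapP[i _ hE]].
  by apply/le_anti; rewrite leNgt hn /= hE a0.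
have w'0 : (0 < size w')%N by rewrite -ltnS -[X in (_ < X)%N]/(size (a 0 i0 :: w')) (perm_size pw).
rewrite slab_spline//; last by apply/allP => _ /mapP[j _ ->].
rewrite -EFinM mulrA -invfM; congr EFin; congr (_^-1 * _).
  by rewrite -(perm_big _ pw) /= big_cons mulrC.
rewrite (cdiffs_perm _ pw) -(perm_size pw) /=; congr cdiffs.
by rewrite SE big_cons; ring.
Qed.

End slab_spline.

(** * Uniform bounds on box splines *)

Section smoothing.
Variable R : realType.
Implicit Types (f g h : R -> R) (c s x : R).

Definition avg4 f x : R := (f (x + 4^-1) + f (x - 4^-1)) / 2.

(** Telescoping: a step of length 1 is made of two steps of length 1/2. *)
Lemma cdiff1_avg4 f : cdiff 1 f = (fun x => 2 * cdiff 2^-1 (avg4 f) x).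
Proof.
apply/funext => x; rewrite /cdiff /avg4.
have -> : x + 2^-1 / 2 + 4^-1 = x + 1 / 2 :> R by field.
have -> : x + 2^-1 / 2 - 4^-1 = x :> R by field.
have -> : x - 2^-1 / 2 + 4^-1 = x :> R by field.
have -> : x - 2^-1 / 2 - 4^-1 = x - 1 / 2 :> R by field.
by field.
Qed.

Lemma avg4_cdiff u f : avg4 (cdiff u f) = cdiff u (avg4 f).
Proof.
apply/funext => x; rewrite /cdiff /avg4.
rewrite (addrAC x (u / 2)) (addrAC x (u / 2)) (addrAC x (- (u / 2)) 4^-1).
rewrite (addrAC x (- (u / 2)) (- 4^-1)); ring.
Qed.

Lemma iter_avg4_cdiff n u f : iter n avg4 (cdiff u f) = cdiff u (iter n avg4 f).
Proof. by elim: n => //= n ->; rewrite avg4_cdiff. Qed.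

Lemma iter_cdiff_iter_avg4 k n u f :
  iter k (cdiff u) (iter n avg4 f) = iter n avg4 (iter k (cdiff u) f).
Proof. by elim: k => // k IH; rewrite !iterS IH iter_avg4_cdiff. Qed.

Lemma avg4_le f c : (forall x, `|f x| <= c) -> forall x, `|avg4 f x| <= c.
Proof.
move=> fc x; rewrite /avg4 normrM [`|2^-1|]ger0_norm ?invr_ge0//.
rewrite ler_pdivrMr// (le_trans (ler_normD _ _))// mulr_natr mulr2n.
exact: lerD.
Qed.

Lemma iter_avg4_le n f c : (forall x, `|f x| <= c) ->
  forall x, `|iter n avg4 f x| <= c.
Proof. by move=> fc; elim: n => //= n; exact: avg4_le. Qed.

(** The expectation of [(s + S) h(x + S / 4)], where [S] is a sum of [n]
    independent fair signs. *)
Fixpoint sign_moment n h s x : R :=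
  if n is n'.+1 then
    (sign_moment n' h (s + 1) (x + 4^-1) + sign_moment n' h (s - 1) (x - 4^-1)) / 2
  else s * h x.

(** The discrete analogue of Gaussian integration by parts: a factor [S]
    against an average is a difference of an average. *)
Lemma sign_momentE n h s x : sign_moment n.+1 h s x =
  s * iter n.+1 avg4 h x + n.+1%:R / 2 * cdiff 2^-1 (iter n avg4 h) x.
Proof.
elim: n s x => [|n IH] s x.
  rewrite /= /cdiff /avg4.
  by rewrite (_ : 2^-1 / 2 = 4^-1 :> R); [field|field].
rewrite -[LHS]/((sign_moment n.+1 h (s + 1) (x + 4^-1) +
  sign_moment n.+1 h (s - 1) (x - 4^-1)) / 2) !IH.
have -> : cdiff 2^-1 (iter n.+1 avg4 h) x =
    avg4 (cdiff 2^-1 (iter n avg4 h)) x by rewrite avg4_cdiff.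
have -> : iter n.+2 avg4 h x = avg4 (iter n.+1 avg4 h) x by [].
have H : cdiff 2^-1 (iter n.+1 avg4 h) x =
    iter n.+1 avg4 h (x + 4^-1) - iter n.+1 avg4 h (x - 4^-1).
  by rewrite /cdiff (_ : 2^-1 / 2 = 4^-1 :> R)//; field.
have H' : cdiff 2^-1 (iter n.+1 avg4 h) x =
    avg4 (cdiff 2^-1 (iter n avg4 h)) x by rewrite avg4_cdiff.
move: H'; rewrite H; move: (iter n.+1 avg4 h) (cdiff 2^-1 (iter n avg4 h)) => u v.
rewrite /avg4 => E.
rewrite -[n.+2]addn1 natrD.
have : u (x - 4^-1) = u (x + 4^-1) - (v (x + 4^-1) + v (x - 4^-1)) / 2 by rewrite -E; ring.
by move=> ->; field.
Qed.

Lemma mean_sqrt_le (a b : R) : 0 <= a -> 0 <= b ->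
  (Num.sqrt a + Num.sqrt b) / 2 <= Num.sqrt ((a + b) / 2).
Proof.
move=> a0 b0; rewrite -[leLHS]ger0_norm; last first.
  by rewrite divr_ge0// addr_ge0 ?sqrtr_ge0.
rewrite -sqrtr_sqr ler_wsqrtr//.
move: (Num.sqrt a) (Num.sqrt b) (sqr_sqrtr a0) (sqr_sqrtr b0) => p q pa qb.
have := sqr_ge0 (p - q); rewrite -pa -qb; lra.
Qed.

(** The root mean square bound [E|s + S| <= sqrt (n + s^2)]: by concavity of
    the square root it passes through the signs one at a time. *)
Lemma sign_moment_le n h c s x : (forall x, `|h x| <= c) ->
  `|sign_moment n h s x| <= c * Num.sqrt (n%:R + s ^+ 2).
Proof.
move=> hc; have c0 : 0 <= c by apply: le_trans (hc 0).
elim: n s x => [|n IH] s x /=.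
  by rewrite add0r sqrtr_sqr normrM mulrC ler_wpM2r.
rewrite normrM [`|2^-1|]ger0_norm ?invr_ge0//.
apply: (@le_trans _ _ (c * ((Num.sqrt (n%:R + (s + 1) ^+ 2) + Num.sqrt (n%:R + (s - 1) ^+ 2)) / 2))).
  rewrite mulrA ler_wpM2r ?invr_ge0// mulrDr.
  by rewrite (le_trans (ler_normD _ _))// lerD.
rewrite ler_wpM2l// (le_trans (mean_sqrt_le _ _)) ?addr_ge0 ?sqr_ge0//.
by rewrite ler_wsqrtr// -[n.+1]addn1 natrD; lra.
Qed.

(** By [sign_momentE] at [s = 0] the difference of an [n]-fold average is
    [2 / (n + 1)] times a moment of order [sqrt (n + 1)]. *)
Lemma cdiff1_iter_avg4_le n h c x : (forall x, `|h x| <= c) ->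
  `|cdiff 1 (iter n avg4 h) x| <= c * (4 / Num.sqrt n.+1%:R).
Proof.
move=> hc.
have half y : `|cdiff 2^-1 (iter n avg4 h) y| <= c * (2 / Num.sqrt n.+1%:R).
  have := sign_moment_le n.+1 0 y hc; rewrite sign_momentE mul0r add0r.
  rewrite expr0n addr0 normrM [`|_ / 2|]ger0_norm ?divr_ge0// => H.
  have s0 : 0 < Num.sqrt n.+1%:R :> R by rewrite sqrtr_gt0.
  have s2 : Num.sqrt n.+1%:R ^+ 2 = n.+1%:R :> R by rewrite sqr_sqrtr.
  have key (r z N : R) : N / 2 * z <= c * r -> 0 < r -> r ^+ 2 = N -> z * r <= c * 2.
    by move=> + r0 rN; rewrite -rN => zr; rewrite -(ler_pM2l r0); lra.
  by rewrite mulrA ler_pdivlMr//; exact: key H s0 s2.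
have -> : cdiff 1 (iter n avg4 h) x =
    cdiff 2^-1 (iter n avg4 h) (x + 4^-1) + cdiff 2^-1 (iter n avg4 h) (x - 4^-1).
  rewrite /cdiff.
  have -> : x + 4^-1 + 2^-1 / 2 = x + 1 / 2 :> R by field.
  have -> : x + 4^-1 - 2^-1 / 2 = x :> R by field.
  have -> : x - 4^-1 + 2^-1 / 2 = x :> R by field.
  have -> : x - 4^-1 - 2^-1 / 2 = x - 1 / 2 :> R by field.
  by ring.
rewrite (le_trans (ler_normD _ _))// (le_trans (lerD (half _) (half _)))//.
by rewrite -mulrDr -mulrDl -natrD.
Qed.

(** The averages are shared out equally among the [k] differences. *)
Lemma iter_cdiff1_iter_avg4_le k m r h c : (forall x, `|h x| <= c) -> forall x,
  `|iter k (cdiff 1) (iter (k * m + r) avg4 h) x| <=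
  c * (4 / Num.sqrt m.+1%:R) ^+ k.
Proof.
move=> hc; have H := iter_avg4_le r hc.
elim: k => [|k IH] x; first by rewrite expr0 mulr1 mul0n add0n; exact: H.
rewrite mulSn -addnA iterD iterS.
have -> : iter k (cdiff 1) (iter m avg4 (iter (k * m + r) avg4 h)) =
    iter m avg4 (iter k (cdiff 1) (iter (k * m + r) avg4 h)).
  exact: iter_cdiff_iter_avg4.
by rewrite exprSr (mulrA c); apply: cdiff1_iter_avg4_le => y; exact: IH.
Qed.

End smoothing.

Section splines.
Variable R : realType.
Implicit Types (x c : R).

(** [spline n (n - 1)] is the density of the sum of [n] independent variables
    that are uniform on [[-1/2, 1/2]], [spline n n] is its distribution function and
    [spline n (n - k.+1)] is the [k]-th derivative of the density. *)
Definition spline n k : R -> R := iter n (cdiff 1) (tpow k).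

Lemma spline_derivative n k : derivative (spline n k.+2) (spline n k.+1).
Proof.
rewrite /spline; elim: n => [|n IH] /=; first exact: derivative_tpow.
exact: derivative_cdiff.
Qed.

(** By the mean value theorem, since [spline n.+2 n.+2] is a difference of a
    primitive of [spline n.+1 n.+1].  This propagates bounds and values from the
    case of one variable. *)
Lemma spline_diag_step n x : exists2 y, x - 2^-1 <= y <= x + 2^-1 &
  spline n.+2 n.+2 x = spline n.+1 n.+1 y.
Proof.
have [|y [y1 y2]] := derivative_mean (@spline_derivative n.+1 n)
  (_ : x - 1 / 2 <= x + 1 / 2); first by lra.
rewrite -[LHS]/(spline n.+2 n.+2 x) => ->.
exists y; first by apply/andP; split; lra.
by rewrite (_ : x + 1 / 2 - (x - 1 / 2) = 1) ?mulr1//; field.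
Qed.

Lemma spline_diag_ge0_le1 n x : 0 <= spline n.+1 n.+1 x <= 1.
Proof.
elim: n x => [|n IH] x; last by have [y _ ->] := spline_diag_step n x.
rewrite /spline /= /cdiff /tpow !expr1 !divr1 /Num.max.
by do 2 case: ifPn; lra.
Qed.

Lemma iter_cdiff_dilate n u f (l : R) : l != 0 ->
  iter n (cdiff u) (fun x => f (l * x)) = (fun x => iter n (cdiff (l * u)) f (l * x)).
Proof.
move=> l0; elim: n => // n IH; apply/funext => x.
rewrite !iterS IH /cdiff; congr (iter n _ f _ - iter n _ f _); by field.
Qed.

Lemma iter_cdiffZ n u f (a : R) :
  iter n (cdiff u) (fun x => a * f x) = (fun x => a * iter n (cdiff u) f x).
Proof.
elim: n => // n IH; apply/funext => x.
by rewrite !iterS IH /cdiff -mulrBr.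
Qed.

Lemma iter_avg4Z n f (a : R) :
  iter n (@avg4 R) (fun x => a * f x) = (fun x => a * iter n (@avg4 R) f x).
Proof.
elim: n => // n IH; apply/funext => x.
by rewrite !iterS IH /avg4 -mulrDr mulrA.
Qed.

Lemma iter_cdiff1_avg4 n f :
  iter n (cdiff 1) f = (fun x => 2 ^+ n * iter n (@avg4 R) (iter n (cdiff 2^-1) f) x).
Proof.
elim: n f => [|n IH] f; first by apply/funext => x; rewrite expr0 mul1r.
rewrite iterSr cdiff1_avg4 iter_cdiffZ; apply/funext => x.
rewrite IH exprS mulrA; congr (_ * _).
have -> : iter n.+1 (@avg4 R) (iter n.+1 (cdiff 2^-1) f) =
    iter n (@avg4 R) (iter n.+1 (cdiff 2^-1) (avg4 f)).
  by rewrite [LHS]iterSr -[avg4 (iter _ _ _)]/(iter 1 (@avg4 R) _) -iter_cdiff_iter_avg4.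
by rewrite iterSr.
Qed.

(** Each of the [n] differences is twice an average of a difference with half
    the step ([cdiff1_avg4]), and the factor [2 ^ n] is absorbed by the homogeneity
    of the truncated power. *)
Lemma spline_diag_self_similar n : spline n n =
  iter n (@avg4 R) (fun x => spline n n (2 * x)).
Proof.
have two0 : (2 : R) != 0 by rewrite pnatr_eq0.
have E x : spline n n (2 * x) = 2 ^+ n * iter n (cdiff 2^-1) (@tpow R n) x.
  rewrite /spline; have := @iter_cdiff_dilate n 2^-1 (@tpow R n) 2 two0.
  rewrite divff// => /(congr1 (fun f => f x)) <-.
  rewrite (_ : (fun x => _) = (fun x => 2 ^+ n * tpow n x)) ?iter_cdiffZ//.
  by apply/funext => y; rewrite tpow_scale.
rewrite {1}/spline iter_cdiff1_avg4; apply/funext => x.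
under [in RHS]eq_fun do rewrite E.
by rewrite iter_avg4Z.
Qed.

(** The [n]-fold difference of a truncated power of degree [n - k.+1] is a
    [k.+1]-fold difference of [spline (n - k.+1) (n - k.+1)], which is an
    [(n - k.+1)]-fold average of a function with values in [[0, 1]]. *)
Lemma spline_bound k : exists2 C, 0 <= C & forall n x, (k.+1.*2 <= n)%N ->
  `|spline n (n - k.+1) x| <= C / Num.sqrt n%:R ^+ k.+1.
Proof.
pose c := Num.sqrt (k.+1.*2)%:R : R.
exists ((4 * c) ^+ k.+1); first by rewrite exprn_ge0// mulr_ge0// sqrtr_ge0.
move=> n x kn.
pose N := (n - k.+1)%N; pose m := (N %/ k.+1)%N.
have NE : N = (k.+1 * m + N %% k.+1)%N by rewrite mulnC -divn_eq.
have N0 : (0 < N)%N by rewrite /N; lia.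
have -> : spline n (n - k.+1) x =
    iter k.+1 (cdiff 1) (iter (k.+1 * m + N %% k.+1) (@avg4 R) (fun x => spline N N (2 * x))) x.
  rewrite -NE -spline_diag_self_similar /spline -iterD.
  by congr (iter _ _ _ x); rewrite /N; lia.
have h1 y : `|spline N N (2 * y)| <= 1.
  case: N N0 {NE m} => // N' _; have /andP[? ?] := spline_diag_ge0_le1 N' (2 * y).
  by rewrite ger0_norm.
apply: (le_trans (iter_cdiff1_iter_avg4_le k.+1 m (N %% k.+1) h1 x)).
rewrite mul1r -expr_div_n ler_pXn2r// ?nnegrE ?divr_ge0 ?mulr_ge0 ?sqrtr_ge0//.
have n0 : 0 < n%:R :> R by rewrite ltr0n; lia.
rewrite -mulrA ler_pM2l//.
rewrite -[leLHS]mul1r ler_pdivrMr ?sqrtr_gt0// mulrAC ler_pdivlMr ?sqrtr_gt0// mul1r.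
rewrite /c -sqrtrM// ler_wsqrtr// -natrM ler_nat.
have : (n - k.+1 < k.+1 * m.+1)%N.
  by rewrite -/N mulnC /m; exact: ltn_ceil.
lia.
Qed.

End splines.

(** * Taylor expansion of second differences *)

Section taylor.
Variable R : realType.
Implicit Types (J : nat -> R -> R) (B x y : R).

(** Consecutive derivatives up to order [n]. *)
Definition tower n J := forall i, (i < n)%N -> derivative (J i) (J i.+1).

Lemma derivative_dist_le f df C x y : derivative f df ->
  (forall z, `|z| <= `|y| -> `|df (x + z)| <= C) -> `|f (x + y) - f x| <= C * `|y| :> R.
Proof.
move=> fdf dfC; have [y0|y0] := leP 0 y.
  have [|c [c1 c2 ->]] := derivative_mean fdf (_ : x <= x + y); first by lra.
  rewrite normrM addrAC subrr add0r ler_wpM2r// -(subrK x c) addrC.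
  by apply: dfC; rewrite !ger0_norm//; lra.
have [|c [c1 c2 E]] := derivative_mean fdf (_ : x + y <= x); first by lra.
rewrite distrC E normrM opprD addrA subrr add0r normrN ler_wpM2r// -(subrK x c) addrC.
by apply: dfC; rewrite !ler0_norm//; lra.
Qed.

(** The factorial is dropped from the remainder: only its order matters here. *)
Lemma taylor_le n J B x y : tower n J -> (forall z, `|J n z| <= B) ->
  `|J 0 (x + y) - \sum_(i < n) J i x * (y ^+ i / i`!%:R)| <= B * `|y| ^+ n.
Proof.
move=> + JB; elim: n J JB y => [|n IH] J JB y tJ.
  by rewrite big_ord0 subr0 mulr1; exact: JB.
pose f y := J 0%N (x + y) - \sum_(i < n.+1) J i x * (y ^+ i / i`!%:R).
pose df y := J 1%N (x + y) - \sum_(i < n) J i.+1 x * (y ^+ i / i`!%:R).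
have fdf : derivative f df.
  apply: derivativeB.
    apply: (derivative_ext _ _ (derivative_affine 1 x (tJ 0%N isT))) => z; rewrite !mul1r addrC //.
  have dS m : derivative (fun z => \sum_(i < m) J i.+1 x * (z ^+ i.+1 / i.+1`!%:R))
      (fun z => \sum_(i < m) J i.+1 x * (z ^+ i / i`!%:R)).
    elim: m => [|m IHm].
      by apply: (derivative_ext _ _ (derivative_cst 0)) => z; rewrite big_ord0.
    apply: (derivative_ext _ _ (derivativeD IHm (derivativeZ (J m.+1 x) (@derivative_exp R m)))) => z;
      by rewrite big_ord_recr.
  apply: (derivative_ext _ _ (derivativeD (derivative_cst (J 0%N x)) (dS n))) => z.
    by rewrite big_ord_recl /= expr0 divr1 mulr1; congr (_ + _); apply: eq_bigr.
  by rewrite add0r.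
have f0 : f 0 = 0.
  rewrite /f addr0 big_ord_recl /= expr0 divr1 mulr1 big1 ?addr0 ?subrr// => i _.
  by rewrite expr0n mul0r mulr0.
have := @derivative_dist_le f df (B * `|y| ^+ n) 0 y fdf.
rewrite add0r f0 subr0 exprSr mulrA; apply=> z zy.
rewrite add0r; have := IH (fun i => J i.+1) JB z (fun i ik => tJ i.+1 ik).
move=> /le_trans; apply; rewrite ler_wpM2l//; first by apply: le_trans (JB 0).
by rewrite lerXn2r ?nnegrE.
Qed.

Lemma taylor_pm n J B x : tower n J -> (forall z, `|J n z| <= B) ->
  - B <= J 0%N (x + 1) - \sum_(i < n) J i x / i`!%:R <= B /\
  - B <= J 0%N (x - 1) - \sum_(i < n) (-1) ^+ i * (J i x / i`!%:R) <= B.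
Proof.
move=> tJ JB; split; rewrite -ler_norml.
  have := taylor_le x 1 tJ JB; rewrite normr1 expr1n mulr1.
  by under eq_bigr do rewrite expr1n mul1r.
have := taylor_le x (-1) tJ JB; rewrite normrN1 expr1n mulr1.
by under eq_bigr do rewrite mulrCA.
Qed.

End taylor.

Section expansions.
Variables (R : realType) (J : nat -> R -> R) (x : R).

Let d2 f : R := cdiff 1 (cdiff 1 f) x.

Lemma cdiff1_cdiff1 f : d2 f = f (x + 1) + f (x - 1) - 2 * f x.
Proof.
rewrite /d2 /cdiff.
have -> : x + 1 / 2 + 1 / 2 = x + 1 :> R by field.
have -> : x - 1 / 2 + 1 / 2 = x :> R by field.
have -> : x + 1 / 2 - 1 / 2 = x :> R by field.
have -> : x - 1 / 2 - 1 / 2 = x - 1 :> R by field.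
by ring.
Qed.

(** A Taylor polynomial with an explicit list of coefficients, which unfolds to
    a linear combination of values of the [J k] at [x]. *)
Fixpoint jet (cs : seq R) k : R :=
  if cs is c :: cs' then c * J k x + jet cs' k.+1 else 0.

Let jetE cs k : jet cs k = \sum_(i < size cs) cs`_i * J (k + i)%N x.
Proof.
elim: cs k => [|c cs IH] k /=; first by rewrite big_ord0.
rewrite IH big_ord_recl /= addn0; congr (_ + _); apply: eq_bigr => i _.
by rewrite addnS.
Qed.

Let facts : (2`!%:R = 2 :> R) * (3`!%:R = 6 :> R) * (4`!%:R = 24 :> R) *
  (5`!%:R = 120 :> R) * (6`!%:R = 720 :> R) * (7`!%:R = 7 * 720 :> R) *
  (8`!%:R = 56 * 720 :> R).
Proof. by do !split; rewrite !factS fact0 !natrM; ring. Qed.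

Let invfacts := [:: 1; 1; 2^-1; 6^-1; 24^-1; 120^-1; 720^-1; (7 * 720)^-1;
  (56 * 720)^-1; 9`!%:R^-1 : R].

Let altfacts := [:: 1; -1; 2^-1; - 6^-1; 24^-1; - 120^-1; 720^-1; - (7 * 720)^-1;
  (56 * 720)^-1; - 9`!%:R^-1 : R].

Let invfactsE i : (i < 10)%N -> invfacts`_i = i`!%:R^-1.
Proof.
by case: i => [|[|[|[|[|[|[|[|[|[|i]]]]]]]]]] //= _; rewrite ?facts ?invr1.
Qed.

Let altfactsE i : (i < 10)%N -> altfacts`_i = (-1) ^+ i * i`!%:R^-1.
Proof.
move=> i10; rewrite -invfactsE//; move: i10.
by case: i => [|[|[|[|[|[|[|[|[|[|i]]]]]]]]]] //= _; ring.
Qed.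

Let bounds n B : tower n J -> (forall z, `|J n z| <= B) ->
  forall k j, (k + j = n)%N -> (j < 11)%N ->
  (- B <= J k (x + 1) - jet (take j invfacts) k <= B) /\
  (- B <= J k (x - 1) - jet (take j altfacts) k <= B).
Proof.
move=> tJ JB k j kj j11.
have tJk : tower j (fun l => J (k + l)%N).
  by move=> l lj; rewrite addnS; apply: tJ; lia.
have JkB z : `|J (k + j)%N z| <= B by rewrite kj.
have := taylor_pm x tJk JkB; rewrite addn0 !jetE !size_takel//.
have -> : \sum_(i < j) (take j invfacts)`_i * J (k + i)%N x =
    \sum_(i < j) J (k + i)%N x / i`!%:R.
  apply: eq_bigr => i _; rewrite nth_take// invfactsE; first exact: mulrC.
  by have := ltn_ord i; lia.
have -> // : \sum_(i < j) (take j altfacts)`_i * J (k + i)%N x =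
    \sum_(i < j) (-1) ^+ i * (J (k + i)%N x / i`!%:R).
apply: eq_bigr => i _; rewrite nth_take// altfactsE; last by have := ltn_ord i; lia.
by rewrite -mulrA; congr (_ * _); rewrite mulrC.
Qed.

(** The combination is chosen so that all Taylor coefficients below order 8
    cancel; it bounds the error in the equations [density_ode]. *)
Lemma residual_expansion B : tower 8 J -> (forall z, `|J 8 z| <= B) ->
  `|d2 (J 0) - (J 1 (x + 1) - J 1 (x - 1)) / 2 + d2 (J 2) / 12
    - d2 (J 4) / 720| <= 5 * B.
Proof.
move=> tJ JB; have H := bounds tJ JB.
have B0 : 0 <= B by apply: le_trans (JB 0).
move: (H 0 8 erefl isT) (H 1 7 erefl isT) (H 2 6 erefl isT) (H 4 4 erefl isT).
rewrite !cdiff1_cdiff1 ler_norml /=; lra.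
Qed.

(** Through [spline_recurrence] the first three terms are [tail_slope / n]; the
    other two cancel the terms of order 7 and 9 of their Taylor expansion, the lowest
    ones that do not vanish. *)
Lemma tail_residual_expansion B : tower 11 J -> (forall z, `|J 11 z| <= B) ->
  `|d2 (J 1) - (J 2 (x + 1) - J 2 (x - 1)) / 2 + d2 (J 3) / 12
    - d2 (J 5) / 720 + d2 (J 7) / (42 * 720)| <= 5 * B.
Proof.
move=> tJ JB; have H := bounds tJ JB.
have B0 : 0 <= B by apply: le_trans (JB 0).
move: (H 1 10 erefl isT) (H 2 9 erefl isT) (H 3 8 erefl isT) (H 5 6 erefl isT) (H 7 4 erefl isT).
rewrite !cdiff1_cdiff1 ler_norml /=; lra.
Qed.

(** The first three terms are [pair_slope]; the other two cancel the terms of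
    order 7 and 9 of their Taylor expansion, the lowest ones that do not vanish. *)
Lemma pair_residual_expansion B : tower 11 J -> (forall z, `|J 11 z| <= B) ->
  `|d2 (J 1) - (J 2 (x + 1) - J 2 (x - 1)) / 4 - J 3 x / 2
    + d2 (J 5) / 720 - d2 (J 7) / (21 * 720)| <= 5 * B.
Proof.
move=> tJ JB; have H := bounds tJ JB.
have B0 : 0 <= B by apply: le_trans (JB 0).
move: (H 1 10 erefl isT) (H 2 9 erefl isT) (H 5 6 erefl isT) (H 7 4 erefl isT).
rewrite !cdiff1_cdiff1 ler_norml /=; lra.
Qed.

End expansions.

(** * The density at the diagonal and its approximate Hermite equations *)

Section spline_identities.
Variable R : realType.
Implicit Types (f : R -> R) (x : R).

(** The Leibniz rule for differences, for the product with the identity. *)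
Lemma mul_iter_cdiff1 n f x : x * iter n.+1 (cdiff 1) f x =
  iter n.+1 (cdiff 1) (fun y => y * f y) x -
  n.+1%:R * ((iter n (cdiff 1) f (x + 1 / 2) + iter n (cdiff 1) f (x - 1 / 2)) / 2).
Proof.
elim: n x => [|n IH] x; first by rewrite /= /cdiff; field.
have C g y : cdiff 1 g y = g (y + 1 / 2) - g (y - 1 / 2) by [].
rewrite iterS C [in RHS]iterS C.
have IH1 := IH (x + 1 / 2); have IH2 := IH (x - 1 / 2).
have e : iter n.+1 (cdiff 1) (fun y => y * f y) =
    fun x => x * iter n.+1 (cdiff 1) f x + n.+1%:R * ((iter n (cdiff 1) f (x + 1 / 2) +
       iter n (cdiff 1) f (x - 1 / 2)) / 2).
  by apply/funext => y; rewrite IH; ring.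
rewrite e !iterS /cdiff.
set u := iter n (cdiff 1) f.
have -> : x + 1 / 2 + 1 / 2 = x + 1 :> R by field.
have -> : x - 1 / 2 + 1 / 2 = x :> R by field.
have -> : x + 1 / 2 - 1 / 2 = x :> R by field.
have -> : x - 1 / 2 - 1 / 2 = x - 1 :> R by field.
by rewrite -[n.+2]addn1 natrD; field.
Qed.

(** The recurrence of B-splines differentiated [i] times: multiplication by
    [x] raises the degree of a truncated power. *)
Lemma spline_recurrence n i x : (i < n.+1)%N ->
  x * spline n.+2 (n.+1 - i) x + i%:R * spline n.+2 (n.+2 - i) x =
  n.+2%:R * (spline n.+2 (n.+2 - i) x -
    (spline n (n.+2 - i.+1) (x + 1) - spline n (n.+2 - i.+1) (x - 1)) / 2).
Proof.
move=> iltn; rewrite /spline mul_iter_cdiff1 subSS.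
have -> : (fun y => y * tpow (n.+1 - i) y) =
    (fun y => (n.+2 - i)%:R * tpow (n.+2 - i) y) :> (R -> R).
  apply/funext => y; have -> : (n.+1 - i = (n - i).+1)%N by lia.
  have -> : (n.+2 - i = (n - i).+2)%N by lia.
  by rewrite tpow_mulr.
rewrite iter_cdiffZ.
have E g y : iter n.+1 (cdiff 1) g y =
  iter n (cdiff 1) g (y + 1 / 2) - iter n (cdiff 1) g (y - 1 / 2) :> R by [].
rewrite !(E _ (x + 1 / 2)) !(E _ (x - 1 / 2)).
have -> : x + 1 / 2 + 1 / 2 = x + 1 :> R by field.
have -> : x - 1 / 2 + 1 / 2 = x :> R by field.
have -> : x + 1 / 2 - 1 / 2 = x :> R by field.
have -> : x - 1 / 2 - 1 / 2 = x - 1 :> R by field.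
by rewrite natrB; [field|lia].
Qed.

Lemma spline_diag_left n x : x <= - (n.+1%:R / 2) -> spline n.+1 n.+1 x = 0.
Proof.
elim: n x => [|n IH] x xn.
  by rewrite /spline /= /cdiff !tpow_neg ?subrr//; lra.
have [y /andP[y1 y2] ->] := spline_diag_step n x.
by apply: IH; move: xn y2; rewrite -[n.+2]addn1 natrD; lra.
Qed.

Lemma spline_diag_right n x : n.+1%:R / 2 <= x -> spline n.+1 n.+1 x = 1.
Proof.
elim: n x => [|n IH] x xn.
  by rewrite /spline /= /cdiff !tpow_pos ?expr1 ?divr1; lra.
have [y /andP[y1 y2] ->] := spline_diag_step n x.
by apply: IH; move: xn y1; rewrite -[n.+2]addn1 natrD; lra.
Qed.

Lemma tower_spline n : tower n.+1 (fun i => @spline R n (n.+2 - i)).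
Proof.
move=> i i_n /=; have -> : (n.+2 - i = (n - i).+2)%N by lia.
have -> : (n.+2 - i.+1 = (n - i).+1)%N by lia.
exact: spline_derivative.
Qed.

End spline_identities.

Section density.
Variable R : realType.
Implicit Types (t : R).

(** The [k]-th derivative with respect to [t] of the section volume at the
    diagonal; for [k = 0] it is the density of the sum of [n] independent uniform
    variables divided by [sqrt n]. *)
Definition density n k t : R :=
  (-1) ^+ k * Num.sqrt n%:R ^+ k.+1 * spline n (n - k.+1) (- (Num.sqrt n%:R * t)).

Lemma derivative_density n k : (k.+3 <= n)%N -> derivative (density n k) (density n k.+1).
Proof.
move=> kn; have -> : (density n k) = fun t => ((-1) ^+ k * Num.sqrt n%:R ^+ k.+1) *
    spline n (n - k.+3).+2 (- Num.sqrt n%:R * t + 0).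
  apply/funext => t; rewrite /density addr0 mulNr; congr (_ * spline _ _ _); lia.
apply: (derivative_ext _ _ (derivativeZ _ (derivative_affine _ _ (@spline_derivative R n _)))) => // t.
rewrite /density (_ : n - k.+2 = (n - k.+3).+1)%N; last by lia.
rewrite (_ : - Num.sqrt n%:R * t + 0 = - (Num.sqrt n%:R * t)); last by ring.
by rewrite !exprS; ring.
Qed.

Lemma density_mass n : (2 <= n)%N -> exists Pi, derivative Pi (density n 0) /\
  Pi (Num.sqrt n%:R / 2) - Pi (- (Num.sqrt n%:R / 2)) = 1.
Proof.
case: n => [//|[//|n]] _; exists (fun t => (-1) * spline n.+2 n.+2 (- Num.sqrt n.+2%:R * t + 0)); split.
  apply: (derivative_ext _ _ (derivativeZ _ (derivative_affine _ _ (@spline_derivative R n.+2 n)))) => // t.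
  rewrite (_ : - Num.sqrt n.+2%:R * t + 0 = - (Num.sqrt n.+2%:R * t)); last by ring.
  by rewrite /density subSS subn0 expr0 expr1; ring.
have r2 : Num.sqrt n.+2%:R * (Num.sqrt n.+2%:R / 2) = n.+2%:R / 2 :> R.
  by rewrite mulrA -expr2 sqr_sqrtr.
have -> : - Num.sqrt n.+2%:R * (Num.sqrt n.+2%:R / 2) + 0 = - (n.+2%:R / 2) :> R.
  by rewrite addr0 mulNr r2.
have -> : - Num.sqrt n.+2%:R * - (Num.sqrt n.+2%:R / 2) + 0 = n.+2%:R / 2 :> R.
  by rewrite addr0 mulrNN r2.
by rewrite spline_diag_left// spline_diag_right//; ring.
Qed.

Lemma normr_density n k t : `|density n k t| =
  Num.sqrt n%:R ^+ k.+1 * `|spline n (n - k.+1) (- (Num.sqrt n%:R * t))|.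
Proof.
by rewrite /density !normrM normrX normrN1 expr1n mul1r ger0_norm ?exprn_ge0 ?sqrtr_ge0.
Qed.

Lemma density_bound K : exists2 C, 0 <= C & forall n k t, (k <= K)%N -> (K.+1.*2 <= n)%N ->
  `|density n k t| <= C.
Proof.
have B k : exists2 C, 0 <= C & forall n t, (k.+1.*2 <= n)%N -> `|density n k t| <= C.
  have [C C0 H] := @spline_bound R k; exists C => // n t kn.
  have r0 : 0 < Num.sqrt n%:R :> R by rewrite sqrtr_gt0 ltr0n; lia.
  by rewrite normr_density mulrC -ler_pdivlMr ?exprn_gt0// H.
elim: K => [|K [C C0 H]].
  by have [C C0 H] := B 0%N; exists C => // n k t; rewrite leqn0 => /eqP->; exact: H.
have [C' C'0 H'] := B K.+1; exists (C + C'); first exact: addr_ge0.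
move=> n k t; rewrite leq_eqVlt => /predU1P[->|kK] nK.
  by rewrite (le_trans (H' _ _ nK))// lerDr.
by rewrite (le_trans (H n k t kK _)) ?lerDl//; lia.
Qed.

(** [spline_bound] in the form needed for splines with [n.+2] differences,
    two of which are expanded by Taylor's formula. *)
Lemma tail_bound j : exists2 C : R, 0 <= C & forall n x, (j.+3.*2 <= n)%N ->
  `|spline n (n - j.+1) x| <= C / Num.sqrt n.+2%:R ^+ j.+1.
Proof.
have [C C0 H] := @spline_bound R j; exists (C * 2 ^+ j.+1); first by rewrite mulr_ge0// exprn_ge0.
move=> n x jn; apply: (le_trans (H n x _)); first by lia.
have r0 : 0 < Num.sqrt n%:R :> R by rewrite sqrtr_gt0 ltr0n; lia.
have r2 : 0 < Num.sqrt n.+2%:R :> R by rewrite sqrtr_gt0 ltr0n.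
rewrite -mulrA ler_wpM2l// -exprVn -expr_div_n lerXn2r ?nnegrE ?invr_ge0 ?divr_ge0 ?(ltW r0) ?(ltW r2)//.
rewrite ler_pdivlMr// mulrC ler_pdivrMr//.
rewrite -(@ler_pXn2r _ 2) ?nnegrE ?mulr_ge0 ?(ltW r0) ?(ltW r2)// exprMn !sqr_sqrtr//.
by rewrite -natrX -natrM ler_nat; lia.
Qed.

(** The Gaussian [exp (- 6 t^2)] and its derivatives satisfy these equations
    with right-hand side 0.  The defect of [density] is [- 12 (-1)^k r^k n] times the
    residual estimated in [residual_expansion], by [spline_recurrence]. *)
Lemma density_ode K : exists2 C, 0 <= C & forall n k t, (k <= K)%N -> (K.+4.+1.*2.*2 <= n)%N ->
  `|density n k.+1 t + 12 * t * density n k t + 12 * k%:R * density n k.-1 t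
    - density n (k + 3) t / (60 * n%:R)| <= C / n%:R ^+ 2.
Proof.
have B k : exists2 C, 0 <= C & forall n t, (k.+4.+1.*2.*2 <= n)%N ->
  `|density n k.+1 t + 12 * t * density n k t + 12 * k%:R * density n k.-1 t
    - density n (k + 3) t / (60 * n%:R)| <= C / n%:R ^+ 2.
  have [C C0 H] := tail_bound (k + 5).
  exists (12 * (5 * C)); first by rewrite !mulr_ge0.
  move=> [//|[//|n]] t kn.
  (* The residual is expanded at splines with two differences fewer, of which the
     splines in the statement are second differences. *)
  pose J i := @spline R n (n.+2 - (k + i)).
  have tJ : tower 8 J.
    move=> i i8; rewrite /J addnS; apply: tower_spline; lia.
  pose r : R := Num.sqrt n.+2%:R.
  have r0 : 0 < r by rewrite sqrtr_gt0 ltr0n.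
  have rn : n.+2%:R = r ^+ 2 by rewrite sqr_sqrtr.
  have JB z : `|J 8%N z| <= C / r ^+ (k + 6).
    rewrite /J (_ : n.+2 - (k + 8) = n - (k + 5).+1)%N; last by lia.
    rewrite (_ : k + 6 = (k + 5).+1)%N; last by lia.
    by apply: H; lia.
  pose x := - (r * t).
  have := residual_expansion x tJ JB.
  set W := (X in `|X - _|).
  have cdiff2 i : cdiff 1 (cdiff 1 (J i)) x = spline n.+2 (n.+2 - (k + i)) x by [].
  have WE : x * spline n.+2 (n.+1 - k) x + k%:R * spline n.+2 (n.+2 - k) x +
    n.+2%:R / 12 * spline n.+2 (n.+2 - k.+2) x = n.+2%:R * W.
    rewrite spline_recurrence; last by lia.
    rewrite /W !cdiff2 addn0 addn2 /J addn1 -[(n.+2 - k.+1)%N]/((n.+2 - k.+1)%N).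
    by field.
  rewrite cdiff2 => HW.
  have -> : density n.+2 k.+1 t + 12 * t * density n.+2 k t +
      12 * k%:R * density n.+2 k.-1 t - density n.+2 (k + 3) t / (60 * n.+2%:R) =
      12 * (-1) ^+ k.+1 * r ^+ k * n.+2%:R * (W - spline n.+2 (n.+2 - (k + 4)) x / 720).
    rewrite mulrBr -(mulrA _ n.+2%:R W) -WE /density -/r -/x.
    have E3 : (n.+2 - (k + 3).+1 = n.+2 - (k + 4))%N by lia.
    have E1 : (n.+2 - k.+1 = n.+1 - k)%N by [].
    rewrite E3 E1 rn.
    have xE : x = - (r * t) by [].
    case: (k) => [|k'] /=.
      by rewrite xE !exprS !expr0; field; rewrite gt_eqF.
    rewrite xE (_ : k'.+1 + 3 = k'.+4)%N; last by lia.
    move: (k'.+1%:R) (n.+2 - k'.+2)%N (n.+2 - (k'.+1 + 4))%N => K1 m1 m2.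
    rewrite !exprS.
    by field; rewrite gt_eqF.
  have c0 : 0 <= 12 * r ^+ k * n.+2%:R.
    by apply: mulr_ge0 => //; apply: mulr_ge0 => //; rewrite exprn_ge0// ltW.
  rewrite normrM (_ : `|12 * _ * _ * _| = 12 * r ^+ k * n.+2%:R); last first.
    by rewrite -(ger0_norm c0) !normrM normrX normrN1 expr1n mulr1.
  apply: (@le_trans _ _ (12 * r ^+ k * n.+2%:R * (5 * (C / r ^+ (k + 6))))).
    by rewrite ler_wpM2l.
  rewrite rn exprD le_eqVlt; apply/orP; left; apply/eqP.
  have rk : r ^+ k != 0 by rewrite expf_neq0 ?gt_eqF.
  move: (r ^+ k) rk => z z0; field.
  by rewrite z0 gt_eqF.
elim: K => [|K [C C0 H]].
  by have [C C0 H] := B 0%N; exists C => // n k t; rewrite leqn0 => /eqP->; exact: H.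
have [C' C'0 H'] := B K.+1; exists (C + C'); first exact: addr_ge0.
move=> n k t; rewrite leq_eqVlt => /predU1P[->|kK] nK.
  by rewrite (le_trans (H' _ _ nK))// ler_wpM2r ?lerDr.
rewrite (le_trans (H n k t kK _))//; first by lia.
by rewrite ler_wpM2r ?lerDl.
Qed.

End density.

(** * Expansion of the two slopes *)

Section residuals.
Variable R : realType.
Implicit Types (t x : R).

(** Up to a positive factor, the derivative of the section volume with respect
    to the square of a coordinate that vanishes on the diagonal. *)
Definition tail_slope n x : R := spline n (n - 1) x + x * spline n (n - 2) x +
  n%:R / 12 * spline n (n - 3) x.

(** Up to a positive factor, the derivative of the section volume with respect
    to the square of the difference of two coordinates that are equal on the
    diagonal. *)
Definition pair_slope n x : R := spline n (n - 1) x -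
  (spline (n - 2) (n - 2) (x + 1) - spline (n - 2) (n - 2) (x - 1)) / 4 -
  spline (n - 2) (n - 3) x / 2.

(** To leading order both slopes vanish, the first one because the density is
    nearly Gaussian; what remains is the fourth derivative with opposite signs, and
    sixth derivatives with different coefficients. *)
Lemma slopes_expansion : exists2 C : R, 0 <= C & forall n t, (60 <= n)%N ->
  let r := Num.sqrt n%:R in
  `|r ^+ 5 * (tail_slope n (- (r * t)) / n%:R) -
    (density n 4 t / 720 - density n 6 t / (42 * 720 * n%:R))| <= C / n%:R ^+ 2 /\
  `|r ^+ 5 * pair_slope n (- (r * t)) +
    (density n 4 t / 720 - density n 6 t / (21 * 720 * n%:R))| <= C / n%:R ^+ 2.
Proof.
have [C C0 H] := @tail_bound R 8; exists (5 * C); first by rewrite mulr_ge0.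
case=> [//|[//|n]] t n60 r; set x := - (r * t).
pose J i := @spline R n (n.+2 - i).
have tJ : tower 11 J.
  by move=> i i11; apply: tower_spline; lia.
have r0 : 0 < r by rewrite sqrtr_gt0 ltr0n.
have rn : n.+2%:R = r ^+ 2 by rewrite sqr_sqrtr.
have JB z : `|J 11 z| <= C / r ^+ 9.
  by rewrite /J (_ : n.+2 - 11 = n - 9)%N; [apply: H; lia|lia].
have d2 i : cdiff 1 (cdiff 1 (J i)) x = spline n.+2 (n.+2 - i) x by [].
have F4 : density n.+2 4 t = r ^+ 5 * spline n.+2 (n.+2 - 5) x.
  by rewrite /density -/r -/x (_ : (-1) ^+ 4 = 1) ?mul1r//; ring.
have F6 : density n.+2 6 t = r ^+ 7 * spline n.+2 (n.+2 - 7) x.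
  by rewrite /density -/r -/x (_ : (-1) ^+ 6 = 1) ?mul1r//; ring.
have bnd u v : u = r ^+ 5 * v -> `|v| <= 5 * (C / r ^+ 9) -> `|u| <= 5 * C / n.+2%:R ^+ 2.
  move=> -> vC; rewrite normrM ger0_norm ?exprn_ge0 ?(ltW r0)//.
  rewrite (_ : 5 * C / n.+2%:R ^+ 2 = r ^+ 5 * (5 * (C / r ^+ 9))).
    by rewrite ler_wpM2l ?exprn_ge0 ?(ltW r0).
  by rewrite rn; field; rewrite gt_eqF.
split.
- apply: bnd (tail_residual_expansion x tJ JB).
  rewrite !d2 F4 F6 rn.
  have -> : tail_slope n.+2 x / r ^+ 2 = spline n.+2 (n.+2 - 1) x -
      (J 2 (x + 1) - J 2 (x - 1)) / 2 + spline n.+2 (n.+2 - 3) x / 12.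
    have := @spline_recurrence R n 1 x; rewrite mul1r rn => Hr.
    rewrite /tail_slope rn [X in X + _]addrC.
    rewrite -[(n.+2 - 2)%N]/(n.+1 - 1)%N Hr; last by lia.
    by rewrite /J; field; rewrite gt_eqF.
  by field; rewrite gt_eqF.
- apply: bnd (pair_residual_expansion x tJ JB).
  rewrite !d2 F4 F6 rn /pair_slope /J.
  by rewrite (_ : n.+2 - 2 = n)%N; [field; rewrite gt_eqF|lia].
Qed.

End residuals.

(** * Comparison with the Gaussian *)

Section gaussian_comparison.
Variable R : realType.
Implicit Types (f df : R -> R) (t E : R).

Lemma derivative_expR : derivative (@expR R) (@expR R).
Proof. by move=> x; exact: is_derive_expR. Qed.

Lemma derivative_atan : derivative (@atan R) (fun x => (1 + x ^+ 2)^-1).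
Proof. by move=> x; exact: is_derive1_atan. Qed.

Lemma derivative_sqr (c : R) : derivative (fun x => c * x ^+ 2) (fun x => c * (2 * x)).
Proof.
apply: (derivative_ext _ _ (derivativeZ c (derivativeM (@derivative_id R) (@derivative_id R)))) => x;
  ring.
Qed.

Definition gauss t : R := expR (- 6 * t ^+ 2).

Lemma derivative_gauss_inv : derivative (fun t => expR (6 * t ^+ 2))
  (fun t => expR (6 * t ^+ 2) * (12 * t)).
Proof.
apply: (derivative_ext _ _ (derivative_comp derivative_expR (derivative_sqr 6))) => // x.
by congr (_ * _); ring.
Qed.

Lemma gauss_invK t : gauss t * expR (6 * t ^+ 2) = 1.
Proof. by rewrite /gauss -expRD mulNr addNr expR0. Qed.

Lemma gauss_gt0 t : 0 < gauss t. Proof. exact: expR_gt0. Qed.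

(** An upper bound with an explicit primitive, the arctangent. *)
Lemma gauss_le t : gauss t <= (1 + 6 * t ^+ 2)^-1.
Proof.
have e : 0 < expR (6 * t ^+ 2) by exact: expR_gt0.
have p : 0 < 1 + 6 * t ^+ 2 by have := sqr_ge0 t; lra.
rewrite -(ler_pM2r e) gauss_invK mulrC ler_pdivlMr// mul1r.
exact: expR_ge1Dx.
Qed.

Lemma derivative_nondecreasing f df a b : derivative f df -> a <= b ->
  (forall x, a <= x <= b -> 0 <= df x) -> f a <= f b.
Proof.
move=> fdf ab df0; have [c [c1 c2 E]] := derivative_mean fdf ab.
by rewrite -subr_ge0 E mulr_ge0 ?subr_ge0// df0 ?c1.
Qed.

Lemma derivative_invD1sqr : derivative (fun t : R => (1 + t ^+ 2)^-1)
  (fun t => - (2 * t) / (1 + t ^+ 2) ^+ 2).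
Proof.
have d : derivative (fun t : R => 1 + t ^+ 2) (fun t => 2 * t).
  apply: (derivative_ext _ _ (derivativeD (derivative_cst 1) (derivative_sqr 1))) => x; ring.
move=> x; have p : 1 + x ^+ 2 != 0 by have := sqr_ge0 x => ?; rewrite gt_eqF//; lra.
suff -> : - (2 * x) / (1 + x ^+ 2) ^+ 2 = - (1 + x ^+ 2) ^- 2 *: (2 * x : R^o).
  exact: is_deriveV.
by rewrite -[RHS]/(- (1 + x ^+ 2) ^- 2 * (2 * x)); ring.
Qed.

(** A function that vanishes at 0, whose derivative is at least [exp(6 t^2)]. *)
Let barrier t := expR (6 * t ^+ 2) * (t * (1 + t ^+ 2)^-1).

Let dbarrier t := expR (6 * t ^+ 2) * (12 * t) * (t * (1 + t ^+ 2)^-1) +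
  expR (6 * t ^+ 2) * (1 * (1 + t ^+ 2)^-1 + t * (- (2 * t) / (1 + t ^+ 2) ^+ 2)).

Let derivative_barrier : derivative barrier dbarrier.
Proof.
apply: derivativeM derivative_gauss_inv _.
exact: derivativeM (@derivative_id R) derivative_invD1sqr.
Qed.

Let expR_le_dbarrier t : expR (6 * t ^+ 2) <= dbarrier t.
Proof.
rewrite /dbarrier -mulrA -mulrDr -[leLHS]mulr1 ler_wpM2l ?expR_ge0//.
have z0 := sqr_ge0 t; have p : 0 < 1 + t ^+ 2 by lra.
rewrite -(ler_pM2r (exprn_gt0 2 p)) mul1r.
rewrite [leRHS](_ : _ = 1 + 11 * t ^+ 2 + 12 * (t ^+ 2) ^+ 2); last by field; rewrite gt_eqF.
move: (t ^+ 2) z0 => z z0; nra.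
Qed.

(** Multiplied by the integrating factor [exp(6 t^2)], [f] has a derivative
    bounded by [E exp(6 t^2)], hence by the derivative of [E] times the barrier.
    Integrating naively would lose the decay in [1 / t]. *)
Lemma gauss_compare f df E t : derivative f df ->
  (forall t, `|df t + 12 * t * f t| <= E) -> 0 <= t ->
  `|f t - f 0 * gauss t| <= E * (t / (1 + t ^+ 2)).
Proof.
move=> fdf dfE t0.
have E0 : 0 <= E by apply: le_trans (dfE 0).
pose G t := expR (6 * t ^+ 2).
pose u t := f t * G t; pose du t := (df t + 12 * t * f t) * G t.
have udu : derivative u du.
  apply: (derivative_ext _ _ (derivativeM fdf derivative_gauss_inv)) => // x.
  by rewrite /du /G; ring.
have duE x : - (E * dbarrier x) <= du x <= E * dbarrier x.
  rewrite -ler_norml normrM [`|G x|]ger0_norm ?expR_ge0//.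
  apply: (@le_trans _ _ (E * G x)); first by rewrite ler_wpM2r ?expR_ge0.
  by rewrite ler_wpM2l// expR_le_dbarrier.
have b0 : barrier 0 = 0 by rewrite /barrier mul0r mulr0.
have u0 : u 0 = f 0 by rewrite /u /G expr0n mulr0 expR0 mulr1.
have up : u t - u 0 <= E * barrier t.
  have := @derivative_nondecreasing _ _ 0 t
    (derivativeB (derivativeZ E derivative_barrier) udu) t0.
  rewrite b0 mulr0 => H; have /H : forall x, 0 <= x <= t -> 0 <= E * dbarrier x - du x.
    by move=> x _; have /andP[] := duE x; lra.
  lra.
have lo : - (E * barrier t) <= u t - u 0.
  have := @derivative_nondecreasing _ _ 0 t
    (derivativeD (derivativeZ E derivative_barrier) udu) t0.
  rewrite b0 mulr0 => H; have /H : forall x, 0 <= x <= t -> 0 <= E * dbarrier x + du x.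
    by move=> x _; have /andP[] := duE x; lra.
  lra.
have G0 : 0 < G t by exact: expR_gt0.
rewrite -(ler_pM2r G0) -[in leLHS](gtr0_norm G0) -normrM mulrBl -mulrA gauss_invK mulr1.
rewrite -u0 -/(u t) ler_norml.
rewrite (_ : E * (t / (1 + t ^+ 2)) * G t = E * barrier t); last by rewrite /barrier /G; ring.
by rewrite lo up.
Qed.

Lemma gauss_compare_abs f df E t : derivative f df ->
  (forall t, `|df t + 12 * t * f t| <= E) ->
  `|f t - f 0 * gauss t| <= E.
Proof.
move=> fdf dfE; have E0 : 0 <= E by apply: le_trans (dfE 0).
have half s : 0 <= s -> E * (s / (1 + s ^+ 2)) <= E.
  move=> s0; rewrite -[leRHS]mulr1 ler_wpM2l//.
  by rewrite ler_pdivrMr ?mul1r; have := sqr_ge0 (s - 1); nra.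
have [t0|t0] := leP 0 t; first by rewrite (le_trans (gauss_compare fdf dfE t0))// half.
have gdg : derivative (fun x => f (-1 * x + 0)) (fun x => -1 * df (-1 * x + 0)).
  exact: derivative_affine.
have := @gauss_compare _ _ E (- t) gdg.
rewrite /gauss sqrrN mulr0 !addr0 mulN1r opprK => H.
have nt0 : 0 <= - t by lra.
apply: (le_trans (H _ nt0)); last by have := half _ nt0; rewrite sqrrN.
move=> x; rewrite addr0; have := dfE (- x); rewrite !mulN1r.
by rewrite -[leLHS]normrN; congr (_ <= _); congr `|_|; ring.
Qed.

(** If [f] is within [E] of [f 0] times a Gaussian, its integral over an
    interval of length [2 b] is at most [|f 0|] times the variation of the arctangent,
    plus [2 b E].  It turns the total mass 1 into a lower bound for [|f 0|]. *)
Lemma mass_le f df Pi E b : derivative f df -> derivative Pi f ->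
  (forall t, `|df t + 12 * t * f t| <= E) -> 0 <= b ->
  Pi b - Pi (- b) <= 4 * `|f 0| + 2 * b * E.
Proof.
move=> fdf Pif dfE b0.
have E0 : 0 <= E by apply: le_trans (dfE 0).
have fle x : f x <= `|f 0| * (1 + x ^+ 2)^-1 + E.
  have := gauss_compare_abs x fdf dfE; rewrite ler_norml => /andP[_ H].
  have : f 0 * gauss x <= `|f 0| * (1 + x ^+ 2)^-1.
    apply: (@le_trans _ _ (`|f 0| * gauss x)); first by rewrite ler_wpM2r ?ler_norm ?ltW ?gauss_gt0.
    rewrite ler_wpM2l// (le_trans (gauss_le x))// lef_pV2 ?posrE; have := sqr_ge0 x; lra.
  lra.
have dA : derivative (fun x => `|f 0| * atan x + E * x - Pi x)
   (fun x => `|f 0| * (1 + x ^+ 2)^-1 + E * 1 - f x).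
  apply: derivativeB Pif; apply: derivativeD.
    exact: derivativeZ derivative_atan.
  exact: derivativeZ (@derivative_id R).
have := @derivative_nondecreasing _ _ (- b) b dA.
have -> : - b <= b by lra.
move=> /(_ isT); have H : forall x, - b <= x <= b -> 0 <= `|f 0| * (1 + x ^+ 2)^-1 + E * 1 - f x.
  by move=> x _; have := fle x; lra.
move=> /(_ H); rewrite atanN.
have : atan b <= 2.
  by have := atan_ltpi2 b; have := @pihalf_lt2 R; lra.
move=> a2 ; have f0 := normr_ge0 (f 0).
move: (atan b) (`|f 0|) a2 f0 => a s a2 s0; nra.
Qed.

End gaussian_comparison.

(** * Size of the fourth derivative *)

Section separation.
Variable R : realType.
Implicit Types (t u C E s : R).

(** The polynomial with roots [gamma_minus], [gamma_plus] and their opposites. *)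
Definition quartic t : R := 48 * t ^+ 4 - 24 * t ^+ 2 + 1.

Lemma gammas : let gm := gamma_minus R in let gp := gamma_plus R in
  [/\ 21 / 100 <= gm, 67 / 100 <= gp, gp <= 7 / 10, 45 / 100 <= gp - gm &
   forall t, quartic t = 48 * ((t - gm) * (t - gp) * ((t + gm) * (t + gp)))].
Proof.
rewrite /gamma_minus /gamma_plus.
set a := Num.sqrt (2 / 3).
have a0 : 0 <= a by exact: sqrtr_ge0.
have a2 : a ^+ 2 = 2 / 3 by rewrite sqr_sqrtr.
have [al au] : 81 / 100 <= a /\ a <= 82 / 100 by split; nra.
have m0 : 0 <= 1 - a by lra.
have p0 : 0 <= 1 + a by lra.
have := sqrtr_ge0 (1 - a); have := sqrtr_ge0 (1 + a).
have := sqr_sqrtr m0; have := sqr_sqrtr p0.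
move: (Num.sqrt (1 - a)) (Num.sqrt (1 + a)) => m p p2 m2 pge mge.
have [ml mu] : 42 / 100 <= m /\ m <= 44 / 100 by split; clear -m2 mge al au; nra.
have [pl pu] : 134 / 100 <= p /\ p <= 14 / 10 by split; clear -p2 pge al au; nra.
split; [clear -ml mu pl pu; lra ..|].
move=> t; rewrite /quartic.
have -> : 48 * ((t - 2^-1 * m) * (t - 2^-1 * p) * ((t + 2^-1 * m) * (t + 2^-1 * p))) =
  48 * (t ^+ 2 - m ^+ 2 / 4) * (t ^+ 2 - p ^+ 2 / 4) by field.
rewrite m2 p2.
have -> : 48 * (t ^+ 2 - (1 - a) / 4) * (t ^+ 2 - (1 + a) / 4) =
  48 * t ^+ 4 - 24 * t ^+ 2 + 3 * (1 - a ^+ 2) by field.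
by rewrite a2; field.
Qed.

(** The distances of [t] to the two roots have a product of at least
    [0.225 u], since the roots are at least 0.45 apart; the two other factors have
    a product of at least 0.14, and [48 * 0.225 * 0.14 > 100 / 76]. *)
Lemma quartic_gap u t : 0 <= t -> 0 <= u ->
  t <= gamma_minus R - u \/ gamma_minus R + u <= t <= gamma_plus R - u \/
  gamma_plus R + u <= t ->
  100 / 76 * u <= `|quartic t|.
Proof.
have [] := gammas; move: (gamma_minus R) (gamma_plus R) => m p m1 p1 p2 mp E t0 u0 H.
have d : 9 / 40 * u <= `|(t - m) * (t - p)|.
  case: H => [H|[/andP[H1 H2]|H]].
  - by rewrite ger0_norm; nra.
  - rewrite ler0_norm; last by nra.
    by have [h|h] := leP (t - m) (p - t); nra.
  - by rewrite ger0_norm; nra.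
have c : 14 / 100 <= (t + m) * (t + p) by nra.
rewrite E normrM [`|48|]ger0_norm// normrM.
rewrite [`|(t + m) * _|]ger0_norm; last by clear -c; lra.
move: (`|_|) ((t + m) * _) d c => x y d c; clear -d c u0; nra.
Qed.

Lemma quartic_ge t : 7 / 10 <= t -> 3 * t ^+ 4 <= quartic t.
Proof.
move=> t7; rewrite /quartic.
have : 49 / 100 <= t ^+ 2 by nra.
rewrite (_ : t ^+ 4 = (t ^+ 2) ^+ 2); last by ring.
by move: (t ^+ 2) => z z7; nra.
Qed.

Section at_a_point.
Variables (f : nat -> R) (t : R).

(** The defect at [t] in the [k]-th derivative of the equation
    [f' + 12 t f = 0], where [f k] is the value at [t] of the [k]-th derivative. *)
Definition defect k := f k.+1 + 12 * t * f k + 12 * k%:R * f k.-1.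

(** Successive elimination of [f 3], [f 2] and [f 1] by means of the first four
    equations. *)
Lemma fourth_from_defects : f 4 = 432 * quartic t * f 0 +
  ((432 * t - 12 * t * (144 * t ^+ 2 - 24)) * defect 0 +
   (144 * t ^+ 2 - 36) * defect 1 - 12 * t * defect 2 + defect 3).
Proof. by rewrite /defect /quartic /=; ring. Qed.

(** The quartic is at least [3 t^4], while the coefficients of the defects grow
    like [t^3]. *)
Lemma separation_far E : 7 / 10 <= t -> (forall k, (k <= 3)%N -> `|defect k| <= E) ->
  4 * E < t * `|f 0| -> E < `|f 4|.
Proof.
move=> t7 dE tf.
have E0 : 0 <= E by apply: le_trans (dE 0%N isT).
have t2 : 7 / 10 * t <= t ^+ 2 by nra.
have t3 : 7 / 10 * t ^+ 2 <= t ^+ 3 by rewrite exprS; nra.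
have br : `|(432 * t - 12 * t * (144 * t ^+ 2 - 24)) * defect 0 +
   (144 * t ^+ 2 - 36) * defect 1 - 12 * t * defect 2 + defect 3| <= 4000 * t ^+ 3 * E.
  have c0 : `|432 * t - 12 * t * (144 * t ^+ 2 - 24)| <= 1728 * t ^+ 3 + 720 * t.
    rewrite (_ : 432 * t - 12 * t * (144 * t ^+ 2 - 24) = 720 * t - 1728 * t ^+ 3); last by ring.
    by rewrite ler_norml; apply/andP; split; lra.
  have c1 : `|144 * t ^+ 2 - 36| <= 144 * t ^+ 2 + 36.
    by rewrite ler_norml; apply/andP; split; have := sqr_ge0 t; clear -f; lra.
  have c2 : `|12 * t| <= 12 * t by rewrite ger0_norm; clear -f t7; lra.
  apply: (@le_trans _ _ ((1728 * t ^+ 3 + 720 * t) * E + (144 * t ^+ 2 + 36) * E + 12 * t * E + E)).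
    rewrite (le_trans (ler_normD _ _))// lerD ?dE//.
    rewrite (le_trans (ler_normB _ _))// lerD//; last first.
      by rewrite normrM ler_pM// dE.
    by rewrite (le_trans (ler_normD _ _))// lerD// normrM ler_pM// dE.
  rewrite -[X in _ + X]mul1r -!mulrDl ler_wpM2r//; clear -f t7 t2 t3; lra.
have q3 := quartic_ge t7.
have f4 : 432 * quartic t * `|f 0| - 4000 * t ^+ 3 * E <= `|f 4|.
  rewrite fourth_from_defects; set b := (X in `|_ + X|).
  have q0 : 0 <= 432 * quartic t by have := sqr_ge0 (t ^+ 2); rewrite -exprM /=; clear -f q3; lra.
  have := ler_normB (432 * quartic t * f 0 + b) b; rewrite addrK normrM (ger0_norm q0).
  move: br; rewrite -/b; lra.
have k : 3 * t ^+ 3 * (t * `|f 0|) <= quartic t * `|f 0|.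
  by rewrite mulrA ler_wpM2r// -mulrA -exprSr.
have k3 : 343 / 1000 <= t ^+ 3 by clear -f t7 t2 t3; lra.
have {}f4 : 432 * (quartic t * `|f 0|) - 4000 * t ^+ 3 * E <= `|f 4| by rewrite mulrA.
move: (t ^+ 3) (t * `|f 0|) (quartic t * `|f 0|) k3 f4 k tf => c x y k3 f4 k tf.
have : c * (4 * E) < c * x by rewrite ltr_pM2l//; clear -f k3; lra.
have : 343 / 1000 * E <= c * E by rewrite ler_wpM2r.
clear -f E0 f4 k; lra.
Qed.

(** The ratios to [exp (- 6 t^2)] of its derivatives up to order 6. *)
Definition hermite k : R := match k with
  | 0 => 1
  | 1 => - 12 * t
  | 2 => 144 * t ^+ 2 - 12
  | 3 => 432 * t - 1728 * t ^+ 3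
  | 4 => 432 * quartic t
  | 5 => - 12 * t * (432 * quartic t) - 48 * (432 * t - 1728 * t ^+ 3)
  | _ => - 12 * t * (- 12 * t * (432 * quartic t) - 48 * (432 * t - 1728 * t ^+ 3))
         - 60 * (432 * quartic t)
  end.

(** Three-term recurrence for the errors; as [12 t <= 9], their bounds grow
    like 1, 10, 115, 1396, 18100, 250000. *)
Lemma hermite_close E : 0 <= t <= 7 / 10 -> (forall k, (k <= 5)%N -> `|defect k| <= E) ->
  forall k, (k <= 6)%N -> `|f k - hermite k * f 0| <= 250 * 1000 * E.
Proof.
move=> /andP[t0 t7] dE.
have E0 : 0 <= E by apply: le_trans (dE 0%N isT).
pose d k := f k - hermite k * f 0.
have step k : (1 <= k <= 5)%N -> d k.+1 = defect k - 12 * t * d k - 12 * k%:R * d k.-1.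
  by case: k => [|[|[|[|[|[|k]]]]]] // _; rewrite /d /defect /hermite /quartic /=; ring.
have bstep k a b c : (1 <= k <= 5)%N -> `|d k| <= a * E -> `|d k.-1| <= b * E ->
    1 + 9 * a + 12 * k%:R * b <= c -> `|d k.+1| <= c * E.
  move=> k5 ka kb abc; rewrite step//.
  apply: (@le_trans _ _ (E + 9 * (a * E) + 12 * k%:R * (b * E))).
    rewrite (le_trans (ler_normB _ _))// lerD//; last first.
      by rewrite normrM ler_pM// ger0_norm// mulr_ge0.
    rewrite (le_trans (ler_normB _ _))// lerD// ?dE//; first by case/andP: k5.
    rewrite normrM ler_pM//; rewrite ger0_norm; lra.
  by rewrite !mulrA -[X in X + _ + _]mul1r -!mulrDl ler_wpM2r.
have d0 : `|d 0%N| <= 0 * E by rewrite /d /hermite mul1r subrr normr0 mul0r.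
have d1 : `|d 1%N| <= 1 * E.
  rewrite mul1r (_ : d 1%N = defect 0) ?dE//.
  by rewrite /d /defect /hermite; ring.
have d2 : `|d 2%N| <= 10 * E by apply: (bstep 1%N _ _ _ isT d1 d0); clear -f t; lra.
have d3 : `|d 3%N| <= 115 * E by apply: (bstep 2%N _ _ _ isT d2 d1); clear -f t; lra.
have d4 : `|d 4%N| <= 1396 * E by apply: (bstep 3%N _ _ _ isT d3 d2); clear -f t; lra.
have d5 : `|d 5%N| <= 181 * 100 * E by apply: (bstep 4%N _ _ _ isT d4 d3); clear -f t; lra.
have d6 : `|d 6%N| <= 250 * 1000 * E by apply: (bstep 5%N _ _ _ isT d5 d4); clear -f t; lra.
have up a k : a <= 250 * 1000 -> `|d k| <= a * E -> `|d k| <= 250 * 1000 * E.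
  by move=> aa /le_trans; apply; rewrite ler_wpM2r.
case=> [|[|[|[|[|[|[|k]]]]]]] k6; last by [].
- by apply: up d0; clear -f t; lra.
- by apply: up d1; clear -f t; lra.
- by apply: up d2; clear -f t; lra.
- by apply: up d3; clear -f t; lra.
- by apply: up d4; clear -f t; lra.
- by apply: up d5; clear -f t; lra.
- by apply: up d6; clear -f t; lra.
Qed.

(** With [z = 12 t^2], the first polynomial is [hermite 6 / 1728], and the
    second one is the coefficient of [f 0 / n] in [f 4], up to the factor [432 / 60]. *)
Let cubic (z : R) : 0 <= z <= 6 -> `|z ^+ 3 - 15 * z ^+ 2 + 45 * z - 15| <= 97 /\
  `|16 * z ^+ 3 - 168 * z ^+ 2 + 384 * z - 96| <= 600.
Proof.
move=> /andP[z0 z6].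
have p1 := mulr_ge0 z0 (sqr_ge0 (z - 2)); have p2 := mulr_ge0 z0 (sqr_ge0 (z - 6)).
have q6 : 0 <= 6 - z by lra.
have p3 := mulr_ge0 q6 (sqr_ge0 (z - 2)); have p4 := mulr_ge0 q6 (sqr_ge0 (z - 4)).
have p5 := mulr_ge0 z0 (sqr_ge0 (z - 5)); have p6 := mulr_ge0 q6 (sqr_ge0 z).
have p7 := mulr_ge0 q6 (sqr_ge0 (z - 5)).
by split; rewrite ler_norml; apply/andP; split; nra.
Qed.

(** Substituting [defect k = hermite (k + 3) f 0 / (60 n) + O(n^-2)] in
    [fourth_from_defects] gives [f 4] up to [O(n^-2)] as [f 0] times
    [432 quartic t] plus a term in [1 / n] with an explicit coefficient. *)
Lemma separation_near (n C : R) : 0 <= t <= 7 / 10 -> 1 <= n -> 0 <= C ->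
  (forall k, (k <= 5)%N -> `|defect k| <= 2 * C / n) ->
  (forall k, (k <= 3)%N -> `|defect k - f (k + 3) / (60 * n)| <= C / n ^+ 2) ->
  100 / n <= `|quartic t| -> 1000 * C < n * `|f 0| ->
  C / n ^+ 2 + `|f 6| / (21 * n) < `|f 4|.
Proof.
move=> tI n1 C0 dE dF pq nf; have /andP[t0 t7] := tI.
have n0 : 0 < n by lra.
pose q := C / n ^+ 2.
have q0 : 0 <= q by rewrite divr_ge0 ?exprn_ge0// ltW.
have He := hermite_close tI dE.
have qE a : 0 <= a -> a * (2 * C / n) / n = 2 * a * q by move=> _; rewrite /q; field; rewrite gt_eqF.
have e k : (k <= 3)%N -> `|defect k - hermite (k + 3) * f 0 / (60 * n)| <= 10 * 1000 * q.
  move=> k3; have h1 := dF k k3; have h2 := He (k + 3)%N (leq_add k3 (leqnn 3)).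
  have -> : defect k - hermite (k + 3) * f 0 / (60 * n) =
    (defect k - f (k + 3) / (60 * n)) + (f (k + 3) - hermite (k + 3) * f 0) / (60 * n).
    by ring.
  rewrite (le_trans (ler_normD _ _))//.
  apply: (@le_trans _ _ (q + 250 * 1000 * (2 * C / n) / (60 * n))).
    rewrite lerD// normrM [`|_^-1|]ger0_norm; last by rewrite invr_ge0; clear -f n0; lra.
    by rewrite ler_wpM2r// invr_ge0; clear -f n0; lra.
  have -> : 250 * 1000 * (2 * C / n) / (60 * n) = 250 * 1000 * 2 / 60 * q.
    by rewrite /q; field; rewrite gt_eqF.
  lra.
pose z := 12 * t ^+ 2.
have zI : 0 <= z <= 6 by rewrite /z; apply/andP; split; clear -f t0 t7; nra.
have [h6 h8] := cubic zI.
pose b := `|f 0|; have b0 : 0 <= b by exact: normr_ge0.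
have bn : 1000 * q < b / n.
  rewrite (_ : 1000 * q = 1000 * C / n / n); last by rewrite /q; field; rewrite gt_eqF.
  by rewrite ltr_pM2r ?invr_gt0// ltr_pdivrMr// [b * n]mulrC.
have f6 : `|f 6| / (21 * n) <= 1728 * 97 / 21 * (b / n) + 250 * 1000 * 2 / 21 * q.
  have H6 : `|hermite 6| <= 1728 * 97.
    have -> : hermite 6 = 1728 * (z ^+ 3 - 15 * z ^+ 2 + 45 * z - 15).
      by rewrite /hermite /quartic /z; ring.
    by rewrite normrM normr_nat ler_wpM2l ?ler0n.
  have := He 6 isT; have := ler_normD (f 6 - hermite 6 * f 0) (hermite 6 * f 0).
  rewrite subrK normrM -/b => u1 u2.
  have u3 : `|hermite 6| * b <= 1728 * 97 * b by rewrite ler_wpM2r.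
  rewrite (_ : 1728 * 97 / 21 * (b / n) + 250 * 1000 * 2 / 21 * q =
    (1728 * 97 * b + 250 * 1000 * (2 * C / n)) / (21 * n)); last first.
    by rewrite /q; field; rewrite gt_eqF.
  rewrite ler_wpM2r ?invr_ge0; clear -f n0 u1 u2 u3; lra.
pose eps k := defect k - hermite (k + 3) * f 0 / (60 * n).
pose T := (432 * t - 12 * t * (144 * t ^+ 2 - 24)) * eps 0%N +
   (144 * t ^+ 2 - 36) * eps 1%N - 12 * t * eps 2%N + eps 3%N.
pose P := 16 * z ^+ 3 - 168 * z ^+ 2 + 384 * z - 96.
have f4 : f 4 = 432 * quartic t * f 0 + 432 / 60 * P * (f 0 / n) + T.
  rewrite [LHS]fourth_from_defects /T /eps /P /hermite /quartic /z /=; field.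
  by rewrite gt_eqF.
have TE : `|T| <= 1200 * (10 * 1000 * q).
  have t2 : 0 <= t ^+ 2 <= 49 / 100 by apply/andP; split; clear -f t0 t7; nra.
  have /andP[t2a t2b] := t2.
  have c0 : `|432 * t - 12 * t * (144 * t ^+ 2 - 24)| <= 1046.
    rewrite (_ : 432 * t - 12 * t * (144 * t ^+ 2 - 24) = t * (720 - 1728 * t ^+ 2)); last by ring.
    move: (t ^+ 2) t2a t2b => w w0 w1.
    by rewrite ler_norml; apply/andP; split; clear -f t0 t7 w0 w1; nra.
  have c1 : `|144 * t ^+ 2 - 36| <= 110.
    by rewrite ler_norml; apply/andP; split; clear -f t2a t2b; lra.
  have c2 : `|12 * t| <= 43 by rewrite ger0_norm; clear -f t0 t7; lra.
  set Q := 10 * 1000 * q.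
  rewrite (_ : 1200 * Q = 1046 * Q + 110 * Q + 43 * Q + Q); last by ring.
  rewrite (le_trans (ler_normD _ _))// lerD ?e//.
  rewrite (le_trans (ler_normB _ _))// lerD//; last by rewrite normrM ler_pM// e.
  by rewrite (le_trans (ler_normD _ _))// lerD// normrM ler_pM// e.
have PE : `|432 / 60 * P * (f 0 / n)| <= 432 / 60 * 600 * (b / n).
  rewrite !normrM [`|n^-1|]ger0_norm ?invr_ge0 ?(ltW n0)// -/b.
  rewrite normr_nat normfV normr_nat.
  by rewrite ler_wpM2r ?divr_ge0 ?(ltW n0)// ler_wpM2l ?divr_ge0 ?ler0n.
have f0E : 432 * 100 * (b / n) <= `|432 * quartic t * f 0|.
  rewrite normrM -/b [b / n]mulrC mulrA ler_wpM2r// normrM normr_nat -mulrA.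
  by rewrite ler_wpM2l ?ler0n.
(* The quartic contributes at least 43200 |f 0| / n, against 4320 |f 0| / n for the
   correction to f 4 and less than 8000 |f 0| / n for f 6; the difference outweighs the
   errors in n^-2, which are below 13000000 C / n^2. *)
have : `|432 * quartic t * f 0| <= `|f 4| + `|432 / 60 * P * (f 0 / n)| + `|T|.
  have -> : 432 * quartic t * f 0 = f 4 - 432 / 60 * P * (f 0 / n) - T by rewrite f4; ring.
  by rewrite (le_trans (ler_normB _ _))// lerD2r ler_normB.
rewrite -/q; clear -f f6 TE PE f0E bn q0; lra.
Qed.

End at_a_point.
End separation.

Section density_separation.
Variable R : realType.
Implicit Types (F : nat -> R -> R) (t C : R).

(** Gathers all that is used about the density: uniform bounds, approximate
    Hermite equations and total mass 1. *)
Lemma density_separation C : 0 <= C -> exists N : nat, forall n, (N <= n)%N ->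
  forall F,
  derivative (F 0%N) (F 1%N) ->
  (exists Pi, derivative Pi (F 0%N) /\
     Pi (Num.sqrt n%:R / 2) - Pi (- (Num.sqrt n%:R / 2)) = 1) ->
  (forall k t, (k <= 8)%N -> `|F k t| <= C) ->
  (forall k t, (k <= 5)%N ->
     `|defect (F ^~ t) t k - F (k + 3)%N t / (60 * n%:R)| <= C / n%:R ^+ 2) ->
  forall t, 0 <= t -> t <= 7 / 10 \/ 6 * t ^+ 2 <= ln n%:R ->
  t <= gamma_minus R - 76 / n%:R \/
  gamma_minus R + 76 / n%:R <= t <= gamma_plus R - 76 / n%:R \/
  gamma_plus R + 76 / n%:R <= t ->
  C / n%:R ^+ 2 + `|F 6 t| / (21 * n%:R) < `|F 4 t|.
Proof.
(* Beyond T0 the inequality t >= T0 alone makes t * (n * gauss t) large; up to T0 the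
   Gaussian is at least gauss T0 and n is large. *)
move=> C0; pose T0 := 80 * C + 1.
have g1 := gauss_gt0 (1 : R); have gT := gauss_gt0 T0.
pose B1 := 16 * C ^+ 2; pose B2 := 9 * 1000 * C / gauss 1; pose B3 := 120 * C / gauss T0.
have B10 : 0 <= B1 by have := sqr_ge0 C; rewrite /B1; lra.
have B20 : 0 <= B2 by apply: divr_ge0; [lra|exact: ltW].
have B30 : 0 <= B3 by apply: divr_ge0; [lra|exact: ltW].
exists (Num.bound (1 + B1 + B2 + B3)) => n Nn F dF [Pi [dPi mass]] Fb Fd t t0 tu tg.
have nB : 1 + B1 + B2 + B3 < n%:R.
  have := archi_boundP (_ : 0 <= 1 + B1 + B2 + B3).
  move=> /(_ ltac:(lra)) /lt_le_trans; apply; by rewrite ler_nat.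
set m : R := n%:R in nB *.
have m0 : 0 < m by lra.
have m1 : 1 <= m by lra.
have B3m : B3 < m by lra.
pose E := 2 * C / m.
have E0 : 0 <= E by rewrite divr_ge0 ?(ltW m0)// mulr_ge0.
have dE k (x : R) : (k <= 5)%N -> `|defect (F ^~ x) x k| <= E.
  move=> k5; have h1 := Fd k x k5; have h2 := Fb (k + 3)%N x (leq_add k5 (leqnn 3)).
  have h3 := ler_normD (defect (F ^~ x) x k - F (k + 3)%N x / (60 * m)) (F (k + 3)%N x / (60 * m)).
  rewrite subrK in h3; apply: (le_trans h3).
  have h4 : `|F (k + 3)%N x / (60 * m)| <= C / m.
    rewrite normrM [`|_^-1|]ger0_norm; last by rewrite invr_ge0; clear -m0; lra.
    rewrite ler_pM ?invr_ge0//; first by clear -m0; lra.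
    by rewrite lef_pV2 ?posrE; clear -m0; lra.
  have h5 : C / m ^+ 2 <= C / m.
    rewrite ler_wpM2l// lef_pV2 ?posrE ?exprn_gt0//; clear -m1; nra.
  rewrite /E; move: h1 h4 h5; rewrite -/m; clear; lra.
have d0 (x : R) : `|F 1%N x + 12 * x * F 0%N x| <= E.
  by have := dE 0%N x isT; rewrite /defect /= mulr0 mul0r addr0.
have s8 : 8^-1 <= `|F 0%N 0|.
  have r0 : 0 < Num.sqrt m by rewrite sqrtr_gt0.
  have := mass_le dF dPi d0 (_ : 0 <= Num.sqrt m / 2).
  move=> /(_ ltac:(clear -r0; lra)); rewrite mass.
  have rm : Num.sqrt m ^+ 2 = m by rewrite sqr_sqrtr// ltW.
  have rC : 4 * C <= Num.sqrt m.
    have : (4 * C) ^+ 2 <= Num.sqrt m ^+ 2 by rewrite rm /B1 in nB *; clear -nB B20 B30; lra.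
    by rewrite ler_pXn2r// nnegrE ?mulr_ge0// ltW.
  have : 2 * (Num.sqrt m / 2) * E <= 1 / 2.
    rewrite /E -{2}rm.
    have -> : 2 * (Num.sqrt m / 2) * (2 * C / Num.sqrt m ^+ 2) = 2 * C / Num.sqrt m.
      by field; rewrite gt_eqF.
    by rewrite ler_pdivrMr//; clear -rC; lra.
  clear; lra.
have F0 (x : R) : 0 <= x -> gauss x / 8 - E * (x / (1 + x ^+ 2)) <= `|F 0%N x|.
  move=> x0; have h := gauss_compare dF d0 x0.
  have h2 := ler_normB (F 0%N x) (F 0%N x - F 0%N 0 * gauss x).
  rewrite opprB addrC subrK normrM [`|gauss x|]gtr0_norm ?gauss_gt0// in h2.
  have : gauss x / 8 <= `|F 0%N 0| * gauss x by rewrite mulrC ler_wpM2r// ltW// gauss_gt0.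
  clear -h h2; lra.
have frac (x : R) : x / (1 + x ^+ 2) <= 1 /\ x * (x / (1 + x ^+ 2)) <= 1.
  have p : 0 < 1 + x ^+ 2 by have := sqr_ge0 x; clear; lra.
  split; first by rewrite ler_pdivrMr// mul1r; have := sqr_ge0 (x - 1); clear; nra.
  by rewrite mulrA ler_pdivrMr// mul1r; clear; nra.
have [t7|t7] := leP t (7 / 10).
- have tI : 0 <= t <= 7 / 10 by rewrite t0.
  apply: (@separation_near _ (F ^~ t) t m C tI m1 C0) => [k k5|k k3||].
  + exact: dE.
  + by apply: Fd; apply: leq_trans k3 _.
  + have := quartic_gap t0 (_ : 0 <= 76 / m) tg.
    move=> /(_ ltac:(by rewrite divr_ge0// ltW)).
    by rewrite (_ : 100 / 76 * (76 / m) = 100 / m)//; field; rewrite gt_eqF.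
  + have h := F0 t t0; have [h1 _] := frac t.
    have gt1 : gauss 1 <= gauss t by rewrite /gauss ler_expR; clear -t0 t7; nra.
    have h3 : E * (t / (1 + t ^+ 2)) <= E by rewrite -[leRHS]mulr1 ler_wpM2l.
    have h4 : m * (gauss 1 / 8 - E) <= m * `|F 0%N t|.
      by rewrite ler_wpM2l ?(ltW m0)//; clear -h h3 gt1; lra.
    have h5 : m * E = 2 * C by rewrite /E; field; rewrite gt_eqF.
    have h6 : 9 * 1000 * C < m * gauss 1.
      by rewrite -ltr_pdivrMr//; rewrite -/B2; clear -nB B10 B30; lra.
    rewrite mulrBr h5 in h4; clear -C0 h4 h6; lra.
- have tln : 6 * t ^+ 2 <= ln m by case: tu => // h; clear -h t7; lra.
  have ng : 1 <= m * gauss t.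
    rewrite -ler_pdivrMl// mulr1 /gauss -[m^-1]lnK ?posrE ?invr_gt0//.
    by rewrite ler_expR lnV ?posrE//; clear -tln; lra.
  have key : 80 * C < m * (t * gauss t).
    have [tT|tT] := leP T0 t.
      have : t * 1 <= t * (m * gauss t) by rewrite ler_wpM2l.
      rewrite mulrCA mulr1 /T0 in tT *; clear -tT C0; lra.
    have gg : gauss T0 <= gauss t.
      by rewrite /gauss ler_expR !mulNr lerN2 ler_wpM2l// !expr2 ler_pM// ltW.
    have : 120 * C < m * gauss T0 by rewrite -ltr_pdivrMr//; exact: B3m.
    have : 7 / 10 * gauss T0 <= t * gauss t by apply: ler_pM; [clear; lra|exact: ltW|exact: ltW|].
    move: (gauss T0) (t * gauss t) gT => u v u0 h1 h2.
    have : m * (7 / 10 * u) <= m * v by rewrite ler_wpM2l// ltW.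
    clear -h2 C0; lra.
  have far : 4 * E < t * `|F 0%N t|.
    have h := F0 t t0; have [_ h1] := frac t.
    have h2 : t * (gauss t / 8 - E * (t / (1 + t ^+ 2))) <= t * `|F 0%N t| by rewrite ler_wpM2l.
    have h3 : E * (t * (t / (1 + t ^+ 2))) <= E by rewrite -[leRHS]mulr1 ler_wpM2l.
    have h4 : 5 * E < t * gauss t / 8.
      rewrite -(ltr_pM2l m0) (_ : m * (5 * E) = 10 * C); last by rewrite /E; field; rewrite gt_eqF.
      clear -key; lra.
    rewrite mulrBr mulrA mulrCA in h2; clear -h2 h3 h4; lra.
  have := @separation_far _ (F ^~ t) t E (ltW t7) (fun k k3 => dE k t (leq_trans k3 (isT : (3 <= 5)%N))) far.
  apply: le_lt_trans; rewrite /E.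
  have h5 : C / m ^+ 2 <= C / m.
    by rewrite ler_wpM2l// lef_pV2 ?posrE ?exprn_gt0//; clear -m1; nra.
  have h4 : `|F 6 t| / (21 * m) <= C / m.
    rewrite ler_pM ?invr_ge0 ?Fb//; first by clear -m0; lra.
    by rewrite lef_pV2 ?posrE; clear -m0; lra.
  clear -h4 h5; lra.
Qed.

End density_separation.

(** * Signs of the slopes *)

Section slopes_opposite.
Variable R : realType.
Implicit Types t : R.

Lemma slopes_opposite : exists N : nat, forall n t, (N <= n)%N ->
  0 <= t -> t <= 7 / 10 \/ 6 * t ^+ 2 <= ln n%:R ->
  t <= gamma_minus R - 76 / n%:R \/
  gamma_minus R + 76 / n%:R <= t <= gamma_plus R - 76 / n%:R \/
  gamma_plus R + 76 / n%:R <= t ->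
  tail_slope n (- (Num.sqrt n%:R * t)) * pair_slope n (- (Num.sqrt n%:R * t)) < 0.
Proof.
have [C1 C10 H1] := @density_bound R 8.
have [C2 C20 H2] := @density_ode R 5.
have [C3 C30 H3] := @slopes_expansion R.
pose C := C1 + C2 + 720 * C3.
have C0 : 0 <= C by rewrite /C; lra.
have [C1C C2C C3C] : [/\ C1 <= C, C2 <= C & 720 * C3 <= C] by split; rewrite /C; lra.
have [N HN] := density_separation C0.
exists (N + 60)%N => n t nN t0 tu tg.
have n60 : (60 <= n)%N by apply: leq_trans nN; apply: leq_addl.
have m0 : 0 < n%:R :> R by rewrite ltr0n; apply: leq_trans n60.
have q0 : 0 <= (n%:R ^+ 2)^-1 :> R by rewrite invr_ge0 exprn_ge0// ltW.
have sep : C / n%:R ^+ 2 + `|density n 6 t| / (21 * n%:R) < `|density n 4 t|.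
  apply: (HN n _ (density n)) => //.
  - by apply: leq_trans nN; apply: leq_addr.
  - by apply: derivative_density; apply: leq_trans n60.
  - by apply: density_mass; apply: leq_trans n60.
  - by move=> k u k8; apply: le_trans C1C; apply: H1 => //; apply: leq_trans n60.
  - move=> k u k5; apply: (@le_trans _ _ (C2 / n%:R ^+ 2)); last by rewrite ler_wpM2r.
    by apply: H2 => //; apply: leq_trans n60.
have [/= h1 h2] := H3 n t n60.
move: h1 h2 sep; move: (density n 4 t) (density n 6 t) => x y.
move: (tail_slope _ _) (pair_slope _ _) => u v.
have r0 : 0 < Num.sqrt n%:R :> R by rewrite sqrtr_gt0.
have w0 : 0 < Num.sqrt n%:R ^+ 5 :> R by rewrite exprn_gt0.
move: (Num.sqrt n%:R ^+ 5) w0 => w w0 h1 h2 sep.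
have yd k : `|y / (k * 720 * n%:R)| = `|y / n%:R| / `|k * 720|.
  by rewrite -!normfV -!normrM; congr `|_|; rewrite !invfM; ring.
have yE : `|y / n%:R| = `|y| / n%:R by rewrite normrM [`|_^-1|]gtr0_norm ?invr_gt0.
have y0 : 0 <= `|y / n%:R| by [].
have e21 : `|y| / (21 * n%:R) = `|y / n%:R| / 21 by rewrite yE invfM; ring.
have c3 : 720 * (C3 / n%:R ^+ 2) <= C / n%:R ^+ 2 by rewrite mulrA ler_wpM2r.
rewrite e21 in sep.
have d21 : `|y / (21 * 720 * n%:R)| = `|y / n%:R| / (21 * 720).
  by rewrite yd [`|_ * 720|]normrM !normr_nat.
have d42 : `|y / (42 * 720 * n%:R)| = `|y / n%:R| / (42 * 720).
  by rewrite yd [`|_ * 720|]normrM !normr_nat.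
have [uE vE] : `|w * u / n%:R - x / 720| < `|x| / 720 /\ `|w * v + x / 720| < `|x| / 720.
  split.
  - apply: (@le_lt_trans _ _ (C3 / n%:R ^+ 2 + `|y / (42 * 720 * n%:R)|)).
      apply: le_trans (lerD h1 (lexx _)); apply: le_trans (ler_normB _ _).
      rewrite le_eqVlt; apply/orP; left; apply/eqP; congr `|_|; ring.
    by rewrite d42; clear -sep c3 y0; lra.
  - apply: (@le_lt_trans _ _ (C3 / n%:R ^+ 2 + `|y / (21 * 720 * n%:R)|)).
      apply: le_trans (lerD h2 (lexx _)); apply: le_trans (ler_normD _ _).
      rewrite le_eqVlt; apply/orP; left; apply/eqP; congr `|_|; ring.
    by rewrite d21; clear -sep c3 y0; lra.
have [x0|x0] := leP 0 x.
- rewrite (ger0_norm x0) in uE vE.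
  move: uE vE; rewrite !ltr_norml => /andP[a1 _] /andP[_ a2].
  have u0 : 0 < u.
    have : 0 < w * u / n%:R by clear -a1 x0; lra.
    by rewrite pmulr_lgt0 ?invr_gt0// pmulr_rgt0.
  have v0 : v < 0.
    have : w * v < 0 by clear -a2 x0; lra.
    by rewrite pmulr_rlt0.
  by rewrite pmulr_rlt0.
- rewrite (ltr0_norm x0) in uE vE.
  move: uE vE; rewrite !ltr_norml => /andP[_ a1] /andP[a2 _].
  have u0 : u < 0.
    have : w * u / n%:R < 0 by clear -a1 x0; lra.
    by rewrite pmulr_llt0 ?invr_gt0// pmulr_rlt0.
  have v0 : 0 < v.
    have : 0 < w * v by clear -a2 x0; lra.
    by rewrite pmulr_rgt0.
  by rewrite nmulr_rlt0.
Qed.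

End slopes_opposite.

(** * Second-order perturbations of splines *)

Section perturbations.
Variable R : realType.
Implicit Types (J : nat -> R -> R) (t x h q B : R).

(** The error of the two-term Taylor expansion of a central difference. *)
Lemma cdiff_expansion J B x h : tower 4 J -> (forall z, `|J 4 z| <= B) ->
  0 < h -> `|cdiff h (J 0%N) x / h - (J 1%N x + h ^+ 2 / 24 * J 3 x)| <= B * h ^+ 3.
Proof.
move=> tJ JB h0.
have B0 : 0 <= B by apply: le_trans (JB 0).
have := taylor_le x (h / 2) tJ JB; have := taylor_le x (- (h / 2)) tJ JB.
rewrite !big_ord_recl !big_ord0 /= /bump /= !normrN.
have -> : `|h / 2| ^+ 4 = h ^+ 4 / 16.
  by rewrite ger0_norm ?divr_ge0 ?(ltW h0)//; field.
set f1 := 1`!%:R; set f2 := 2`!%:R; set f3 := 3`!%:R.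
have [-> -> ->] : [/\ f1 = 1 :> R, f2 = 2 :> R & f3 = 6 :> R] by [].
move=> h1 h2.
have : `|cdiff h (J 0%N) x - h * (J 1%N x + h ^+ 2 / 24 * J 3 x)| <= B * h ^+ 4 / 8.
  move: (lerD h2 h1) => /(le_trans (ler_normB _ _)).
  rewrite (_ : B * h ^+ 4 / 8 = B * (h ^+ 4 / 16) + B * (h ^+ 4 / 16)); last by field.
  apply: le_trans; rewrite le_eqVlt; apply/orP; left; apply/eqP; congr `|_|.
  by rewrite /cdiff; field.
move=> h3; rewrite -(ler_pM2l h0) -[X in X * `|_|](gtr0_norm h0) -normrM.
rewrite mulrBr (mulrC h (_ / h)) divfK ?gt_eqF//.
apply: (le_trans h3); rewrite (_ : h * (B * h ^+ 3) = B * h ^+ 4); last by ring.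
have : 0 <= B * h ^+ 4 by rewrite mulr_ge0// exprn_ge0// ltW.
clear; lra.
Qed.

(** The new coordinate [h] acts in three ways of the same order: through the
    norm [l] in the prefactor (the term [J 1 x]), through [l] in the offset [- l t]
    (the term [x * J 2 x]), and through the difference with step [h] (the term
    [J 3 x]). *)
Lemma tail_perturbation J B r t : tower 4 J -> 1 <= r ->
  (forall k z, (1 <= k <= 4)%N -> `|J k z| <= B) ->
  exists K, forall h, 0 < h <= 1 ->
    let l := Num.sqrt (r ^+ 2 + h ^+ 2) in let x := - (r * t) in
    `|l / h * cdiff h (J 0%N) (- (l * t)) - r * J 1%N x -
      h ^+ 2 / (2 * r) * (J 1%N x + x * J 2 x + r ^+ 2 / 12 * J 3 x)| <= K * h ^+ 3.
Proof.
move=> tJ r1 JB; pose x := - (r * t).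
have B0 : 0 <= B by apply: le_trans (JB 1%N 0 isT).
exists ((1 + `|x|) * B + `|t| * B + (r + 1) * (B * `|t| ^+ 2) + B +
  (r + 1) * (B * `|t|) + (r + 1) * B).
move=> h /andP[h0 h1]; cbv zeta; set l := Num.sqrt _; rewrite -/x; set y := - (l * t).
have l2 : l ^+ 2 = r ^+ 2 + h ^+ 2.
  by rewrite sqr_sqrtr// addr_ge0 ?sqr_ge0.
have l0 : 0 <= l by exact: sqrtr_ge0.
pose dl := l - r.
have dlE : dl * (2 * r + dl) = h ^+ 2 by rewrite /dl; ring: l2.
have dl0 : 0 <= dl.
  by rewrite subr_ge0 -(@ler_pXn2r _ 2)// ?nnegrE ?l2 ?lerDl ?sqr_ge0//; clear -r1; lra.
have hp k : 0 <= h ^+ k by rewrite exprn_ge0// ltW.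
have dl_le : dl <= h ^+ 2 by rewrite -dlE; clear -dl0 r1; nra.
have dl1 : dl <= 1 by apply: (le_trans dl_le); rewrite exprn_ile1// ltW.
have lr : `|l| <= r + 1 by rewrite ger0_norm//; move: dl1; rewrite /dl; clear; lra.
have dh : dl <= h.
  by apply: (le_trans dl_le); rewrite expr2 ler_piMl// ltW.
have dl2 : dl ^+ 2 <= h ^+ 3 by rewrite [leRHS]exprSr expr2 ler_pM.
have dlh : dl * h ^+ 2 <= h ^+ 3 by rewrite [leRHS]exprS ler_wpM2r.
have yx : y = x + - (dl * t) by rewrite /y /x /dl; ring.
have E1 := cdiff_expansion y tJ (fun z => JB 4 z isT) h0.
have E2 : `|J 3 y - J 3 x| <= B * `|t| * dl.
  have := @derivative_dist_le R _ _ B x (- (dl * t)) (tJ 3 isT) (fun z _ => JB 4 _ isT).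
  by rewrite normrN normrM (ger0_norm dl0) -yx -mulrA [`|t| * _]mulrC.
have E3 : `|J 1%N y - (J 1%N x - dl * t * J 2 x)| <= B * `|t| ^+ 2 * h ^+ 3.
  have := @taylor_le R 2 (fun i => J i.+1) B x (- (dl * t))
    (fun i i2 => tJ i.+1 (leq_trans i2 (isT : (2 <= 3)%N))) (fun z => JB 3 z isT).
  rewrite -yx !big_ord_recl big_ord0 /= /bump /= normrN normrM exprMn (ger0_norm dl0) => H.
  apply: (@le_trans _ _ (B * (dl ^+ 2 * `|t| ^+ 2))).
    apply: le_trans H; rewrite le_eqVlt; apply/orP; left; apply/eqP; congr `|_ - _|.
    by rewrite fact0 (_ : 1`! = 1%N)//; field.
  by rewrite -mulrA ler_wpM2l// mulrC ler_wpM2l// exprn_ge0.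
have E4 : `|dl - h ^+ 2 / (2 * r)| <= 1 * h ^+ 3.
  have -> : dl - h ^+ 2 / (2 * r) = - (dl ^+ 2 / (2 * r)).
    by rewrite -dlE; field; rewrite gt_eqF//; clear -r1; lra.
  rewrite normrN mul1r; apply: le_trans dl2.
  rewrite ger0_norm; last by rewrite divr_ge0 ?sqr_ge0//; clear -r1; lra.
  by rewrite ler_pdivrMr; have := sqr_ge0 dl; clear -r1; nra.
set e1 := cdiff _ _ _ / _ - _ in E1; set e2 := _ - _ in E2; set e3 := _ - _ in E3.
set e4 := _ - _ in E4.
have -> : l / h * cdiff h (J 0%N) y - r * J 1%N x -
      h ^+ 2 / (2 * r) * (J 1%N x + x * J 2 x + r ^+ 2 / 12 * J 3 x) =
    e4 * (J 1%N x + x * J 2 x) - dl ^+ 2 * t * J 2 x + l * e3 +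
    dl * h ^+ 2 * (J 3 x / 24) + l * (h ^+ 2 / 24) * e2 + l * e1.
  rewrite /e1 /e2 /e3 /e4 /x /dl; field.
  by rewrite !gt_eqF//; clear -r1; lra.
have JBx k : (1 <= k <= 4)%N -> `|J k x| <= B by exact: JB.
have b1 : `|e4 * (J 1%N x + x * J 2 x)| <= (1 + `|x|) * B * h ^+ 3.
  rewrite normrM mulrC ler_pM//; last by rewrite mul1r in E4.
  rewrite mulrDl mul1r (le_trans (ler_normD _ _))// lerD ?JBx// normrM ler_wpM2l// JBx//.
have b2 : `|dl ^+ 2 * t * J 2 x| <= `|t| * B * h ^+ 3.
  rewrite -mulrA normrM mulrC ler_pM//; first by rewrite normrM ler_wpM2l// JBx.
  by rewrite ger0_norm ?sqr_ge0.
have b3 : `|l * e3| <= (r + 1) * (B * `|t| ^+ 2) * h ^+ 3.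
  by rewrite normrM -[leRHS]mulrA ler_pM.
have b4 : `|dl * h ^+ 2 * (J 3 x / 24)| <= B * h ^+ 3.
  rewrite normrM mulrC ler_pM//; last by rewrite ger0_norm// mulr_ge0.
  by rewrite normrM normfV normr_nat; have := JBx 3 isT; have := normr_ge0 (J 3 x); clear; lra.
have b5 : `|l * (h ^+ 2 / 24) * e2| <= (r + 1) * (B * `|t|) * h ^+ 3.
  rewrite -[l * _ * _]mulrA normrM -[leRHS]mulrA ler_pM// normrM.
  apply: (@le_trans _ _ (h ^+ 2 * (B * `|t| * dl))).
    rewrite ler_pM// ger0_norm ?divr_ge0//.
    by rewrite ler_pdivrMr//; have := hp 2; clear; lra.
  by rewrite mulrCA ler_wpM2l ?mulr_ge0// mulrC.
have b6 : `|l * e1| <= (r + 1) * B * h ^+ 3 by rewrite normrM -[leRHS]mulrA ler_pM.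
have tri (a b c d e f : R) : `|a - b + c + d + e + f| <= `|a| + `|b| + `|c| + `|d| + `|e| + `|f|.
  do 4! rewrite (le_trans (ler_normD _ _))// lerD//.
  exact: ler_normB.
apply: (le_trans (tri _ _ _ _ _ _)).
move: b1 b2 b3 b4 b5 b6; clear; lra.
Qed.

(** The differences with steps [(p + q) / 2] and [(p - q) / 2] only involve
    the shifts [p / 2] and [q / 2]; here [p = 2 - dl], and [1 - q^2 / 2] is the
    product of the two steps.  The expression [V0] is the second difference at
    [q = 0]. *)
Lemma pair_perturbation J B x q dl : tower 3 J ->
  (forall k z, (2 <= k <= 3)%N -> `|J k z| <= B) -> 0 < q <= 1 ->
  0 <= dl <= q ^+ 2 -> dl * (4 - dl) = q ^+ 2 ->
  let V0 := J 0%N (x + 1) + J 0%N (x - 1) - 2 * J 0%N x in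
  `|J 0%N (x + (2 - dl) / 2) + J 0%N (x - (2 - dl) / 2) -
      J 0%N (x + q / 2) - J 0%N (x - q / 2) - (1 - q ^+ 2 / 2) * V0 -
    q ^+ 2 / 2 * (V0 - (J 1%N (x + 1) - J 1%N (x - 1)) / 4 - J 2 x / 2)| <= 2 * B * q ^+ 3.
Proof.
move=> tJ JB /andP[q0 q1] /andP[dl0 dlq] dlE; cbv zeta; set V0 := _ - 2 * _.
have B0 : 0 <= B by apply: le_trans (JB 2%N 0 isT).
have hp k : 0 <= q ^+ k by rewrite exprn_ge0// ltW.
have dq : dl <= q by apply: (le_trans dlq); rewrite expr2 ler_piMl// ltW.
have dl2 : dl ^+ 2 <= q ^+ 3 by rewrite [leRHS]exprSr expr2 ler_pM.
have E1 y z : `|J 0%N (y + z) - (J 0%N y + z * J 1%N y)| <= B * z ^+ 2.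
  have := @taylor_le R 2 J B y z
    (fun i i2 => tJ i (leq_trans i2 (isT : (2 <= 3)%N))) (fun w => JB 2 w isT).
  rewrite !big_ord_recl big_ord0 /= /bump /= -[z ^+ 2]ger0_norm ?sqr_ge0// normrX.
  apply: le_trans; rewrite le_eqVlt; apply/orP; left; apply/eqP; congr `|_ - _|.
  by rewrite fact0 (_ : 1`! = 1%N)// /addn /=; field.
have E2 z : `|J 0%N (x + z) - (J 0%N x + z * J 1%N x + z ^+ 2 / 2 * J 2 x)| <= B * `|z| ^+ 3.
  have := taylor_le x z tJ (fun w => JB 3 w isT).
  rewrite !big_ord_recl big_ord0 /= /bump /=.
  apply: le_trans; rewrite le_eqVlt; apply/orP; left; apply/eqP; congr `|_ - _|.
  by rewrite fact0 (_ : 1`! = 1%N)// (_ : 2`! = 2%N)//; field.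
have e1 := E1 (x + 1) (- (dl / 2)); have e2 := E1 (x - 1) (dl / 2).
have e3 := E2 (q / 2); have e4 := E2 (- (q / 2)).
have e5 : `|J 1%N (x + 1) - J 1%N (x - 1)| <= B * 2.
  have := @derivative_dist_le R _ _ B (x - 1) 2 (tJ 1%N isT) (fun z _ => JB 2%N _ isT).
  by rewrite normr_nat (_ : x - 1 + 2 = x + 1)//; ring.
rewrite sqrrN in e1; rewrite normrN in e4; rewrite (ger0_norm (_ : 0 <= q / 2)) in e3 e4; last first.
  by rewrite divr_ge0// ltW.
rewrite (_ : x + (2 - dl) / 2 = x + 1 + - (dl / 2)); last by field.
rewrite (_ : x - (2 - dl) / 2 = x - 1 + dl / 2); last by field.
set a1 := _ - _ in e1; set a2 := _ - _ in e2; set a3 := _ - _ in e3; set a4 := _ - _ in e4.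
set a5 := _ - _ in e5.
have -> : J 0%N (x + 1 + - (dl / 2)) + J 0%N (x - 1 + dl / 2) -
      J 0%N (x + q / 2) - J 0%N (x - q / 2) - (1 - q ^+ 2 / 2) * V0 -
    q ^+ 2 / 2 * (V0 - a5 / 4 - J 2 x / 2) = a1 + a2 - a3 - a4 - dl ^+ 2 / 8 * a5.
  by rewrite /a1 /a2 /a3 /a4 /a5 /V0 sqrrN expr_div_n -dlE; field.
have tri (a b c d e : R) : `|a + b - c - d - e| <= `|a| + `|b| + `|c| + `|d| + `|e|.
  do 3! rewrite (le_trans (ler_normB _ _))// lerD//.
  exact: ler_normD.
apply: (le_trans (tri _ _ _ _ _)).
have b5 : `|dl ^+ 2 / 8 * a5| <= q ^+ 3 / 8 * (B * 2).
  by rewrite normrM ler_pM// ger0_norm ?divr_ge0 ?sqr_ge0// ler_pM2r.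
have b1 : B * (dl / 2) ^+ 2 <= B * q ^+ 3 / 4.
  by rewrite -mulrA ler_wpM2l// expr_div_n ler_pM ?invr_ge0 ?sqr_ge0//; clear; lra.
have b3 : B * (q / 2) ^+ 3 = B * q ^+ 3 / 8 by field.
have bq : 0 <= B * q ^+ 3 by rewrite mulr_ge0.
move: e1 e2 e3 e4 b5 b1 b3 bq; clear; lra.
Qed.

End perturbations.

(** * Volumes at vectors that differ from the diagonal in a few coordinates *)

Section profiles.
Variable R : realType.
Implicit Types (l x t : R) (cs : seq R).

Lemma cdiffs_dilate l cs (f : R -> R) : l != 0 ->
  cdiffs [seq l^-1 * c | c <- cs] (fun x => f (l * x)) = (fun x => cdiffs cs f (l * x)).
Proof.
move=> l0; elim: cs => // c cs IH; apply/funext => x.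
by rewrite /= IH /cdiff; congr (cdiffs _ _ _ - cdiffs _ _ _); field.
Qed.

Lemma cdiffsZ cs (f : R -> R) a :
  cdiffs cs (fun x => a * f x) = (fun x => a * cdiffs cs f x).
Proof. by elim: cs => // c cs IH; apply/funext => x; rewrite /= IH /cdiff -mulrBr. Qed.

(** The formula of [section_volume_spline] for a multiple of the unit vector,
    which spares the normalisation of its entries. *)
Lemma section_volume_homogeneous d (b : 'rV[R]_d) t l cs : 0 < l -> sphere_orthant b ->
  perm_eq cs [seq h <- [seq l * b 0 i | i <- enum 'I_d] | 0 < h] -> (1 < size cs)%N ->
  section_volume t b =
  (l * (\prod_(c <- cs) c)^-1 * cdiffs cs (@tpow R (size cs).-1) (- (l * t)))%:E.
Proof.
move=> l0 bS pcs scs; have ln : l != 0 by rewrite gt_eqF.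
have := @section_volume_spline R d b t [seq l^-1 * c | c <- cs] bS.
rewrite size_map => -> //; last first.
  apply: (perm_trans (perm_map _ pcs)).
  have pos (g : 'I_d -> R) : [seq h <- [seq g i | i <- enum 'I_d] | 0 < h] =
    [seq g i | i <- [seq i <- enum 'I_d | 0 < g i]] by rewrite filter_map.
  rewrite !pos -map_comp.
  rewrite (eq_filter (a2 := fun i => 0 < b 0 i)); last by move=> i /=; rewrite pmulr_rgt0.
  have E : (fun c => l^-1 * c) \o (fun i => l * b 0 i) =1 b 0 by move=> i /=; rewrite mulKf.
  by rewrite (eq_map E).
congr EFin; case: cs pcs scs => // c cs _ _; set k := (size _).-1.
have E : @tpow R k = (fun x => (l ^+ k)^-1 * tpow k (l * x)).
  by apply/funext => x; rewrite tpow_scale ?(ltW l0)// mulKf// expf_neq0.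
rewrite [X in cdiffs (map _ _) X]E cdiffsZ cdiffs_dilate// mulrN mulrA; congr (_ * _).
rewrite big_map; have -> : forall s : seq R, \prod_(c <- s) (l^-1 * c) = l ^- size s * \prod_(c <- s) c.
  elim=> [|e s IH]; first by rewrite !big_nil expr0 invr1 mulr1.
  by rewrite !big_cons IH /= exprS; field; rewrite ln expf_neq0.
rewrite /k /= invfM invrK exprS; set Q := (\prod_(_ <- _) _)^-1.
by field; rewrite expf_neq0.
Qed.

Lemma perm_positive_values (I : finType) (S : {set I}) (s : seq I) (f : I -> R) :
  uniq s -> {in s, forall i, 0 < f i} ->
  (forall i, i \notin s -> f i = (i \in S)%:R) ->
  perm_eq ([seq f i | i <- s] ++ nseq #|S :\: [set i in s]| 1)
    [seq h <- [seq f i | i <- enum I] | 0 < h].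
Proof.
move=> us fs fS.
have : perm_eq (s ++ [seq i <- enum I | i \notin s]) (enum I).
  rewrite perm_sym -(perm_filterC (mem s) (enum I)) perm_cat2r.
  apply: uniq_perm => //; first by rewrite filter_uniq ?enum_uniq.
  by move=> i; rewrite mem_filter mem_enum andbT.
move=> /(perm_map f)/(perm_filter (fun h => 0 < h)) H; apply: perm_trans H.
rewrite map_cat filter_cat (_ : [seq h <- map f s | 0 < h] = map f s); last first.
  by apply/all_filterP/allP => _ /mapP[i si ->]; exact: fs.
rewrite perm_cat2l filter_map -filter_predI.
rewrite (_ : [seq i <- enum I | _] = enum (S :\: [set i in s])); last first.
  rewrite enumT [RHS]/enum_mem; apply: eq_filter => i /=; rewrite !inE /=; case: (boolP (i \in s)) => [|si]; first by rewrite andbF.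
  by rewrite fS// ltr0n lt0b andbT.
have /all_pred1P -> : all (pred1 1) [seq f i | i <- enum (S :\: [set i in s])].
  by apply/allP => h /mapP[i]; rewrite mem_enum !inE => /andP[si iS] ->; rewrite fS// iS.
by rewrite size_map cardE.
Qed.

(** The vectors to be compared have the entries [1 / l] on [S] and 0 elsewhere,
    except on a short list [s] of coordinates. *)
Lemma section_volume_profile d t (S : {set 'I_d}) (s : seq 'I_d) (f : 'I_d -> R) l m :
  uniq s -> {in s, forall i, 0 < f i} ->
  (forall i, i \notin s -> f i = (i \in S)%:R) ->
  #|S :\: [set i in s]| = m -> 0 < l -> l ^+ 2 = \sum_(i <- s) f i ^+ 2 + m%:R ->
  (1 < size s + m)%N ->
  let b := \row_i (l^-1 * f i) in sphere_orthant b /\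
  section_volume t b = (l * (\prod_(i <- s) f i)^-1 *
    cdiffs [seq f i | i <- s] (spline m (size s + m).-1) (- (l * t)))%:E.
Proof.
move=> us fs fS Sm l0 l2 sm b.
have pf := perm_positive_values us fs fS; rewrite Sm in pf.
have f0 i : 0 <= f i.
  by have [/fs/ltW//|/fS ->] := boolP (i \in s); rewrite ler0n.
have bS : sphere_orthant b.
  split; last by move=> i; rewrite mxE mulr_ge0 ?invr_ge0// ltW.
  have -> : dot b b = (l ^+ 2)^-1 * \sum_i f i ^+ 2.
    by rewrite mulr_sumr; apply: eq_bigr => i _; rewrite !mxE; field; rewrite gt_eqF.
  have -> : \sum_i f i ^+ 2 = l ^+ 2.
    rewrite l2 -big_enum /= -(big_map f predT (fun x => x ^+ 2)) (bigID (fun h => 0 < h)) /=.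
    rewrite [X in _ + X]big1_seq ?addr0.
      rewrite -big_filter -(perm_big _ pf) big_cat big_map big_nseq /=; congr (_ + _).
      by rewrite expr1n iter_addr addr0.
    move=> h /andP[hn /mapP[i _ hE]]; rewrite (_ : h = 0) ?expr0n//.
    by apply/le_anti; rewrite leNgt hn hE f0.
  by rewrite mulVf// expf_neq0// gt_eqF.
split=> //.
rewrite (@section_volume_homogeneous _ b t l ([seq f i | i <- s] ++ nseq m 1) l0 bS).
- rewrite size_cat size_map size_nseq cdiffs_cat big_cat big_map big_nseq /=.
  rewrite (_ : iter m _ 1 = 1) ?mulr1; last by elim: m {Sm l2 sm pf} => //= m ->; rewrite mulr1.
  congr (_ * cdiffs _ _ _)%:E; rewrite /spline.
  by move: (tpow _) => g; elim: m {Sm l2 sm pf} => //= m ->.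
- have E : f =1 (fun i => l * b 0 i) by move=> i; rewrite mxE mulVKf// gt_eqF.
  by rewrite -(eq_map E).
- by rewrite size_cat size_map size_nseq.
Qed.

End profiles.

(** * Directions of increase and decrease at the diagonal *)

Section directions.
Variable R : realType.
Implicit Types (t x h : R).

(** The component of [p - q] orthogonal to [a] is a direction of the
    hyperplane, hence orthogonal to [p - q], hence 0.  So [p - q], with entries in
    0, 1 and -1, is a multiple of [a], which is nonnegative. *)
Lemma normal_of_face_diagonal d n t (a : 'rV[R]_d) : (0 < n)%N -> sphere_orthant a ->
  orthogonal_to_face_diagonal n (hyperplane t a) ->
  exists S : {set 'I_d}, #|S| = n /\ forall i, a 0 i = (Num.sqrt n%:R)^-1 * (i \in S)%:R.
Proof.
move=> n0 [aa a0] [p [q [[pv qv Sn] orth]]].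
set S := [set i | _]%SET in Sn; exists S; split=> //.
pose v := p - q; pose c := dot v a; pose w := v - c *: a.
have dotBZ (x y : 'rV[R]_d) : dot x (y - c *: a) = dot x y - c * dot x a.
  by rewrite /dot mulr_sumr -sumrB; apply: eq_bigr => i _; rewrite !mxE; ring.
have aw : dot a w = 0 by rewrite /w dotBZ aa mulr1 dotC subrr.
have wv : dot w v = 0.
  pose x0 := ((\sum_i a 0 i) / 2 - t) *: a.
  have dx0 : dot a x0 = (\sum_i a 0 i) / 2 - t.
    rewrite /x0; move: (_ / 2 - t) => k; rewrite -[RHS]mulr1 -[X in _ = _ * X]aa.
    by rewrite /dot mulr_sumr; apply: eq_bigr => i _; rewrite !mxE mulrCA.
  have dxw : dot a (x0 + w) = (\sum_i a 0 i) / 2 - t.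
    rewrite -dx0 -[RHS]addr0 -[X in _ = _ + X]aw /dot -big_split.
    by apply: eq_bigr => i _; rewrite !mxE mulrDr.
  by have := orth _ _ dxw dx0; rewrite addrC addKr.
have ww : dot w w = 0 by rewrite {2}/w dotBZ wv dotC aw mulr0 subrr.
have w0 i : w 0 i = 0.
  apply/eqP; rewrite -sqrf_eq0 expr2; apply/eqP.
  by move/eqP: ww; rewrite /dot psumr_eq0 => [/allP/(_ i (mem_index_enum i))/eqP//|j _]; rewrite -expr2 sqr_ge0.
have va i : v 0 i = c * a 0 i by have := w0 i; rewrite !mxE => /eqP; rewrite subr_eq0 => /eqP.
have v2 i : v 0 i ^+ 2 = (i \in S)%:R.
  rewrite inE !mxE; have [->|pq] := eqVneq (p 0 i) (q 0 i); first by rewrite subrr expr0n.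
  move: pq; case: (pv i) => ->; case: (qv i) => ->; rewrite ?eqxx// => _.
    by rewrite sub0r sqrrN expr1n.
  by rewrite subr0 expr1n.
have c2 : c ^+ 2 = n%:R.
  have : \sum_i v 0 i ^+ 2 = c ^+ 2 * dot a a.
    by rewrite mulr_sumr; apply: eq_bigr => i _; rewrite va exprMn expr2.
  rewrite aa mulr1 => <-; under eq_bigr do rewrite v2.
  by rewrite -Sn -sum1_card natr_sum [RHS]big_mkcond; apply: eq_bigr => i _; case: (i \in S).
have cn : Num.sqrt n%:R = `|c| by rewrite -c2 sqrtr_sqr.
have c0 : 0 < `|c| by rewrite -cn sqrtr_gt0 ltr0n.
move=> i; rewrite cn; apply: (@mulfI _ `|c|); first by rewrite gt_eqF.
rewrite mulVKf ?gt_eqF// -[a 0 i]ger0_norm// -normrM -va -sqrtr_sqr v2.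
by case: (i \in S); rewrite ?sqrtr1 ?sqrtr0.
Qed.

(** Along a family of unit vectors [b] within distance [h] of [a], the volume
    changes by [c h^2 + O(h^3)] up to a positive factor [1 / k], which may depend on
    [h]. *)
Definition quadratic_variation d t (a : 'rV[R]_d) (v0 c : R) := exists K, forall h,
  0 < h <= 1 -> exists b v k, [/\ sphere_orthant b, forall i, `|b 0 i - a 0 i| <= h,
    section_volume t b = v%:E, 0 < k & `|k * (v - v0) - c * h ^+ 2| <= K * h ^+ 3].

Lemma quadratic_variation_sign d t (a : 'rV[R]_d) v0 c U :
  quadratic_variation t a v0 c -> c != 0 -> nbhs a U ->
  exists b v, [/\ (@sphere_orthant R d `&` U) b, section_volume t b = v%:E &
    0 < c * (v - v0)].
Proof.
move=> [K H] c0 /nbhs_ballP[e /= e0 aeU].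
have c1 : 0 < `|c| by rewrite normr_gt0.
pose h := Num.min 1 (Num.min (e / 2) (`|c| / (2 * (`|K| + 1)))).
have K1 : 0 < `|K| + 1 by rewrite ltr_wpDl.
have h0 : 0 < h by rewrite !lt_min ltr01 !divr_gt0// mulr_gt0.
have [h1 he hc] : [/\ h <= 1, h <= e / 2 & h <= `|c| / (2 * (`|K| + 1))].
  by split; rewrite !ge_min lexx ?orbT.
have [|b [v [k [bS ba bv k0 bK]]]] := H h; first by rewrite h0.
exists b, v; split=> //.
  split=> //; apply: aeU; split=> // i j; rewrite /ball /= distrC ord1.
  by apply: (le_lt_trans (ba j)); apply: (le_lt_trans he); move: e0; clear; lra.
have h2 : 0 < h ^+ 2 by rewrite exprn_gt0.
have : `|k * (v - v0) - c * h ^+ 2| < `|c| * h ^+ 2.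
  apply: (le_lt_trans bK); apply: (@le_lt_trans _ _ (`|K| * h * h ^+ 2)).
    by rewrite -mulrA -exprS ler_wpM2r ?exprn_ge0 ?(ltW h0)// ler_norm.
  rewrite ltr_pM2r// ; move: hc; rewrite ler_pdivlMr ?mulr_gt0//.
  by have := normr_ge0 K; move: h0 c1; clear; move: `|K| `|c| => u w; nra.
rewrite -(pmulr_rgt0 _ k0) [k * (c * _)]mulrCA.
case: (ltgtP c 0) c0 => // cs _; rewrite ltr_norml => /andP[a1 a2].
  by rewrite nmulr_rgt0//; move: a1 a2; rewrite (ltr0_norm cs); clear; lra.
by rewrite pmulr_rgt0//; move: a1 a2; rewrite (gtr0_norm cs); clear; lra.
Qed.

Lemma spline_bounded n : (8 <= n)%N -> exists B, forall k x, (1 <= k <= 4)%N ->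
  `|@spline R n (n - k) x| <= B.
Proof.
move=> n8; have H k : (k < 4)%N -> exists B, forall x, `|@spline R n (n - k.+1) x| <= B.
  move=> k4; have [C _ HC] := @spline_bound R k.
  by exists (C / Num.sqrt n%:R ^+ k.+1) => x; apply: HC; lia.
have [B1 H1] := H 0%N isT; have [B2 H2] := H 1%N isT.
have [B3 H3] := H 2%N isT; have [B4 H4] := H 3%N isT.
exists (Num.max (Num.max B1 B2) (Num.max B3 B4)) => k x.
case: k => [|[|[|[|[|k]]]]] // _; rewrite !le_max.
- by rewrite H1.
- by rewrite H2 orbT.
- by rewrite H3 orbT.
- by rewrite H4 !orbT.
Qed.

Lemma sub_le_of_sqr (l r h : R) : 1 <= r -> r <= l -> (l - r) * (l + r) = h ^+ 2 ->
  h ^+ 2 <= h -> l - r <= h.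
Proof. nra. Qed.

(** The decrease [dl] of the sum of two coordinates with squared norm 2 when
    their difference becomes [q]. *)
Lemma spread_parameter q : 0 < q <= 1 -> exists dl : R,
  [/\ 0 <= dl <= q ^+ 2, dl * (4 - dl) = q ^+ 2 & 3 * dl <= 1].
Proof.
move=> /andP[q0 q1].
have q2 : q ^+ 2 <= 1 by rewrite exprn_ile1// ltW.
have s2 : Num.sqrt (4 - q ^+ 2) ^+ 2 = 4 - q ^+ 2 by rewrite sqr_sqrtr//; lra.
have s0 := sqrtr_ge0 (4 - q ^+ 2).
have qq : 0 <= q ^+ 2 by exact: sqr_ge0.
exists (2 - Num.sqrt (4 - q ^+ 2)).
move: (q ^+ 2) (Num.sqrt _) q2 s2 s0 qq => z s z1 s2 s0 z0.
have dl0 : s <= 2 by nra.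
have dlz : 2 - s <= z by nra.
split; [lra|lra|nra].
Qed.

Section at_diagonal.
Variables (d n : nat) (t : R) (S : {set 'I_d}).
Hypotheses (n10 : (10 <= n)%N) (Sn : #|S| = n).
Let r := Num.sqrt n%:R : R.
Let x := - (r * t).
Let a : 'rV[R]_d := \row_i (r^-1 * (i \in S)%:R).
Let v0 := r * spline n (n - 1) x.

Let r0 : 0 < r.
Proof. by rewrite sqrtr_gt0 ltr0n; apply: leq_trans n10. Qed.

Let r1 : 1 <= r.
Proof. by rewrite -sqrtr1 ler_wsqrtr// ler1n; apply: leq_trans n10. Qed.

Let r2 : r ^+ 2 = n%:R.
Proof. by rewrite sqr_sqrtr. Qed.

Lemma section_volume_diagonal : section_volume t a = v0%:E.
Proof.
have := @section_volume_profile R d t S [::] (fun i => (i \in S)%:R) r n isT.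
have -> : S :\: [set i in [::]] = S by apply/setP => i; rewrite !inE.
case=> //; last first.
- by move=> _ ->; rewrite big_nil invr1 mulr1 /= /v0 subn1.
- by apply: leq_trans n10.
- by rewrite big_nil add0r.
Qed.

(** The vectors [(1, ..., 1, h, 0, ..., 0) / sqrt (n + h^2)]. *)
Lemma tail_variation j0 : j0 \notin S ->
  quadratic_variation t a v0 (tail_slope n x / (2 * r)).
Proof.
move=> j0S; have [B HB] := spline_bounded (leq_trans (isT : (8 <= 10)%N) n10).
have tJ : tower 4 (fun i => @spline R n (n - i)).
  move=> i i4 /=; have -> : (n - i = (n - i).-2.+2)%N by lia.
  have -> : (n - i.+1 = (n - i).-2.+1)%N by lia.
  exact: spline_derivative.
have [K HK] := tail_perturbation t tJ r1 HB.
exists K => h /andP[h0 h1]; have := HK h; rewrite h0 h1 => /(_ isT).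
cbv zeta; rewrite -/x subn0 r2; set l := Num.sqrt _ => Kh.
have l2 : l ^+ 2 = n%:R + h ^+ 2 by rewrite sqr_sqrtr// addr_ge0// ?ler0n ?sqr_ge0.
have l0 : 0 < l.
  by rewrite sqrtr_gt0; have := sqr_ge0 h; rewrite -r2 => h2; rewrite ltr_wpDr// exprn_gt0.
have rl : r <= l by rewrite -(@ler_pXn2r _ 2)// ?nnegrE ?(ltW r0) ?(ltW l0)// l2 r2 lerDl sqr_ge0.
pose f i : R := if i == j0 then h else (i \in S)%:R.
have [||||||bS bv] := @section_volume_profile R d t S [:: j0] f l n isT.
- by move=> i; rewrite inE /f => ->.
- by move=> i; rewrite inE /f => /negbTE ->.
- by rewrite -[RHS]Sn; apply: eq_card => i; rewrite !inE; case: eqVneq => // ->; rewrite (negbTE j0S).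
- exact: l0.
- by rewrite big_seq1 /f eqxx l2 addrC.
- by rewrite /= add1n ltnS; apply: leq_trans n10.
exists (\row_i (l^-1 * f i)), (l * h^-1 * cdiff h (spline n n) (- (l * t))), 1; split=> //.
- move=> i; rewrite !mxE /f; case: eqVneq => [->|_].
    rewrite (negbTE j0S) mulr0 subr0 ger0_norm ?mulr_ge0 ?invr_ge0 ?(ltW l0) ?(ltW h0)//.
    by rewrite ler_piMl ?(ltW h0)// invf_le1// (le_trans r1).
  rewrite -mulrBl normrM; apply: (@le_trans _ _ (h * 1)); last by rewrite mulr1.
  apply: ler_pM => //; last by case: (i \in S); rewrite ?normr1 ?normr0.
  have -> : l^-1 - r^-1 = - ((l - r) / (l * r)) by field; rewrite !gt_eqF.
  rewrite normrN ger0_norm; last by rewrite divr_ge0 ?subr_ge0// mulr_ge0 ?(ltW l0) ?(ltW r0).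
  rewrite ler_pdivrMr ?mulr_gt0//.
  have lr1 : 1 <= l * r by apply: mulr_ege1 => //; apply: le_trans rl.
  have : (l - r) * (l + r) = h ^+ 2 by rewrite -subr_sqr l2 r2 addrAC subrr add0r.
  have hs : h <= h * (l * r) by rewrite ler_peMr// ltW.
  move=> lrh; apply: le_trans hs; have : h ^+ 2 <= h by rewrite expr2 ler_piMl// ltW.
  exact: sub_le_of_sqr r1 rl lrh.
- by rewrite bv /= big_seq1 /f eqxx.
- have -> : 1 * (l / h * cdiff h (spline n n) (- (l * t)) - v0) - tail_slope n x / (2 * r) * h ^+ 2 =
    l / h * cdiff h (spline n n) (- (l * t)) - v0 - h ^+ 2 / (2 * r) * tail_slope n x by ring.
  exact: Kh.
Qed.

(** The vectors [(c1, c2, 1, ..., 1, 0, ..., 0) / sqrt n], where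
    [c1^2 + c2^2 = 2]. *)
Lemma pair_variation : quadratic_variation t a v0 (pair_slope n x / 2).
Proof.
pose m := (n - 2)%N; have nm : n = m.+2 by rewrite /m; lia.
have [B HB] := @spline_bounded m ltac:(rewrite /m; lia).
pose J i := @spline R m (m.+1 - i).
have tJ : tower 3 J.
  move=> i i3; rewrite /J; have -> : (m.+1 - i = (m - i).-1.+2)%N by rewrite /m; lia.
  have -> : (m.+1 - i.+1 = (m - i).-1.+1)%N by rewrite /m; lia.
  exact: spline_derivative.
have JB k z : (2 <= k <= 3)%N -> `|J k z| <= B.
  by move=> k23; rewrite /J (_ : m.+1 - k = m - k.-1)%N; [apply: HB|]; lia.
have /card_gt1P[i1 [i2 [i1S i2S i12]]] : (1 < #|S|)%N by rewrite Sn; apply: leq_trans n10.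
exists (2 * B) => q /andP[q0 q1].
have [dl [dlI dlE dl3]] := spread_parameter (introT andP (conj q0 q1)).
have /andP[dl0 dlq] := dlI.
have {}dlq : dl <= q by apply: (le_trans dlq); rewrite expr2 ler_piMl// ltW.
have := pair_perturbation x tJ JB (introT andP (conj q0 q1)) dlI dlE.
cbv zeta; set V0 := _ - 2 * J 0%N x; set W := _ - J 0%N (x - q / 2) => Hq.
have V0E : V0 = spline n (n - 1) x.
  rewrite nm subn1 -[spline _ _ _]/(cdiff 1 (cdiff 1 (J 0%N)) x) /V0 /cdiff.
  have -> : x + 1 / 2 + 1 / 2 = x + 1 :> R by field.
  have -> : x + 1 / 2 - 1 / 2 = x :> R by field.
  have -> : x - 1 / 2 + 1 / 2 = x :> R by field.
  have -> : x - 1 / 2 - 1 / 2 = x - 1 :> R by field.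
  by ring.
pose c1 := (2 - dl + q) / 2; pose c2 := (2 - dl - q) / 2.
have c10 : 0 < c1 by rewrite divr_gt0//; lra.
have c20 : 0 < c2 by rewrite divr_gt0//; lra.
have cc : c1 * c2 = 1 - q ^+ 2 / 2.
  have -> : c1 * c2 = ((2 - dl) ^+ 2 - q ^+ 2) / 4 by rewrite /c1 /c2; field.
  by rewrite -dlE; field.
have c11 : `|c1 - 1| <= q by rewrite /c1 ler_norml; lra.
have c21 : `|c2 - 1| <= q by rewrite /c2 ler_norml; lra.
pose f i : R := if i == i1 then c1 else if i == i2 then c2 else (i \in S)%:R.
have f1 : f i1 = c1 by rewrite /f eqxx.
have f2 : f i2 = c2 by rewrite /f eq_sym (negbTE i12) eqxx.
have us : uniq [:: i1; i2] by rewrite /= inE i12.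
have [|||||| bS bv] := @section_volume_profile R d t S [:: i1; i2] f r m us.
- by move=> i; rewrite !inE => /orP[]/eqP ->; rewrite ?f1 ?f2.
- by move=> i; rewrite !inE /f => /norP[/negbTE -> /negbTE ->].
- rewrite (_ : S :\: _ = (S :\ i1) :\ i2); last first.
    by apply/setP => i; rewrite !inE negb_or andbCA andbA.
  have := cardsD1 i1 S; have := cardsD1 i2 (S :\ i1).
  rewrite !inE i1S i2S eq_sym i12 Sn /= !add1n => E2 E1.
  by rewrite /m E1 E2 subn2.
- exact: r0.
- rewrite big_cons big_seq1 f1 f2 r2 [in LHS]nm -addn2 natrD addrC; congr (_ + _).
  have -> : c1 ^+ 2 + c2 ^+ 2 = ((2 - dl) ^+ 2 + q ^+ 2) / 2 by rewrite /c1 /c2; field.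
  by rewrite -dlE; field.
- by [].
have WE : W = cdiff c1 (cdiff c2 (J 0%N)) x.
  rewrite /W /cdiff.
  have -> : x + c1 / 2 + c2 / 2 = x + (2 - dl) / 2 by rewrite /c1 /c2; field.
  have -> : x + c1 / 2 - c2 / 2 = x + q / 2 by rewrite /c1 /c2; field.
  have -> : x - c1 / 2 + c2 / 2 = x - q / 2 by rewrite /c1 /c2; field.
  have -> : x - c1 / 2 - c2 / 2 = x - (2 - dl) / 2 by rewrite /c1 /c2; field.
  by ring.
exists (\row_i (r^-1 * f i)), (r * (c1 * c2)^-1 * W), (c1 * c2 / r); split=> //.
- move=> i; rewrite !mxE -mulrBr normrM; apply: (@le_trans _ _ (1 * q)); last by rewrite mul1r.
  apply: ler_pM => //; first by rewrite ger0_norm ?invr_ge0 ?(ltW r0)// invf_le1.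
  have [->|n1] := eqVneq i i1; first by rewrite f1 i1S.
  have [->|n2] := eqVneq i i2; first by rewrite f2 i2S.
  by rewrite /f (negbTE n1) (negbTE n2) subrr normr0 ltW.
- by rewrite bv WE /J big_cons big_seq1 /= f1 f2 subn0.
- by rewrite divr_gt0// mulr_gt0.
- have -> : c1 * c2 / r * (r * (c1 * c2)^-1 * W - v0) = W - (1 - q ^+ 2 / 2) * V0.
    by rewrite /v0 -V0E -cc; field; rewrite !gt_eqF.
  apply: le_trans Hq; rewrite /pair_slope -V0E.
  have -> : (n - 2 = m.+1 - 1)%N by rewrite [X in (X - 2)%N]nm.
  have -> : (n - 3 = m.+1 - 2)%N by rewrite [X in (X - 3)%N]nm.
  rewrite [X in spline X (m.+1 - 1)]subn1 [X in spline X (m.+1 - 2)]subn1 -/(J 1%N) -/(J 2).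
  by rewrite le_eqVlt; apply/orP; left; apply/eqP; congr `|_|; field.
Qed.

End at_diagonal.
End directions.

(** The bound [gamma_plus <= 7 / 10] allows the first two intervals to be
    treated together. *)
Lemma range_cases (R : realType) n (t : R) : (0 < n)%N ->
  (`[0, gamma_minus R - 76 / n%:R] `|`
   `[gamma_minus R + 76 / n%:R, gamma_plus R - 76 / n%:R] `|`
   `[gamma_plus R + 76 / n%:R, Num.sqrt (ln n%:R / 6)]) t ->
  [/\ 0 <= t, t <= 7 / 10 \/ 6 * t ^+ 2 <= ln n%:R &
  t <= gamma_minus R - 76 / n%:R \/
  gamma_minus R + 76 / n%:R <= t <= gamma_plus R - 76 / n%:R \/
  gamma_plus R + 76 / n%:R <= t].
Proof.
move=> n0; have [m1 p1 p2 mp _] := gammas R.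
have k0 : 0 <= 76 / n%:R :> R by rewrite divr_ge0.
case=> [[|]|]; rewrite /= in_itv /= => /andP[t1 t2].
- by split; [|left; lra|left].
- by split; [lra|left; lra|right; left; rewrite t1].
- have t0 : 0 <= t by lra.
  split; [by []|right|by right; right].
  have : t ^+ 2 <= Num.sqrt (ln n%:R / 6) ^+ 2 by rewrite ler_pXn2r// nnegrE sqrtr_ge0.
  by rewrite sqr_sqrtr; [lra|rewrite divr_ge0// ln_ge0// ler1n].
Qed.

Theorem theorem1p7 (R : realType) :
  let K : R := 76 in
  exists N : nat, forall n d : nat, (N <= n)%N -> (n < d)%N ->
  forall t : R,
    (`[0, gamma_minus R - K / n%:R] `|`
     `[gamma_minus R + K / n%:R, gamma_plus R - K / n%:R] `|`
     `[gamma_plus R + K / n%:R, Num.sqrt (ln n%:R / 6)]) t ->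
  forall a : 'rV[R]_d,
    @sphere_orthant R d a ->
    orthogonal_to_face_diagonal n (hyperplane t a) ->
    not_weakly_locally_extremal (@sphere_orthant R d) (section_volume t) a.
Proof.
move=> K; have [N HN] := slopes_opposite R.
exists (N + 10)%N => n d Nn nd t tR a aS an U aU.
have n10 : (10 <= n)%N by apply: leq_trans Nn; apply: leq_addl.
have n0 : (0 < n)%N by apply: leq_trans n10.
have [t0 tu tg] := range_cases n0 tR.
have := HN n t (leq_trans (leq_addr _ _) Nn) t0 tu tg.
have [S [Sn aE]] := normal_of_face_diagonal n0 aS an.
have {aE aS an} aE : a = \row_i ((Num.sqrt n%:R)^-1 * (i \in S)%:R).
  by apply/rowP => i; rewrite aE mxE.
have [j0 j0S] : exists j0, j0 \notin S.
  apply/existsP; rewrite -negb_forall; apply/negP => /forallP H.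
  move: nd; rewrite -Sn (_ : S = [set: 'I_d]%SET) ?cardsT ?card_ord ?ltnn//.
  by apply/setP => i; rewrite H inE.
have r0 : 0 < Num.sqrt n%:R :> R by rewrite sqrtr_gt0 ltr0n.
have ht := tail_variation t n10 Sn j0S; have hp := @pair_variation R d n t S n10 Sn.
have va := section_volume_diagonal t n10 Sn.
rewrite -aE in ht hp va; rewrite va.
move: ht hp; set u := tail_slope _ _; set v := pair_slope _ _; set v0 := _ * spline _ _ _.
move=> ht hp uv.
have u0 : u != 0 by apply: contraTneq uv => ->; rewrite mul0r ltxx.
have w0 : v != 0 by apply: contraTneq uv => ->; rewrite mulr0 ltxx.
have [|b1 [v1 [b1U b1v s1]]] := quadratic_variation_sign ht _ aU.
  by rewrite mulf_neq0// invr_neq0// mulf_neq0// gt_eqF.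
have [|b2 [v2 [b2U b2v s2]]] := quadratic_variation_sign hp _ aU.
  by rewrite mulf_neq0// invr_neq0.
have {}s1 : 0 < u * (v1 - v0).
  by move: s1; rewrite mulrAC pmulr_lgt0// invr_gt0 mulr_gt0.
have {}s2 : 0 < v * (v2 - v0) by move: s2; rewrite mulrAC pmulr_lgt0.
have [u1|u1|u1] := ltgtP u 0; last by rewrite u1 eqxx in u0.
- have v_gt0 : 0 < v by rewrite -(nmulr_rlt0 _ u1).
  exists b1, b2; split=> //; rewrite ?b1v ?b2v lte_fin -subr_gt0.
  + by rewrite -opprB oppr_gt0 -(nmulr_rgt0 _ u1).
  + by rewrite -(pmulr_rgt0 _ v_gt0).
- have v_lt0 : v < 0 by rewrite -(pmulr_rlt0 _ u1).
  exists b2, b1; split=> //; rewrite ?b1v ?b2v lte_fin -subr_gt0.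
  + by rewrite -opprB oppr_gt0 -(nmulr_rgt0 _ v_lt0).
  + by rewrite -(pmulr_rgt0 _ u1).
Qed.
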